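(* Let $k$ be an algebraically closed field of characteristic zero, let $p$ be a prime number, and let $H$ be a semisimple Hopf algebra over $k$ such that $\operatorname{c.d.}(H)=\{1,p\}$ and $|G(H^* )|=p$. Suppose that $H$ is quasitriangular. Then $G(H^* )\subseteq Z(H^* )$ and $H^*$ is nilpotent.
   Context: $\operatorname{c.d.}(H)$ is the set of dimensions of the irreducible representations of $H$. $G(H^* )$ is the group of group-like elements of $H^*$, and $Z(H^* )$ is the center of the algebra $H^*$. $H$ is quasitriangular if it admits an $R$-matrix, i.e. an invertible $R\in H\otimes H$ with $(\Delta\otimes\mathrm{id})(R)=R_{13}R_{23}$, $(\mathrm{id}\otimes\Delta)(R)=R_{13}R_{12}$, $(\epsilon\otimes\mathrm{id})(R)=1=(\mathrm{id}\otimes\epsilon)(R)$ and $\Delta^{\mathrm{cop}}(h)=R\Delta(h)R^{-1}$ for all $h\in H$. A semisimple Hopf algebra $A$ is nilpotent if the fusion category $\operatorname{Rep}A$ of its finite-dimensional representations is nilpotent: there are fusion categories $\mathcal C_0=\mathrm{Vec}_k,\mathcal C_1,\dots,\mathcal C_n=\operatorname{Rep}A$ and finite groups $G_1,\dots,G_n$ such that each $\mathcal C_i$ is faithfully graded by $G_i$ (i.e. $\mathcal C_i=\oplus_{g\in G_i}(\mathcal C_i)_g$ with nonzero full abelian subcategories $(\mathcal C_i)_g$, where $(\mathcal C_i)_g\otimes(\mathcal C_i)_h\subseteq(\mathcal C_i)_{gh}$ and $(\mathcal C_i)_g^*=(\mathcal C_i)_{g^{-1}}$) with trivial component $\mathcal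 C_{i-1}$. *)

(* Defs.v *)
From HB Require Import structures.
From mathcomp Require Import all_boot all_order all_algebra all_fingroup all_field.
From mathcomp Require Import boolp classical_sets functions cardinality.

Set Implicit Arguments.
Unset Strict Implicit.
Unset Printing Implicit Defensive.

Import GRing.Theory.
Local Open Scope ring_scope.

(* Tensor product of finite-dimensional vector spaces: t : tens V W is the    *)
(* matrix of coordinates of t on the family e_i (x) f_j, where e and f are    *)
(* the chosen bases of V and W; see tlift_tpure and tens_ind for the          *)
(* characteristic properties.                                                 *)
Definition tens (k : fieldType) (V W : vectType k) :=
  'M[k]_(\dim {:V}, \dim {:W}).

HB.instance Definition _ (k : fieldType) (V W : vectType k) :=
  Vector.on (tens V W).

Section Tensor.
Variable k : fieldType.

Definition bas (V : vectType k) (i : 'I_(\dim {:V})) : V := (vbasis {:V})`_i.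
Definition crd (V : vectType k) (v : V) (i : 'I_(\dim {:V})) : k :=
  coord (vbasis {:V}) i v.

Definition tpure (V W : vectType k) (v : V) (w : W) : tens V W :=
  \matrix_(i, j) (crd v i * crd w j).

(* The linear map V (x) W -> U induced by a bilinear map f : V -> W -> U.     *)
Definition tlift (V W U : vectType k) (f : V -> W -> U) (t : tens V W) : U :=
  \sum_i \sum_j t i j *: f (bas i) (bas j).

Definition bilin (V W U : vectType k) (f : V -> W -> U) : Prop :=
  (forall w, linear (f^~ w)) /\ (forall v, linear (f v)).

End Tensor.

Notation "v ⊗ w" := (tpure v w) (at level 40, left associativity) : ring_scope.

Section TensorTheory.
Variable k : fieldType.
Implicit Types V W U : vectType k.

Lemma crdP V (v : V) : v = \sum_i crd v i *: bas i.
Proof. exact: coord_vbasis (memvf v). Qed.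

Lemma crd_linear V i : scalar (fun v : V => crd v i).
Proof. by move=> a u v; rewrite /crd linearP. Qed.

Lemma bas_neq0 V (v : V) : v != 0 -> exists i, crd v i != 0.
Proof.
move=> v0; apply/existsP; apply: contraNT v0; rewrite negb_exists.
move/forallP=> v0; rewrite (crdP v) big1 // => i _.
by move: (v0 i); rewrite negbK => /eqP->; rewrite scale0r.
Qed.

Lemma crd_bas V (i j : 'I_(\dim {:V})) : crd (bas i) j = (i == j)%:R.
Proof. exact: coord_free (basis_free (vbasisP _)). Qed.

Fact tlift_linear V W U (f : V -> W -> U) : linear (tlift f).
Proof.
move=> a s t; rewrite /tlift scaler_sumr -big_split; apply: eq_bigr => i _ /=.
rewrite scaler_sumr -big_split; apply: eq_bigr => j _ /=.
by rewrite !mxE scalerDl scalerA.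
Qed.

HB.instance Definition _ V W U (f : V -> W -> U) :=
  GRing.isLinear.Build k (tens V W) U _ (tlift f) (tlift_linear f).

Lemma tpure_bilin V W : bilin (@tpure k V W).
Proof.
split=> [w|v] a x y; apply/matrixP=> i j; rewrite !mxE crd_linear.
  by rewrite mulrDl mulrA.
by rewrite mulrDr mulrCA.
Qed.

Lemma bilinDl V W U (f : V -> W -> U) : bilin f ->
  forall u v w, f (u + v) w = f u w + f v w.
Proof. by case=> fl _ u v w; have := fl w 1 u v; rewrite !scale1r. Qed.
Lemma bilinDr V W U (f : V -> W -> U) : bilin f ->
  forall v u w, f v (u + w) = f v u + f v w.
Proof. by case=> _ fr v u w; have := fr v 1 u w; rewrite !scale1r. Qed.
Lemma bilin0l V W U (f : V -> W -> U) : bilin f -> forall w, f 0 w = 0.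
Proof.
by move=> bf w; apply: (addIr (f 0 w)); rewrite -(bilinDl bf) !add0r.
Qed.
Lemma bilin0r V W U (f : V -> W -> U) : bilin f -> forall v, f v 0 = 0.
Proof.
by move=> bf v; apply: (addIr (f v 0)); rewrite -(bilinDr bf) !add0r.
Qed.
Lemma bilinZl V W U (f : V -> W -> U) : bilin f ->
  forall a v w, f (a *: v) w = a *: f v w.
Proof.
by move=> bf a v w; have := bf.1 w a v 0; rewrite (bilin0l bf) !addr0.
Qed.
Lemma bilinZr V W U (f : V -> W -> U) : bilin f ->
  forall a v w, f v (a *: w) = a *: f v w.
Proof.
by move=> bf a v w; have := bf.2 v a w 0; rewrite (bilin0r bf) !addr0.
Qed.

Lemma bilin_suml V W U (f : V -> W -> U) : bilin f ->
  forall (I : finType) (v : I -> V) w, f (\sum_i v i) w = \sum_i f (v i) w.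
Proof.
move=> bf I v w; pose h := (f^~ w).
by apply: (big_morph h) => [x y|]; rewrite /h ?(bilinDl bf) ?(bilin0l bf).
Qed.
Lemma bilin_sumr V W U (f : V -> W -> U) : bilin f ->
  forall (I : finType) v (w : I -> W), f v (\sum_i w i) = \sum_i f v (w i).
Proof.
move=> bf I v w.
by apply: (big_morph (f v)) => [x y|]; rewrite ?(bilinDr bf) ?(bilin0r bf).
Qed.

Lemma tlift_tpure V W U (f : V -> W -> U) : bilin f ->
  forall v w, tlift f (v ⊗ w) = f v w.
Proof.
move=> bf v w; rewrite [in RHS](crdP v) (bilin_suml bf); apply: eq_bigr => i _.
rewrite [in RHS](crdP w) (bilin_sumr bf); apply: eq_bigr => j _.
by rewrite mxE (bilinZl bf) (bilinZr bf) scalerA.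
Qed.

Lemma tens_basE V W (t : tens V W) : t = \sum_i \sum_j t i j *: (bas i ⊗ bas j).
Proof.
apply/matrixP=> i0 j0.
rewrite [RHS](@summxE) (bigD1 i0) //= [X in _ = X + _]summxE (bigD1 j0) //=.
rewrite !mxE !crd_bas !eqxx !mulr1 !big1 ?addr0 // => [i /negPf ii0|j /negPf jj0].
  by rewrite summxE big1 // => j _; rewrite !mxE !crd_bas ii0 mul0r mulr0.
by rewrite !mxE !crd_bas jj0 !mulr0.
Qed.

Lemma tens_ind V W (P : tens V W -> Prop) : P 0 ->
  (forall s t, P s -> P t -> P (s + t)) -> (forall v w, P (v ⊗ w)) ->
  forall t, P t.
Proof.
move=> P0 PD Pv t; rewrite (tens_basE t).
apply: (big_ind P) => // i _; apply: (big_ind P) => // j _.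
by rewrite -(bilinZl (@tpure_bilin V W)).
Qed.

Lemma tpure_neq0 V W (v : V) (w : W) : v != 0 -> w != 0 -> v ⊗ w != 0.
Proof.
move=> /bas_neq0[i vi] /bas_neq0[j wj]; apply/eqP=> /matrixP/(_ i j)/eqP.
by rewrite !mxE mulf_eq0 (negPf vi) (negPf wj).
Qed.

Lemma tlift_fun_linear V W U (f g h : V -> W -> U) a :
  (forall v w, f v w = a *: g v w + h v w) ->
  forall t, tlift f t = a *: tlift g t + tlift h t.
Proof.
move=> fE t; rewrite /tlift scaler_sumr -big_split; apply: eq_bigr => i _ /=.
rewrite scaler_sumr -big_split; apply: eq_bigr => j _ /=.
by rewrite fE scalerDr !scalerA mulrC.
Qed.

Lemma eq_tlift V W U (f g : V -> W -> U) :
  (forall v w, f v w = g v w) -> forall t, tlift f t = tlift g t.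
Proof.
by move=> fg t; apply: eq_bigr => i _; apply: eq_bigr => j _; rewrite fg.
Qed.

Lemma linear_tlift V W U U' (g : {linear U -> U'}) (f : V -> W -> U) t :
  g (tlift f t) = tlift (fun v w => g (f v w)) t.
Proof.
rewrite linear_sum; apply: eq_bigr => i _; rewrite linear_sum.
by apply: eq_bigr => j _; rewrite linearZ.
Qed.

Lemma tlift_funD V W U (f g h : V -> W -> U) :
  (forall v w, f v w = g v w + h v w) ->
  forall t, tlift f t = tlift g t + tlift h t.
Proof.
move=> fE t; rewrite -[tlift g t]scale1r.
by apply: tlift_fun_linear => v w; rewrite scale1r.
Qed.

Lemma tlift_bilin_arg V W U V' W' (f : V -> W -> V' -> W' -> U) :
  (forall v' w', bilin (fun v w => f v w v' w')) ->
  forall s, bilin (fun v w => tlift (f v w) s).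
Proof.
move=> bf s; split=> [w|v] a x y; apply: tlift_fun_linear => v' w'.
  by rewrite (bf _ _).1.
by rewrite (bf _ _).2.
Qed.

Lemma linear_comp_bilin V W U U' (g : {linear U -> U'}) (f : V -> W -> U) :
  bilin f -> bilin (fun v w => g (f v w)).
Proof. by case=> fl fr; split=> [w|v] a x y; rewrite ?fl ?fr linearP. Qed.

Lemma bilin_comp V W U V' W' (f : V -> W -> U) (g : {linear V' -> V})
  (h : {linear W' -> W}) : bilin f -> bilin (fun v w => f (g v) (h w)).
Proof. by case=> fl fr; split=> [w|v] a x y; rewrite linearP ?fl ?fr. Qed.

Definition hom2 V W U (f : V -> W -> U) : 'Hom(V, 'Hom(W, U)) :=
  linfun (fun v => linfun (f v)).

Lemma hom2E V W U (f : V -> W -> U) v w : bilin f -> hom2 f v w = f v w.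
Proof.
move=> bf; have E1 x y : linfun (f x) y = f x y.
  pose L := GRing.isLinear.Build k W U _ (f x) (bf.2 x).
  by pose fl : {linear W -> U} := HB.pack (f x) L; rewrite (lfunE fl).
have hl : linear (fun x => linfun (f x)).
  move=> a x y; apply/lfunP=> z.
  by rewrite add_lfunE scale_lfunE !E1 bf.1.
pose L := GRing.isLinear.Build k V 'Hom(W, U) _ _ hl.
pose fl : {linear V -> 'Hom(W, U)} := HB.pack (fun x => linfun (f x)) L.
by rewrite /hom2 (lfunE fl) /= E1.
Qed.

Lemma mul_bilin (A : falgType k) : bilin (fun a b : A => a * b).
Proof.
split=> [w|v] a x y /=; first by rewrite mulrDl scalerAl.
by rewrite mulrDr scalerAr.
Qed.

End TensorTheory.

Section TensorMaps.
Variable k : fieldType.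
Implicit Types V W U : vectType k.

Definition tmap V W V' W' (f : V -> V') (g : W -> W') : tens V W -> tens V' W' :=
  tlift (fun v w => f v ⊗ g w).

Definition tswap V W : tens V W -> tens W V := tlift (fun v w => w ⊗ v).

Definition tassoc V W U : tens (tens V W) U -> tens V (tens W U) :=
  tlift (fun s u => tlift (fun v w => v ⊗ (w ⊗ u)) s).

HB.instance Definition _ V W V' W' (f : V -> V') (g : W -> W') :=
  GRing.isLinear.Build k (tens V W) (tens V' W') _ (tmap f g)
    (tlift_linear (fun v w => f v ⊗ g w)).
HB.instance Definition _ V W :=
  GRing.isLinear.Build k (tens V W) (tens W V) _ (@tswap V W)
    (tlift_linear (fun v w => w ⊗ v)).
HB.instance Definition _ V W U :=
  GRing.isLinear.Build k (tens (tens V W) U) (tens V (tens W U)) _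
    (@tassoc V W U)
    (tlift_linear (fun s u => tlift (fun v w => v ⊗ (w ⊗ u)) s)).

Lemma tmap_tpure V W V' W' (f : {linear V -> V'}) (g : {linear W -> W'}) v w :
  tmap f g (v ⊗ w) = f v ⊗ g w.
Proof. exact: (tlift_tpure (bilin_comp f g (@tpure_bilin k V' W'))). Qed.

Lemma tswap_tpure V W (v : V) (w : W) : tswap (v ⊗ w) = w ⊗ v.
Proof.
rewrite /tswap tlift_tpure //.
by split=> [x|x] a y z; rewrite ?(tpure_bilin _ _).1 ?(tpure_bilin _ _).2.
Qed.

Lemma tassoc_tpure V W U (v : V) (w : W) (u : U) :
  tassoc ((v ⊗ w) ⊗ u) = v ⊗ (w ⊗ u).
Proof.
have tb := @tpure_bilin k.
rewrite /tassoc tlift_tpure ?tlift_tpure //.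
  split=> [x|x] a y z /=; first by rewrite (tb _ _).1.
  by rewrite (tb _ _).1 (tb _ _).2.
split=> [x|x] a y z; first by rewrite linearP.
by apply: tlift_fun_linear => v' w'; rewrite !(tb _ _).2.
Qed.

End TensorMaps.

(* The algebra A (x) B, with (a (x) b) (a' (x) b') = a a' (x) b b'.           *)
Section TensorAlgebra.
Variables (k : fieldType) (A B : falgType k).

Definition tone : tens A B := 1 ⊗ 1.
Definition tmul (s t : tens A B) : tens A B :=
  tlift (fun a b => tlift (fun a' b' => (a * a') ⊗ (b * b')) t) s.

Let tb := @tpure_bilin k A B.

Lemma tmul_bilin_in1 a b :
  bilin (fun a' b' => (a * a') ⊗ (b * b') : tens A B).
Proof.
by split=> [w|v] c x y; rewrite mulrDr -scalerAr ?tb.1 ?tb.2.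
Qed.
Lemma tmul_bilin_in2 a' b' :
  bilin (fun a b => (a * a') ⊗ (b * b') : tens A B).
Proof.
by split=> [w|v] c x y; rewrite mulrDl -scalerAl ?tb.1 ?tb.2.
Qed.

Lemma tmul_bilin : bilin tmul.
Proof.
split=> [t|s]; first exact: tlift_linear.
by move=> c x y; apply: tlift_fun_linear => a b; rewrite linearP.
Qed.

Lemma tmul_pure a b a' b' : tmul (a ⊗ b) (a' ⊗ b') = (a * a') ⊗ (b * b').
Proof.
rewrite /tmul tlift_tpure; last exact: tlift_bilin_arg tmul_bilin_in2 _.
by rewrite tlift_tpure //; exact: tmul_bilin_in1.
Qed.

Fact tmulA : associative tmul.
Proof.
have b := tmul_bilin.
elim/tens_ind=> [||a1 b1]; first by move=> y z; rewrite !(bilin0l b).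
  by move=> s t IHs IHt y z; rewrite !(bilinDl b) IHs IHt.
elim/tens_ind=> [||a2 b2].
- by move=> z; rewrite (bilin0l b) (bilin0r b) (bilin0l b).
- by move=> s t IHs IHt z; rewrite (bilinDl b) !(bilinDr b) (bilinDl b) IHs IHt.
elim/tens_ind=> [|s t IHs IHt|a3 b3]; first by rewrite !(bilin0r b).
  by rewrite !(bilinDr b) IHs IHt.
by rewrite !tmul_pure !mulrA.
Qed.

Fact tmul1 : left_id tone tmul.
Proof.
have b := tmul_bilin.
elim/tens_ind=> [|s t IHs IHt|a1 b1]; first by rewrite (bilin0r b).
  by rewrite (bilinDr b) IHs IHt.
by rewrite tmul_pure !mul1r.
Qed.

Fact tmul1r : right_id tone tmul.
Proof.
have b := tmul_bilin.
elim/tens_ind=> [|s t IHs IHt|a1 b1]; first by rewrite (bilin0l b).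
  by rewrite (bilinDl b) IHs IHt.
by rewrite tmul_pure !mulr1.
Qed.

Fact tmulDl : left_distributive tmul +%R.
Proof. by move=> x y z; rewrite (bilinDl tmul_bilin). Qed.
Fact tmulDr : right_distributive tmul +%R.
Proof. by move=> x y z; rewrite (bilinDr tmul_bilin). Qed.
Fact tone_neq0 : tone != 0.
Proof. by rewrite tpure_neq0 ?oner_neq0. Qed.

HB.instance Definition _ := GRing.Zmodule_isNzRing.Build (tens A B)
  tmulA tmul1 tmul1r tmulDl tmulDr tone_neq0.

Fact tmulZl (c : k) (x y : tens A B) : c *: (x * y) = (c *: x) * y.
Proof. exact: esym (bilinZl tmul_bilin c x y). Qed.
Fact tmulZr (c : k) (x y : tens A B) : c *: (x * y) = x * (c *: y).
Proof. exact: esym (bilinZr tmul_bilin c x y). Qed.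

HB.instance Definition _ := GRing.Lmodule_isLalgebra.Build k (tens A B) tmulZl.
HB.instance Definition _ := GRing.Lalgebra_isAlgebra.Build k (tens A B) tmulZr.
HB.instance Definition _ := Algebra_isFalgebra.Build k (tens A B).

End TensorAlgebra.


HB.mixin Record isHopf (k : fieldType) H of Falgebra k H := {
  comul : {linear H -> tens H H};
  counit : {linear H -> k^o};
  antipode : {linear H -> H};
  comulA : forall h : H,
    tassoc (tmap comul idfun (comul h)) = tmap idfun comul (comul h);
  counitl : forall h : H, tlift (fun x y : H => counit x *: y) (comul h) = h;
  counitr : forall h : H, tlift (fun x y : H => counit y *: x) (comul h) = h;
  comul1 : comul 1 = 1;
  comulM : {morph comul : x y / x * y};
  counit1 : counit 1 = 1;
  counitM : {morph counit : x y / x * y};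
  antipodel : forall h : H,
    tlift (fun x y : H => antipode x * y) (comul h) = counit h *: 1;
  antipoder : forall h : H,
    tlift (fun x y : H => x * antipode y) (comul h) = counit h *: 1
}.

#[short(type="hopfAlgType")]
HB.structure Definition HopfAlgebra (k : fieldType) :=
  { H of Falgebra k H & isHopf k H }.

Definition vdual (k : fieldType) (V : vectType k) := 'Hom(V, k^o).

HB.instance Definition _ (k : fieldType) (V : vectType k) :=
  Vector.on (vdual V).

Section DualTensors.
Variable k : fieldType.
Implicit Types V W U : vectType k.

Lemma bilin_mulk V W (f : {linear V -> k^o}) (g : {linear W -> k^o}) :
  bilin (fun v w => f v * g w : k^o).
Proof.
split=> [w|v] a x y; rewrite linearP /=; first by rewrite mulrDl -scalerAl.
by rewrite mulrDr -scalerAr.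
Qed.

Definition dbas V (i : 'I_(\dim {:V})) : vdual V :=
  linfun (coord (vbasis {:V}) i : V -> k^o).

Lemma dbasE V (i : 'I_(\dim {:V})) v : dbas i v = crd v i.
Proof. by rewrite lfunE. Qed.

Lemma dbas_sum V (f : vdual V) : f = \sum_i f (bas i) *: dbas i.
Proof.
apply/lfunP=> v; rewrite sum_lfunE {1}(crdP v) linear_sum; apply: eq_bigr => i _.
by rewrite linearZ scale_lfunE /= dbasE [LHS]mulrC.
Qed.

Definition contract V U (v : V) (s : tens (vdual V) U) : U :=
  tlift (fun (f : vdual V) u => (f v : k) *: u) s.

Lemma contract_bilin_arg V U (v : V) :
  bilin (fun (f : vdual V) (u : U) => (f v : k) *: u).
Proof.
split=> [w|f] a x y /=.
  by rewrite add_lfunE scale_lfunE scalerDl scalerA.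
by rewrite scalerDr !scalerA mulrC.
Qed.

Lemma contract_pure V U (v : V) f (u : U) :
  contract v ((f : vdual V) ⊗ u) = (f v : k) *: u.
Proof. exact: tlift_tpure (contract_bilin_arg U v) f u. Qed.

HB.instance Definition _ V U (v : V) :=
  GRing.isLinear.Build k (tens (vdual V) U) U _ (@contract V U v)
    (tlift_linear (fun (f : vdual V) u => (f v : k) *: u)).

Lemma contract_inj V U (s t : tens (vdual V) U) :
  (forall v, contract v s = contract v t) -> s = t.
Proof.
have K r : r = \sum_i dbas i ⊗ contract (bas i) r :> tens (vdual V) U.
  elim/tens_ind: r => [|x y IHx IHy|f u].
  - by rewrite big1 // => i _; rewrite linear0 (bilin0r (@tpure_bilin _ _ _)).
  - rewrite {1}IHx {1}IHy -big_split; apply: eq_bigr => i _ /=.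
    by rewrite linearD (bilinDr (@tpure_bilin _ _ _)).
  rewrite {1}(dbas_sum f) (bilin_suml (@tpure_bilin _ _ _)).
  apply: eq_bigr => i _; rewrite contract_pure.
  by rewrite (bilinZl (@tpure_bilin _ _ _)) (bilinZr (@tpure_bilin _ _ _)).
by move=> st; rewrite (K s) (K t); apply: eq_bigr => i _; rewrite st.
Qed.

Definition eval2 V W (s : tens (vdual V) (vdual W)) (v : V) (w : W) : k :=
  contract v s w.

Lemma eval2D V W (s t : tens (vdual V) (vdual W)) v w :
  eval2 (s + t) v w = eval2 s v w + eval2 t v w.
Proof. by rewrite /eval2 linearD add_lfunE. Qed.
Lemma eval20 V W v w : @eval2 V W 0 v w = 0.
Proof. by rewrite /eval2 linear0 zero_lfunE. Qed.
Lemma eval2_pure V W f g v w : @eval2 V W (f ⊗ g) v w = f v * g w.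
Proof. by rewrite /eval2 contract_pure scale_lfunE. Qed.

Lemma eval2_inj V W (s t : tens (vdual V) (vdual W)) :
  (forall v w, eval2 s v w = eval2 t v w) -> s = t.
Proof. by move=> st; apply: contract_inj => v; apply/lfunP=> w; apply: st. Qed.

Lemma eval2E V W (s : tens (vdual V) (vdual W)) v w :
  eval2 s v w =
    tlift (fun (f : vdual V) (g : vdual W) => f v * g w : k^o) s.
Proof.
elim/tens_ind: s => [|x y IHx IHy|f g].
- by rewrite eval20 linear0.
- by rewrite eval2D IHx IHy linearD.
rewrite eval2_pure tlift_tpure //; split=> [h|h] a x y /=.
  by rewrite add_lfunE scale_lfunE mulrDl -scalerAl.
by rewrite add_lfunE scale_lfunE mulrDr -scalerAr.
Qed.

Lemma eval2_bilin V W (s : tens (vdual V) (vdual W)) :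
  bilin (fun v w => eval2 s v w : k^o).
Proof.
elim/tens_ind: s => [|x y IHx IHy|f g].
- by split=> [w|v] a x y; rewrite !eval20 scaler0 addr0.
- by split=> [w|v] a u v'; rewrite !eval2D ?IHx.1 ?IHy.1 ?IHx.2 ?IHy.2
    scalerDr addrACA.
by split=> [w|v] a x y; rewrite !eval2_pure (bilin_mulk _ _).1 ||
   rewrite !eval2_pure (bilin_mulk _ _).2.
Qed.

(* The element s of V* (x) W* = (V (x) W)* with s(v (x) w) = B v w.           *)
Definition of_bil V W (B : V -> W -> k) : tens (vdual V) (vdual W) :=
  \sum_i \sum_j B (bas i) (bas j) *: (dbas i ⊗ dbas j).

Lemma eval2_of_bil V W (B : V -> W -> k) :
  bilin (B : V -> W -> k^o) -> forall v w, eval2 (of_bil B) v w = B v w.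
Proof.
move=> bB v w; rewrite [in RHS](crdP v) (bilin_suml bB) /eval2 /of_bil.
rewrite linear_sum sum_lfunE; apply: eq_bigr => i _ /=.
rewrite [in RHS](crdP w) (bilin_sumr bB) linear_sum sum_lfunE.
apply: eq_bigr => j _; rewrite (bilinZl bB) (bilinZr bB) linearZ /=.
rewrite contract_pure !scale_lfunE !dbasE.
by rewrite -[LHS]/(_ * (_ * _)) -[RHS]/(_ * (_ * _)) mulrCA [X in _ * X = _]mulrC.
Qed.

End DualTensors.

(* The convolution product of linear maps H -> A.                              *)
Section Convolution.
Variables (k : fieldType) (H : hopfAlgType k) (A : falgType k).
Implicit Types (f g : 'Hom(H, A)).

Definition cmul f g : 'Hom(H, A) :=
  linfun (tlift (fun x y => f x * g y) \o comul).
Definition cunit : 'Hom(H, A) := linfun (fun x => (counit x : k) *: (1 : A)).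

Lemma cmulE f g x : cmul f g x = tlift (fun x y => f x * g y) (comul x).
Proof. by rewrite lfunE. Qed.
Lemma cunitE x : cunit x = (counit x : k) *: 1.
Proof.
pose u (x : H) : A := (counit x : k) *: 1.
have ul : linear u by move=> a y z; rewrite /u linearP scalerDl scalerA.
pose uL : {linear H -> A} := HB.pack u (GRing.isLinear.Build k H A _ u ul).
by rewrite (lfunE uL).
Qed.

Lemma mul_lin_bilin (V W : vectType k) (f : {linear V -> A})
  (g : {linear W -> A}) : bilin (fun v w => f v * g w).
Proof. exact: (bilin_comp f g (@mul_bilin k A)). Qed.

Fact cmulA : associative cmul.
Proof.
move=> f g l; apply/lfunP=> h; rewrite !cmulE.
pose T3 : {linear tens H (tens H H) -> A} :=
  tlift (fun x s => f x * tlift (fun y z => g y * l z) s).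
have T3E x y z : T3 (x ⊗ (y ⊗ z)) = f x * (g y * l z).
  rewrite /T3 /= tlift_tpure; last exact: mul_lin_bilin.
  by rewrite tlift_tpure //; apply: mul_lin_bilin.
have tb := @tpure_bilin k.
have E0 x s : T3 (x ⊗ s) = f x * tlift (fun y z => g y * l z) s.
  by rewrite /T3 /= tlift_tpure //; apply: mul_lin_bilin.
have E1 s : T3 (tmap idfun comul s) = tlift (fun x y => f x * cmul g l y) s.
  elim/tens_ind: s => [|x y IHx IHy|x y]; first by rewrite !linear0.
    by rewrite !linearD /= IHx IHy.
  by rewrite tmap_tpure E0 tlift_tpure ?cmulE //; apply: mul_lin_bilin.
have E2 y u : T3 (tassoc (u ⊗ y)) = tlift (fun x y : H => f x * g y) u * l y.
  elim/tens_ind: u => [|a b IHa IHb|a b].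
  - by rewrite (bilin0l (tb _ _)) !linear0 mul0r.
  - by rewrite (bilinDl (tb _ _)) !linearD /= mulrDl IHa IHb.
  by rewrite tassoc_tpure T3E tlift_tpure ?mulrA //; apply: mul_lin_bilin.
have E3 s : T3 (tassoc (tmap comul idfun s)) =
    tlift (fun x y => cmul f g x * l y) s.
  elim/tens_ind: s => [|x y IHx IHy|x y]; first by rewrite !linear0.
    by rewrite !linearD /= IHx IHy.
  by rewrite tmap_tpure E2 tlift_tpure ?cmulE //; apply: mul_lin_bilin.
by rewrite -E1 -E3 comulA.
Qed.

Fact cmul1 : left_id cunit cmul.
Proof.
move=> f; apply/lfunP=> h; rewrite cmulE -[in RHS](counitl h).
rewrite linear_tlift; apply: eq_tlift => x y.
by rewrite cunitE -scalerAl mul1r linearZ.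
Qed.

Fact cmul1r : right_id cunit cmul.
Proof.
move=> f; apply/lfunP=> h; rewrite cmulE -[in RHS](counitr h).
rewrite linear_tlift; apply: eq_tlift => x y.
by rewrite cunitE -scalerAr mulr1 linearZ.
Qed.

Fact cmul_bilin : bilin cmul.
Proof.
split=> [g|f] a u v; apply/lfunP=> h; rewrite add_lfunE scale_lfunE !cmulE;
  apply: tlift_fun_linear => x y; rewrite add_lfunE scale_lfunE.
  by rewrite mulrDl -scalerAl.
by rewrite mulrDr -scalerAr.
Qed.

Fact cunit_neq0 : cunit != 0.
Proof.
apply/eqP=> /lfunP/(_ 1); rewrite cunitE counit1 zero_lfunE scale1r => /eqP.
by rewrite oner_eq0.
Qed.

Definition conv := 'Hom(H, A).
HB.instance Definition _ := Vector.on conv.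

Fact cmulDl : left_distributive cmul +%R.
Proof. by move=> x y z; rewrite (bilinDl cmul_bilin). Qed.
Fact cmulDr : right_distributive cmul +%R.
Proof. by move=> x y z; rewrite (bilinDr cmul_bilin). Qed.

HB.instance Definition _ := GRing.Zmodule_isNzRing.Build conv
  cmulA cmul1 cmul1r cmulDl cmulDr cunit_neq0.

Fact cmulZl (c : k) (x y : conv) : c *: (x * y) = (c *: x) * y.
Proof. exact: esym (bilinZl cmul_bilin c x y). Qed.
Fact cmulZr (c : k) (x y : conv) : c *: (x * y) = x * (c *: y).
Proof. exact: esym (bilinZr cmul_bilin c x y). Qed.

HB.instance Definition _ := GRing.Lmodule_isLalgebra.Build k conv cmulZl.
HB.instance Definition _ := GRing.Lalgebra_isAlgebra.Build k conv cmulZr.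
HB.instance Definition _ := Algebra_isFalgebra.Build k conv.

End Convolution.

Lemma antipode1 (k : fieldType) (H : hopfAlgType k) : antipode 1 = 1 :> H.
Proof.
have := antipodel (1 : H); rewrite comul1 counit1 scale1r.
rewrite -[X in tlift _ X]/(1 ⊗ 1) tlift_tpure ?mulr1 //.
exact: (bilin_comp _ idfun (@mul_bilin k H)).
Qed.

Lemma tlift_mul (k : fieldType) (A B : falgType k) (U : vectType k)
    (f : A -> B -> U) (s t : tens A B) : bilin f ->
  tlift f (s * t) = tlift (fun u1 u2 =>
    tlift (fun v1 v2 => f (u1 * v1) (u2 * v2)) t) s.
Proof.
move=> bf.
have b1 u1 u2 : bilin (fun v1 v2 => f (u1 * v1) (u2 * v2)).
  by split=> [w|v] c a b; rewrite mulrDr -scalerAr ?bf.1 ?bf.2.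
have b2 v1 v2 : bilin (fun u1 u2 => f (u1 * v1) (u2 * v2)).
  by split=> [w|v] c a b; rewrite mulrDl -scalerAl ?bf.1 ?bf.2.
elim/tens_ind: s => [|s s' IHs IHt|u1 u2]; first by rewrite mul0r !linear0.
  by rewrite mulrDl !linearD /= IHs IHt.
rewrite tlift_tpure; last exact: tlift_bilin_arg.
elim/tens_ind: t => [|t t' IHs IHt|v1 v2]; first by rewrite mulr0 !linear0.
  by rewrite mulrDr !linearD /= IHs IHt.
by rewrite tlift_tpure // -[_ * _]/(tmul _ _) tmul_pure tlift_tpure.
Qed.

Lemma antipodeM (k : fieldType) (H : hopfAlgType k) (x y : H) :
  antipode (x * y) = antipode y * antipode x.
Proof.
have mb : bilin (fun x y : H => x * y) := @mul_bilin k H.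
have fb : bilin (fun x y : H => antipode y * antipode x).
  by split=> [w|v] a u u'; rewrite linearP ?mulrDr ?mulrDl -?scalerAr -?scalerAl.
have gb : bilin (fun x y : H => antipode (x * y)) := linear_comp_bilin antipode mb.
pose F : 'Hom(H, conv H H) := hom2 (fun x y : H => antipode y * antipode x).
pose G : 'Hom(H, conv H H) := hom2 (fun x y : H => x * y).
pose K : 'Hom(H, conv H H) := hom2 (fun x y : H => antipode (x * y)).
have cE (P Q : 'Hom(H, conv H H)) u v : cmul P Q u v =
    tlift (fun u1 u2 => tlift (fun v1 v2 => P u1 v1 * Q u2 v2) (comul v))
          (comul u).
  rewrite cmulE.
  pose ev (p : conv H H) := p v.
  have evl : linear ev by move=> a p q; rewrite /ev add_lfunE scale_lfunE.
  pose evL : {linear conv H H -> H} :=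
    HB.pack ev (GRing.isLinear.Build k (conv H H) H _ ev evl).
  rewrite -[LHS]/(evL _) linear_tlift; apply: eq_tlift => u1 u2 /=.
  by rewrite /ev -[LHS]/(cmul _ _ v) cmulE.
have oneE u v : cunit H (conv H H) u v = (counit u * counit v : k) *: 1.
  by rewrite cunitE scale_lfunE -[(1 : conv H H) v]/(cunit H H v) cunitE scalerA.
have FG : cmul F G = cunit H (conv H H).
  apply/lfunP=> u; apply/lfunP=> v; rewrite cE oneE.
  have E t : tlift (fun u1 u2 : H =>
      tlift (fun v1 v2 : H => F u1 v1 * G u2 v2) t) (comul u) =
      (counit u : k) *: tlift (fun v1 v2 : H => antipode v1 * v2) t.
    have ab : bilin (fun v1 v2 : H => antipode v1 * v2).
      exact: (bilin_comp _ idfun mb).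
    elim/tens_ind: t => [|t t' IHt IHt'|v1 v2].
    - rewrite linear0 scaler0 [LHS]big1 // => i _; rewrite big1 // => j _.
      by rewrite linear0 scaler0.
    - rewrite linearD scalerDr -IHt -IHt'.
      by apply: tlift_funD => u1 u2; rewrite linearD.
    rewrite [in RHS]tlift_tpure // -[v2 in RHS]mul1r [in RHS]mulrA.
    rewrite scalerAl scalerAr -antipodel.
    pose ml z : H := antipode v1 * z * v2.
    have mll : linear ml.
      by move=> a z z'; rewrite /ml mulrDr mulrDl -scalerAr -scalerAl.
    pose mL : {linear H -> H} := HB.pack ml (GRing.isLinear.Build k H H _ ml mll).
    rewrite -[RHS]/(mL _) linear_tlift; apply: eq_tlift => u1 u2 /=.
    rewrite tlift_tpure ?/F ?/G ?hom2E //; first by rewrite /ml !mulrA.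
    split=> [w|w] a z z'; first by rewrite linearP mulrDl -scalerAl.
    by rewrite linearP mulrDr -scalerAr.
  by rewrite E antipodel scalerA.
have GK : cmul G K = cunit H (conv H H).
  apply/lfunP=> u; apply/lfunP=> v; rewrite cE oneE -counitM -antipoder comulM.
  rewrite tlift_mul; last exact: (bilin_comp idfun _ mb).
  by apply: eq_tlift => u1 u2; apply: eq_tlift => v1 v2; rewrite /G /K !hom2E.
have : F = K by rewrite -[F]cmul1r -GK cmulA FG cmul1.
by move=> /lfunP /(_ x) /lfunP /(_ y); rewrite /F /K !hom2E.
Qed.

(* The dual Hopf algebra H*: convolution product, unit the counit of H,      *)
(* coproduct determined by dcomulE, counit f |-> f 1, antipode f |-> f \o S. *)
Section DualHopf.
Variables (k : fieldType) (H : hopfAlgType k).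
Local Notation D := (vdual H).
Implicit Types (f g : D) (x y : H).

Definition dmul f g : D := @cmul k H k^o f g.
Definition dunit : D := cunit H k^o.
Definition dcomul f : tens D D := of_bil (fun x y => f (x * y)).
Definition dcounit f : k^o := f 1.
Definition dantipode f : D := linfun (f \o antipode).

Lemma dmulE f g x : dmul f g x = tlift (fun x y => f x * g y : k^o) (comul x).
Proof. exact: cmulE. Qed.
Lemma dunitE x : dunit x = counit x.
Proof. by rewrite cunitE; apply: mulr1. Qed.
Lemma dantipodeE f x : dantipode f x = f (antipode x).
Proof. by rewrite lfunE. Qed.
Lemma dcomulE f x y : eval2 (dcomul f) x y = f (x * y).
Proof.
exact: (eval2_of_bil (linear_comp_bilin f (@mul_bilin k H))).
Qed.

Fact dmulA : associative dmul. Proof. exact: cmulA. Qed.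
Fact dmul1 : left_id dunit dmul. Proof. exact: cmul1. Qed.
Fact dmul1r : right_id dunit dmul. Proof. exact: cmul1r. Qed.
Fact dmul_bilin : bilin dmul. Proof. exact: cmul_bilin. Qed.
Fact dunit_neq0 : dunit != 0. Proof. exact: cunit_neq0. Qed.

Fact dmulDl : left_distributive dmul +%R.
Proof. by move=> x y z; rewrite (bilinDl dmul_bilin). Qed.
Fact dmulDr : right_distributive dmul +%R.
Proof. by move=> x y z; rewrite (bilinDr dmul_bilin). Qed.
HB.instance Definition _ := GRing.Zmodule_isNzRing.Build D
  dmulA dmul1 dmul1r dmulDl dmulDr dunit_neq0.

Fact dmulZl (c : k) (x y : D) : c *: (x * y) = (c *: x) * y.
Proof. exact: esym (bilinZl dmul_bilin c x y). Qed.
Fact dmulZr (c : k) (x y : D) : c *: (x * y) = x * (c *: y).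
Proof. exact: esym (bilinZr dmul_bilin c x y). Qed.

HB.instance Definition _ := GRing.Lmodule_isLalgebra.Build k D dmulZl.
HB.instance Definition _ := GRing.Lalgebra_isAlgebra.Build k D dmulZr.
HB.instance Definition _ := Algebra_isFalgebra.Build k D.

Fact dcomul_linear : linear dcomul.
Proof.
move=> a f g; apply: eval2_inj => x y.
have -> : eval2 (a *: dcomul f + dcomul g) x y =
    a * eval2 (dcomul f) x y + eval2 (dcomul g) x y.
  by rewrite eval2D /eval2 linearZ /= scale_lfunE.
by rewrite !dcomulE add_lfunE scale_lfunE.
Qed.
Fact dcounit_linear : linear dcounit.
Proof. by move=> a f g; rewrite /dcounit add_lfunE scale_lfunE. Qed.
Fact dantipode_linear : linear dantipode.
Proof.
move=> a f g; apply/lfunP=> x.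
by rewrite add_lfunE scale_lfunE !dantipodeE add_lfunE scale_lfunE.
Qed.

HB.instance Definition _ :=
  GRing.isLinear.Build k D (tens D D) _ dcomul dcomul_linear.
HB.instance Definition _ :=
  GRing.isLinear.Build k D k^o _ dcounit dcounit_linear.
HB.instance Definition _ :=
  GRing.isLinear.Build k D D _ dantipode dantipode_linear.

Let tb := @tpure_bilin k.

Fact dcomulA f : tassoc (tmap dcomul idfun (dcomul f)) =
  tmap idfun dcomul (dcomul f).
Proof.
have E1 x (s : tens D D) : contract x (tmap idfun dcomul s) = dcomul (contract x s).
  elim/tens_ind: s => [|s t IHs IHt|g h]; first by rewrite !linear0.
    by rewrite !linearD /= IHs IHt.
  by rewrite tmap_tpure !contract_pure linearZ.
have E2 x y u (h : D) : contract y (contract x (tassoc (u ⊗ h))) =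
    eval2 u x y *: h.
  elim/tens_ind: u => [|s t IHs IHt|g l].
  - by rewrite (bilin0l (tb _ _)) !linear0 eval20 scale0r.
  - by rewrite (bilinDl (tb _ _)) !linearD /= IHs IHt eval2D scalerDl.
  by rewrite tassoc_tpure contract_pure linearZ /= contract_pure eval2_pure
    scalerA.
have E3 x y (s : tens D D) : contract y (contract x (tassoc (tmap dcomul idfun s))) =
    contract (x * y) s.
  elim/tens_ind: s => [|s t IHs IHt|g h]; first by rewrite !linear0.
    by rewrite !linearD /= IHs IHt.
  by rewrite tmap_tpure E2 dcomulE contract_pure.
apply: contract_inj => x; apply: contract_inj => y; rewrite E3 E1.
apply/lfunP=> z; rewrite -!/(eval2 _ _ _) !dcomulE.
by rewrite -[RHS]/(eval2 (dcomul f) x (y * z)) dcomulE mulrA.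
Qed.

Fact dcounitl f : tlift (fun g h : D => dcounit g *: h) (dcomul f) = f.
Proof. by apply/lfunP=> z; rewrite -[LHS]/(eval2 _ 1 z) dcomulE mul1r. Qed.

Fact dcounitr f : tlift (fun g h : D => dcounit h *: g) (dcomul f) = f.
Proof.
have E s z : tlift (fun g h : D => dcounit h *: g) s z = eval2 s z 1.
  elim/tens_ind: s => [|s t IHs IHt|g h].
  - by rewrite !linear0 zero_lfunE eval20.
  - by rewrite linearD add_lfunE IHs IHt eval2D.
  rewrite tlift_tpure ?scale_lfunE ?eval2_pure; first exact: mulrC.
  split=> [w|v] c x y /=; last by rewrite linearP /= scalerDl scalerA.
  by rewrite scalerDr !scalerA mulrC.
by apply/lfunP=> z; rewrite E dcomulE mulr1.
Qed.

Fact dcomul1 : dcomul 1 = 1.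
Proof.
apply: eval2_inj => x y; rewrite dcomulE -[1 in RHS]/(dunit ⊗ dunit) eval2_pure.
by rewrite -[LHS]/(dunit _) !dunitE counitM.
Qed.

Fact dcomulM : {morph dcomul : f g / f * g}.
Proof.
move=> f g; apply: eval2_inj => x y; rewrite dcomulE.
have mE (f' g' : D) h :
  (f' * g') h = tlift (fun x y : H => f' x * g' y : k^o) (comul h) by apply: dmulE.
have E2 (s t : tens D D) : eval2 (s * t) x y =
  tlift (fun u1 u2 : H => tlift (fun v1 v2 : H =>
    eval2 s u1 v1 * eval2 t u2 v2 : k^o) (comul y)) (comul x).
  elim/tens_ind: s => [|s s' IHs IHs'|a b].
  - rewrite mul0r eval20 [RHS]big1 // => i _; rewrite big1 // => j _.
    rewrite [X in _ *: X]big1 ?scaler0 // => i' _; rewrite big1 // => j' _.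
    by rewrite eval20 mul0r scaler0.
  - rewrite mulrDl eval2D IHs IHs'; symmetry.
    apply: (@tlift_funD k H H k^o) => u1 u2; apply: (@tlift_funD k H H k^o) => v1 v2.
    by rewrite eval2D mulrDl.
  elim/tens_ind: t => [|t t' IHt IHt'|c d].
  - rewrite mulr0 eval20 [RHS]big1 // => i _; rewrite big1 // => j _.
    rewrite [X in _ *: X]big1 ?scaler0 // => i' _; rewrite big1 // => j' _.
    by rewrite eval20 mulr0 scaler0.
  - rewrite mulrDr eval2D IHt IHt'; symmetry.
    apply: (@tlift_funD k H H k^o) => u1 u2; apply: (@tlift_funD k H H k^o) => v1 v2.
    by rewrite eval2D mulrDr.
  rewrite -[_ * _]/(tmul _ _) tmul_pure eval2_pure !mE.
  elim/tens_ind: (comul x) => [|s s' IHs IHs'|u1 u2].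
  - by rewrite !linear0 mul0r.
  - by rewrite !linearD /= mulrDl IHs IHs'.
  have bb v1 v2 : bilin (fun u1 u2 : H =>
      eval2 (a ⊗ b) u1 v1 * eval2 (c ⊗ d) u2 v2 : k^o).
    split=> [w|v] e l m; rewrite !eval2_pure linearP /= mulrDl -scalerAl.
      by rewrite mulrDl; congr (_ + _); exact: esym (mulrA _ _ _).
    by rewrite mulrDr; congr (_ + _); exact: mulrCA.
  rewrite [RHS]tlift_tpure; last exact: tlift_bilin_arg.
  rewrite tlift_tpure; last exact: bilin_mulk.
  elim/tens_ind: (comul y) => [|s s' IHs IHs'|v1 v2].
  - by rewrite !linear0 mulr0.
  - by rewrite !linearD /= mulrDr IHs IHs'.
  rewrite !tlift_tpure ?eval2_pure; first by rewrite mulrACA.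
    split=> [w|v] e l m; rewrite !eval2_pure linearP /= mulrDr -scalerAr.
      by rewrite mulrDl; congr (_ + _); exact: esym (mulrA _ _ _).
    by rewrite mulrDr; congr (_ + _); exact: mulrCA.
  exact: bilin_mulk.
rewrite mE comulM (@tlift_mul k H H k^o) ?E2; last exact: bilin_mulk.
apply: (@eq_tlift k H H k^o) => u1 u2; apply: (@eq_tlift k H H k^o) => v1 v2.
by rewrite !dcomulE.
Qed.

Fact dcounit1 : dcounit 1 = 1.
Proof. by rewrite /dcounit -[LHS]/(dunit 1) dunitE counit1. Qed.

Fact dcounitM : {morph dcounit : f g / f * g}.
Proof.
move=> f g; rewrite /dcounit -[LHS]/(dmul f g 1) dmulE comul1.
by rewrite -[1]/(1 ⊗ 1) tlift_tpure //; apply: bilin_mulk.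
Qed.

Fact dantipodel f :
  tlift (fun g h : D => dantipode g * h) (dcomul f) = dcounit f *: 1.
Proof.
have E s z : tlift (fun g h : D => dantipode g * h) s z =
    tlift (fun x y : H => eval2 s (antipode x) y : k^o) (comul z).
  elim/tens_ind: s => [|s t IHs IHt|g h].
  - rewrite linear0 zero_lfunE [RHS]big1 // => i _; rewrite big1 // => j _.
    by rewrite eval20 scaler0.
  - rewrite linearD add_lfunE IHs IHt; symmetry.
    by apply: (@tlift_funD k H H k^o) => u1 u2; rewrite eval2D.
  rewrite tlift_tpure; last exact: (bilin_comp _ idfun (@mul_bilin k D)).
  rewrite -[LHS]/(dmul _ _ _) dmulE; apply: (@eq_tlift k H H k^o) => u1 u2.
  by rewrite eval2_pure dantipodeE.
apply/lfunP=> z; rewrite E scale_lfunE /dcounit.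
have -> : (1 : D) z = counit z by apply: dunitE.
have -> : tlift (fun x y : H => eval2 (dcomul f) (antipode x) y : k^o) (comul z)
    = f (tlift (fun x y : H => antipode x * y) (comul z)).
  rewrite linear_sum; apply: eq_bigr => i _.
  by rewrite linear_sum; apply: eq_bigr => j _; rewrite linearZ /= dcomulE.
by rewrite antipodel linearZ; apply: mulrC.
Qed.

Fact dantipoder f :
  tlift (fun g h : D => g * dantipode h) (dcomul f) = dcounit f *: 1.
Proof.
have E s z : tlift (fun g h : D => g * dantipode h) s z =
    tlift (fun x y : H => eval2 s x (antipode y) : k^o) (comul z).
  elim/tens_ind: s => [|s t IHs IHt|g h].
  - rewrite linear0 zero_lfunE [RHS]big1 // => i _; rewrite big1 // => j _.
    by rewrite eval20 scaler0.
  - rewrite linearD add_lfunE IHs IHt; symmetry.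
    by apply: (@tlift_funD k H H k^o) => u1 u2; rewrite eval2D.
  rewrite tlift_tpure; last exact: (bilin_comp idfun _ (@mul_bilin k D)).
  rewrite -[LHS]/(dmul _ _ _) dmulE; apply: (@eq_tlift k H H k^o) => u1 u2.
  by rewrite eval2_pure dantipodeE.
apply/lfunP=> z; rewrite E scale_lfunE /dcounit.
have -> : (1 : D) z = counit z by apply: dunitE.
have -> : tlift (fun x y : H => eval2 (dcomul f) x (antipode y) : k^o) (comul z)
    = f (tlift (fun x y : H => x * antipode y) (comul z)).
  rewrite linear_sum; apply: eq_bigr => i _.
  by rewrite linear_sum; apply: eq_bigr => j _; rewrite linearZ /= dcomulE.
by rewrite antipoder linearZ; apply: mulrC.
Qed.

HB.instance Definition _ := isHopf.Build k D dcomulA dcounitl dcounitr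
  dcomul1 dcomulM dcounit1 dcounitM dantipodel dantipoder.

End DualHopf.

Section Quasitriangular.
Variables (k : fieldType) (H : hopfAlgType k).
Local Notation H2 := (tens H H).
Local Notation H3 := (tens H H2).

Definition leg12 (R : H2) : H3 := tassoc (R ⊗ (1 : H)).
Definition leg23 (R : H2) : H3 := 1 ⊗ R.
Definition leg13 (R : H2) : H3 := tmap idfun (fun b : H => 1 ⊗ b : H2) R.

Definition is_Rmatrix (R : H2) : Prop :=
  [/\ R \is a GRing.unit,
      tassoc (tmap comul idfun R) = leg13 R * leg23 R,
      tmap idfun comul R = leg13 R * leg12 R,
      tlift (fun x y : H => (counit x : k) *: y) R = 1 /\
      tlift (fun x y : H => (counit y : k) *: x) R = 1
    & forall h : H, tswap (comul h) = R * comul h * R^-1].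

Definition quasitriangular : Prop := exists R : H2, is_Rmatrix R.

Definition grouplikes : set H :=
  [set g | comul g = g ⊗ g /\ counit g = 1]%classic.

Definition alg_center : set H := [set g | g \in 'Z({: H})%VS]%classic.

End Quasitriangular.

Arguments grouplikes {k} H _.
Arguments alg_center {k} H _.

(* Finite-dimensional left modules over a finite-dimensional algebra.         *)
Record rep (k : fieldType) (A : falgType k) := Rep {
  rcar :> vectType k;
  ract : A -> rcar -> rcar;
  ract_bilin : bilin ract;
  ract1 : forall v, ract 1 v = v;
  ractM : forall a b v, ract (a * b) v = ract a (ract b v)
}.

Section Representations.
Variables (k : fieldType) (A : falgType k).
Implicit Types X Y : rep A.

HB.instance Definition _ X (a : A) :=
  GRing.isLinear.Build k X X _ (@ract k A X a) ((@ract_bilin k A X).2 a).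

Definition is_hom X Y (f : 'Hom(X, Y)) : Prop :=
  forall a v, f (ract a v) = ract a (f v).

Definition isorep X Y : Prop :=
  exists f : 'Hom(X, Y), is_hom f /\ bijective f.

Definition stable X (U : {vspace X}) : Prop :=
  forall a v, v \in U -> ract a v \in U.

Definition irrep X : Prop :=
  (0 < \dim {:X})%N /\
  forall U : {vspace X}, stable U -> U = 0%VS \/ U = fullv.

Definition completely_reducible X : Prop :=
  forall U : {vspace X}, stable U ->
    exists W : {vspace X}, [/\ stable W, (U + W)%VS = fullv & (U :&: W)%VS = 0%VS].

Definition regular_rep : rep A :=
  @Rep k A A *%R (@mul_bilin k A) (@mul1r A) (fun a b v => esym (mulrA a b v)).

Definition semisimple : Prop := completely_reducible regular_rep.

Definition char_degrees : set nat :=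
  [set d | exists X : rep A, irrep X /\ \dim {:X} = d]%classic.

(* X is the direct sum (biproduct) of the finite family Y.                    *)
Definition is_dsum (I : finType) (X : rep A) (Y : I -> rep A) : Prop :=
  exists (inj : forall i, 'Hom(Y i, X)) (prj : forall i, 'Hom(X, Y i)),
  [/\ forall i, is_hom (inj i) /\ is_hom (prj i),
      forall i, (prj i \o inj i)%VF = \1%VF,
      forall i j, i != j -> (prj j \o inj i)%VF = 0
    & \sum_i (inj i \o prj i)%VF = \1%VF].

(* Full subcategories of Rep A are predicates on representations. Taking I    *)
(* empty or a singleton in the first clause gives the zero object and         *)
(* closure under isomorphism.                                                 *)
Definition full_abelian (C : rep A -> Prop) : Prop :=
  [/\ forall (I : finType) X (Y : I -> rep A),
        (forall i, C (Y i)) -> is_dsum X Y -> C X,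
      forall (X Y K : rep A) (f : 'Hom(X, Y)) (i : 'Hom(K, X)), C X -> C Y ->
        is_hom f -> is_hom i -> lker i = 0%VS -> limg i = lker f -> C K
    & forall (X Y Q : rep A) (f : 'Hom(X, Y)) (q : 'Hom(Y, Q)), C X -> C Y ->
        is_hom f -> is_hom q -> limg q = fullv -> lker q = limg f -> C Q].

End Representations.

Section TensorCategory.
Variables (k : fieldType) (H : hopfAlgType k).
Implicit Types X Y : rep H.

Section Trivial.
Variable V : vectType k.
Definition triv_act (a : H) (v : V) : V := (counit a : k) *: v.
Fact triv_bilin : bilin triv_act.
Proof.
split=> [w|v] a x y; rewrite /triv_act; first by rewrite linearP scalerDl scalerA.
by rewrite scalerDr !scalerA mulrC.
Qed.
Fact triv_act1 v : triv_act 1 v = v.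
Proof. by rewrite /triv_act counit1 scale1r. Qed.
Fact triv_actM a b v : triv_act (a * b) v = triv_act a (triv_act b v).
Proof. by rewrite /triv_act counitM scalerA. Qed.
(* The image of V under the unique tensor embedding Vec -> Rep H; the unit    *)
(* object is triv_rep k^o.                                                    *)
Definition triv_rep : rep H := Rep triv_bilin triv_act1 triv_actM.
End Trivial.

Definition unit_rep : rep H := triv_rep k^o.

Section Tensor.
Variables X Y : rep H.
Definition tens_act (a : H) (t : tens X Y) : tens X Y :=
  tlift (fun x y => tmap (ract x) (ract y) t) (comul a).

Lemma tens_bilin_in (t : tens X Y) :
  bilin (fun x y : H => tmap (ract x) (ract y) t).
Proof.
apply: tlift_bilin_arg => v w.
by split=> [y|x] a u u'; rewrite (ract_bilin _).1 ?(tpure_bilin _ _).1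
  ?(tpure_bilin _ _).2.
Qed.

Fact tens_act_bilin : bilin tens_act.
Proof.
split=> [u|a] c s t; first by rewrite /tens_act !linearP.
by apply: tlift_fun_linear => x y; rewrite linearP.
Qed.

Fact tens_act1 t : tens_act 1 t = t.
Proof.
rewrite /tens_act comul1 -[X in tlift _ X]/(1 ⊗ 1) tlift_tpure.
  elim/tens_ind: t => [|s t IHs IHt|v w]; first by rewrite linear0.
    by rewrite linearD /= IHs IHt.
  by rewrite tmap_tpure /= !ract1.
exact: tens_bilin_in.
Qed.

Fact tens_actM a b t : tens_act (a * b) t = tens_act a (tens_act b t).
Proof.
rewrite /tens_act comulM tlift_mul; last exact: tens_bilin_in.
apply: eq_tlift => x y; rewrite linear_tlift; apply: eq_tlift => x' y'.
elim/tens_ind: t => [|s t IHs IHt|v w]; first by rewrite !linear0.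
  by rewrite !linearD /= IHs IHt.
by rewrite /= !tmap_tpure /= !ractM.
Qed.

Definition tens_rep : rep H := Rep tens_act_bilin tens_act1 tens_actM.
End Tensor.

Section Dual.
Variable X : rep H.
Definition dual_act (a : H) (f : vdual X) : vdual X :=
  linfun (f \o ract (antipode a)).

Lemma dual_actE a f v : dual_act a f v = f (ract (antipode a) v).
Proof. by rewrite lfunE. Qed.

Fact dual_act_bilin : bilin dual_act.
Proof.
split=> [f|a] c x y; apply/lfunP=> v; rewrite add_lfunE scale_lfunE !dual_actE.
  by rewrite linearP (ract_bilin _).1 linearP.
by rewrite add_lfunE scale_lfunE.
Qed.

Fact dual_act1 f : dual_act 1 f = f.
Proof. by apply/lfunP=> v; rewrite dual_actE antipode1 ract1. Qed.

Fact dual_actM a b f : dual_act (a * b) f = dual_act a (dual_act b f).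
Proof. by apply/lfunP=> v; rewrite !dual_actE antipodeM ractM. Qed.

Definition dual_rep : rep H := Rep dual_act_bilin dual_act1 dual_actM.
End Dual.

(* As C is full, k-linearity, finite-dimensionality of the Hom spaces and     *)
(* End(1) = k are inherited from Rep H.                                       *)
Definition fusion_subcategory (C : rep H -> Prop) : Prop :=
  [/\ full_abelian C /\ C unit_rep,
      forall X Y, C X -> C Y -> C (tens_rep X Y),
      forall X, C X -> C (dual_rep X),
      forall X, C X -> completely_reducible X
    & exists (n : nat) (S : 'I_n -> rep H),
        forall X, C X -> irrep X -> exists i, isorep X (S i)].

Definition faithful_grading (C : rep H -> Prop) (G : finGroupType)
    (D : G -> rep H -> Prop) : Prop :=
  [/\ forall g, [/\ full_abelian (D g), forall X, D g X -> C X
                  & exists X, D g X /\ (0 < \dim {:X})%N],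
      forall X, C X -> exists Y : G -> rep H,
        (forall g, D g (Y g)) /\ is_dsum X Y,
      forall g h X Y (f : 'Hom(X, Y)),
        g != h -> D g X -> D h Y -> is_hom f -> f = 0,
      forall g h X Y, D g X -> D h Y -> D (g * h)%g (tens_rep X Y)
    & forall g Y, D g^-1%g Y <-> exists X, D g X /\ isorep Y (dual_rep X)].

(* In a tower Vec = C_0, ..., C_n = Rep H, the category C_i is the trivial    *)
(* component of C_(i+1), so all the C_i are fusion subcategories of Rep H.    *)
Definition nilpotent_hopf : Prop :=
  exists (n : nat) (C : nat -> rep H -> Prop),
  [/\ forall i, (i <= n)%N -> fusion_subcategory (C i),
      forall X, C 0%N X <-> exists V : vectType k, isorep X (triv_rep V),
      forall X, C n X
    & forall i, (i < n)%N -> exists (G : finGroupType) (D : G -> rep H -> Prop),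
        faithful_grading (C i.+1) D /\ forall X, D 1%g X <-> C i X].

End TensorCategory.

(* Main.v *)
(* Write sigma_l h = chi(h1) h2 and sigma_r h = h1 chi(h2) for a group-like
   chi of H*. For an irreducible X of dimension p, End X has dimension p^2 and
   splits into irreducibles of dimensions 1 and p; each linear character
   occurs at most once and the trivial one does occur, so all p of them occur.
   Hence each chi yields T <> 0 in End X with h T = T sigma_l(h). For chi <> 1
   the quantum trace of T^i vanishes for 0 < i < p while that of 1 does not,
   so T has p distinct eigenlines, on which K = {h | sigma_l h = h} acts
   diagonally; thus K is commutative. The R-matrix gives the group-like u =
   (id (x) chi)(R), with sigma_l = u sigma_r u^-1. Comparing the traces on X
   of the Drinfeld element w and of sigma_l w gives chi(u) = 1, so u lies in
   K. The characters of K are the counit and p for each X, all distinct, so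
   they form a group of order 1 mod p; since u^p = 1, Lagrange forces u = 1,
   i.e. chi is central in H*. Then R lies in K (x) K, which makes K
   cocommutative. Summing the characters of K gives an integral of H* with
   nonzero value at 1, so H* is semisimple. The central chi grades Rep H* by
   Z/p; its trivial component is Rep K*, whose irreducibles have dimension 1,
   so it is graded by the finite group of its irreducibles, with trivial
   component Vec. *)

Require Import Defs.
From HB Require Import structures.
From mathcomp Require Import all_boot all_order all_algebra all_fingroup all_field.
From mathcomp Require Import cyclic zify.
From mathcomp Require Import boolp classical_sets functions cardinality.

(* all_fingroup rebinds ract. *)
Import Defs.

Set Implicit Arguments.
Unset Strict Implicit.
Unset Printing Implicit Defensive.

Import GRing.Theory.
Local Open Scope ring_scope.

(** * Linear algebra *)

(** Nothing is assumed about S². The Drinfeld element w implements S² by conjugation, which yields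
    both the injectivity of the antipode and an H-invariant trace F |-> tr(F w) on End X. The
    comparison behind chi(u) = 1 runs as follows. Put v = (chi ⊗ id)(R), so that chi(u) = chi(v).
    The product uv is central and group-like, and sigma_l w = chi^-1(v) (uv)^-1 w. Since w T = T
    sigma_l(w), both have the same trace on X, so chi^-1(v) times the scalar of (uv)^-1 on X is 1.
    That scalar is not known for arbitrary X. It is 1 when X is a p-dimensional constituent of End
    X0, because uv acts there by conjugation with a central element. Such a constituent exists
    because p lines do not fill the p^2 dimensions. The obstacle afterwards is that K is a priori
    only a subalgebra with Delta(K) inside K ⊗ H, so its characters cannot be convolved. Once u lies
    in the commutative algebra K, sigma_l = u sigma_r u^-1 shows that sigma_r fixes K too; only then
    is K a Hopf subalgebra and the count 1 mod p usable. *)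

Section LinearAlgebra.
Variable k : fieldType.
Implicit Types V W U : vectType k.

Lemma vdual_sep V (x y : V) : (forall f : vdual V, f x = f y) -> x = y.
Proof.
by move=> xy; rewrite (crdP x) (crdP y); apply: eq_bigr => i _; rewrite -!dbasE xy.
Qed.

Lemma linfunE V W (f : V -> W) : linear f -> forall x, linfun f x = f x.
Proof.
move=> fl x; pose L := GRing.isLinear.Build k V W _ f fl.
by pose F : {linear V -> W} := HB.pack f L; rewrite (lfunE F).
Qed.

Definition lapply V W (x : V) (f : 'Hom(V, W)) : W := f x.
Fact lapply_linear V W (x : V) : linear (@lapply V W x).
Proof. by move=> a f g; rewrite /lapply add_lfunE scale_lfunE. Qed.
HB.instance Definition _ V W x :=
  GRing.isLinear.Build k 'Hom(V, W) W _ (@lapply V W x) (lapply_linear x).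

Lemma tlift_lfunE V W U U' (f : V -> W -> 'Hom(U, U')) t x :
  tlift f t x = tlift (fun v w => f v w x) t.
Proof. exact: (linear_tlift (lapply x)). Qed.

Lemma tlift_of_linear V W U U' (g : U -> U') : linear g ->
  forall (f : V -> W -> U) t, g (tlift f t) = tlift (fun v w => g (f v w)) t.
Proof.
move=> gl f t; rewrite -[LHS](linfunE gl) linear_tlift.
by apply: eq_tlift => v w; rewrite /= linfunE.
Qed.

Lemma linear_inj_surj V (f : {linear V -> V}) : injective f -> forall y, exists x, f x = y.
Proof.
move=> fi y; have kf : lker (linfun f) == 0%VS.
  by apply/lker0P => u v; rewrite !lfunE => /fi.
by exists ((linfun f)^-1%VF y); have := lker0_lfunVK kf y; rewrite lfunE.
Qed.

Lemma unity_root_neq0 (c : k) n : (0 < n)%N -> c ^+ n = 1 -> c != 0.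
Proof.
move=> n0 cn; apply: contraTneq (oner_neq0 k) => c0.
by rewrite -cn c0 expr0n (gtn_eqF n0) eqxx.
Qed.

Lemma sum_unity_root (c : k) n : c ^+ n = 1 ->
  \sum_(i < n) c ^+ i = (c == 1)%:R * n%:R.
Proof.
move=> cn; case: eqVneq => [->|c1].
  by rewrite mul1r (eq_bigr (fun=> 1)) ?sumr_const ?card_ord // => i _; rewrite expr1n.
rewrite mul0r; apply/eqP; have : (c - 1) * (\sum_(i < n) c ^+ i) == 0.
  by rewrite -subrX1 cn subrr.
by rewrite mulf_eq0 subr_eq0 (negPf c1).
Qed.

Lemma eq_unity_ratio (c d : k) : c != 0 -> (c^-1 * d == 1) = (c == d).
Proof.
by move=> c0; rewrite -(inj_eq (mulfI c0)) mulVKf // mulr1 eq_sym.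
Qed.

Definition ltrace V (f : 'End(V)) : k := \sum_i crd (f (bas i)) i.

Fact ltrace_linear V : scalar (@ltrace V).
Proof.
move=> a f g; rewrite /ltrace mulr_sumr -big_split; apply: eq_bigr => i _ /=.
by rewrite add_lfunE scale_lfunE crd_linear.
Qed.
HB.instance Definition _ V :=
  GRing.isLinear.Build k 'End(V) k _ (@ltrace V) (@ltrace_linear V).

Lemma crd_sum V (I : finType) (F : I -> V) i :
  crd (\sum_j F j) i = \sum_j crd (F j) i.
Proof.
apply: (big_morph (fun v : V => crd v i)) => [x y|].
  by have := crd_linear i 1 x y; rewrite scale1r mul1r.
by rewrite /crd linear0.
Qed.

Lemma crdZ V a (v : V) i : crd (a *: v) i = a * crd v i.
Proof. by rewrite /crd linearZ. Qed.

Lemma ltraceC V (f g : 'End(V)) : ltrace (f \o g)%VF = ltrace (g \o f)%VF.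
Proof.
have E (f' g' : 'End(V)) : ltrace (f' \o g')%VF =
    \sum_i \sum_j crd (g' (bas i)) j * crd (f' (bas j)) i.
  apply: eq_bigr => i _; rewrite comp_lfunE [X in f' X]crdP linear_sum crd_sum.
  by apply: eq_bigr => j _; rewrite linearZ crdZ.
rewrite !E exchange_big; apply: eq_bigr => i _; apply: eq_bigr => j _.
exact: mulrC.
Qed.

(* The rank one endomorphism v |-> crd v i *: x has trace crd x i. *)
Lemma ltrace_nondeg V (g : 'End(V)) : g != 0 -> exists f : 'End(V), ltrace (f \o g)%VF != 0.
Proof.
move=> g0; have [x gx] : exists x, g x != 0.
  apply: contrapT => nx; case/eqP: g0; apply/lfunP => x; rewrite zero_lfunE.
  by apply/eqP; apply/negP => /negP gx; apply: nx; exists x.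
have [i gi] := bas_neq0 gx.
have fl : linear (fun v : V => crd v i *: x).
  by move=> a u v; rewrite crd_linear scalerDl scalerA.
exists (linfun (fun v : V => crd v i *: x)); rewrite ltraceC /ltrace.
have -> : \sum_j crd ((g \o linfun (fun v : V => crd v i *: x))%VF (bas j)) j = crd (g x) i.
  rewrite (bigD1 i) //= big1 ?addr0 => [|j /negPf ji]; rewrite comp_lfunE linfunE // linearZ crdZ crd_bas.
    by rewrite eqxx mul1r.
  by rewrite ji mul0r.
by [].
Qed.

End LinearAlgebra.

(** * Modules over finite-dimensional algebras *)

Section Modules.
Variables (k : fieldType) (A : falgType k).
Implicit Types X Y Z : rep A.

Lemma hom_comp X Y Z (f : 'Hom(Y, Z)) (g : 'Hom(X, Y)) :
  is_hom f -> is_hom g -> is_hom (f \o g)%VF.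
Proof. by move=> hf hg a v; rewrite !comp_lfunE hg hf. Qed.

Lemma hom_id X : is_hom (\1%VF : 'End(X)).
Proof. by move=> a v; rewrite !id_lfunE. Qed.

Lemma stablef X : stable (fullv : {vspace X}).
Proof. by move=> a v _; rewrite memvf. Qed.

Lemma stableI X (U V : {vspace X}) : stable U -> stable V -> stable (U :&: V)%VS.
Proof. by move=> sU sV a v; rewrite !memv_cap => /andP[/sU-> /sV->]. Qed.

Lemma stable_lker X Y (f : 'Hom(X, Y)) : is_hom f -> stable (lker f).
Proof. by move=> hf a v; rewrite !memv_ker hf => /eqP->; rewrite linear0. Qed.

Lemma stable_limg X Y (f : 'Hom(X, Y)) (U : {vspace X}) :
  is_hom f -> stable U -> stable (f @: U)%VS.
Proof. by move=> hf sU a v /memv_imgP[x xU ->]; rewrite -hf memv_img ?sU. Qed.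

Lemma irrep_hom_inj X Y (f : 'Hom(X, Y)) :
  irrep X -> is_hom f -> f != 0 -> lker f = 0%VS.
Proof.
move=> [_ iX] hf f0; case: (iX _ (stable_lker hf)) => // kf.
case/eqP: f0; apply/lfunP => x; rewrite zero_lfunE; apply/eqP.
by rewrite -memv_ker kf memvf.
Qed.

Lemma irrep_hom_surj X Y (f : 'Hom(X, Y)) :
  irrep Y -> is_hom f -> f != 0 -> limg f = fullv.
Proof.
move=> [_ iY] hf f0; case: (iY _ (stable_limg hf (@stablef X))) => // kf.
case/eqP: f0; apply/lfunP => x; rewrite zero_lfunE; apply/eqP.
by rewrite -memv0 -kf memv_img ?memvf.
Qed.

Lemma isorepW X Y (f : 'Hom(X, Y)) :
  is_hom f -> lker f = 0%VS -> limg f = fullv -> isorep X Y.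
Proof.
move=> hf kf lf; exists f; split=> //; exists (f^-1)%VF => x /=.
  by apply: lker0_lfunK; rewrite kf.
by apply: limg_lfunVK; rewrite lf memvf.
Qed.

Lemma isorep_sym X Y : isorep X Y -> isorep Y X.
Proof.
move=> [f [hf [g fK gK]]].
have gl : linear g.
  by move=> a u v; apply: (can_inj fK); rewrite gK linearP /= !gK.
exists (linfun g); split=> [a v|].
  by rewrite !linfunE //; apply: (can_inj fK); rewrite gK hf gK.
by exists f => x; rewrite linfunE // ?gK ?fK.
Qed.

Lemma isorep_dim X Y : isorep X Y -> \dim {:X} = \dim {:Y}.
Proof.
move=> [f [hf [g fK gK]]].
have kf : (lker f == 0)%VS.
  by apply/lker0P => x y; apply: (can_inj fK).
have <- : limg f = fullv.
  by apply/vspaceP => x; rewrite memvf -[x]gK memv_img ?memvf.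
by rewrite limg_dim_eq // (eqP kf) capv0.
Qed.

Lemma isorep_trans Y X Z : isorep X Y -> isorep Y Z -> isorep X Z.
Proof.
move=> [f [hf bf]] [g [hg bg]]; exists (g \o f)%VF; split; first exact: hom_comp.
have [f' fK f'K] := bf; have [g' gK g'K] := bg.
by exists (f' \o g') => x /=; rewrite comp_lfunE ?gK ?fK ?f'K ?g'K.
Qed.

Lemma irrep_schur X Y (f : 'Hom(X, Y)) :
  irrep X -> irrep Y -> is_hom f -> f != 0 -> isorep X Y.
Proof.
move=> iX iY hf f0.
by apply: (isorepW hf); [apply: irrep_hom_inj | apply: irrep_hom_surj].
Qed.

Section Sub.
Variables (X : rep A) (U : {vspace X}).
Definition sub_act (a : A) (u : subvs_of U) : subvs_of U :=
  vsproj U (ract a (vsval u)).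
Hypothesis sU : stable U.

Lemma vsval_sub_act a u : vsval (sub_act a u) = ract a (vsval u).
Proof. by rewrite vsprojK // sU // subvsP. Qed.
Fact sub_bilin : bilin sub_act.
Proof.
split=> [w|v] a x y; apply: val_inj; rewrite [val _]vsval_sub_act /=.
  by rewrite !vsval_sub_act (ract_bilin _).1.
by rewrite !vsval_sub_act linearP.
Qed.
Fact sub_act1 v : sub_act 1 v = v.
Proof. by apply: val_inj; rewrite [val _]vsval_sub_act ract1. Qed.
Fact sub_actM a b v : sub_act (a * b) v = sub_act a (sub_act b v).
Proof.
by apply: val_inj; rewrite [val _]vsval_sub_act ractM /= !vsval_sub_act.
Qed.
Definition subrep : rep A := Rep sub_bilin sub_act1 sub_actM.
Definition sub_inj : 'Hom(subrep, X) := linfun (vsval : subvs_of U -> X).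
Definition sub_prj : 'Hom(X, subrep) := linfun (vsproj U : X -> subvs_of U).
Lemma sub_injE u : sub_inj u = vsval u. Proof. by rewrite lfunE. Qed.
Lemma sub_prjE u : sub_prj u = vsproj U u. Proof. by rewrite lfunE. Qed.
Lemma sub_inj_hom : is_hom sub_inj.
Proof. by move=> a v; rewrite !sub_injE -vsval_sub_act. Qed.
Lemma dim_subrep : \dim {:subrep} = \dim U.
Proof. by rewrite dimvf. Qed.
End Sub.

(** Simple submodules are kept as subspaces of X, so that a decomposition is a list of subspaces to
    which sums and dimension counts apply directly. *)
Definition simple_sub X (U : {vspace X}) : Prop :=
  [/\ stable U, U <> 0%VS &
      forall W : {vspace X}, stable W -> (W <= U)%VS -> W = 0%VS \/ W = U].

Lemma simple_sub_irrep X (U : {vspace X}) (sU : stable U) :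
  simple_sub U -> irrep (subrep sU).
Proof.
move=> [_ U0 Um]; split; first by rewrite dim_subrep lt0n dimv_eq0; apply/eqP.
move=> W sW; pose f := sub_inj sU.
have fi : lker f == 0%VS.
  rewrite -subv0; apply/subvP => x; rewrite memv_ker sub_injE memv0 => /eqP x0.
  by apply/eqP/val_inj; rewrite -[RHS]/(vsval 0) linear0.
have sWU : (f @: W <= U)%VS.
  by apply/subvP => x /memv_imgP[y _ ->]; rewrite sub_injE subvsP.
case: (Um _ (stable_limg (@sub_inj_hom _ _ sU) sW) sWU) => fW; [left | right].
  apply/eqP; rewrite -subv0; apply/subvP => x xW; rewrite memv0.
  have := memv_img f xW; rewrite fW memv0 -memv_ker (eqP fi) memv0; exact: id.
apply/vspaceP => x; rewrite memvf.
have : f x \in (f @: W)%VS by rewrite fW sub_injE subvsP.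
by case/memv_imgP => y yW /(lker0P fi)->.
Qed.

Lemma simple_sub_ex X (U : {vspace X}) : stable U -> U <> 0%VS ->
  exists2 W, simple_sub W & (W <= U)%VS.
Proof.
have [n] := ubnP (\dim U); elim: n U => // n IHn U dU sU U0.
have [|nU] := pselect (simple_sub U); first by exists U.
have [W [sW WU W0 WnU]] : exists W : {vspace X},
    [/\ stable W, (W <= U)%VS, W <> 0%VS & W <> U].
  apply: contrapT => nW; apply: nU; split=> // W sW WU.
  by have [|W0] := pselect (W = 0%VS); [left | right; apply: contrapT => WnU; apply: nW; exists W].
have dW : (\dim W < n)%N.
  rewrite ltnS in dU; apply: leq_trans dU; rewrite ltn_neqAle dimvS // andbT.
  by apply/eqP => e; apply: WnU; apply/eqP; rewrite eqEdim WU e leqnn.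
by have [T sT TW] := IHn W dW sW W0; exists T; rewrite ?(subv_trans TW).
Qed.

Lemma simple_decomposition X : completely_reducible X ->
  exists s : seq {vspace X}, [/\ forall U, U \in s -> simple_sub U, uniq s,
    (\sum_(U <- s) U)%VS = fullv & (\sum_(U <- s) \dim U)%N = \dim {:X}].
Proof.
move=> crX; suff S n : forall U : {vspace X}, stable U -> (\dim U < n)%N ->
    exists s : seq {vspace X}, [/\ forall W, W \in s -> simple_sub W, uniq s,
    (\sum_(W <- s) W)%VS = U & (\sum_(W <- s) \dim W)%N = \dim U].
  exact: (S _ _ (@stablef X) (ltnSn _)).
elim: n => // n IHn U sU dU.
have [->|/eqP U0] := eqVneq U 0%VS.
  by exists [::]; split=> //; rewrite ?big_nil ?dimv0.
have [W simW WU] := simple_sub_ex sU U0; have [sW W0 _] := simW.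
have [T [sT WT dWT]] := crX W sW.
(* The modular law turns the complement T of W in X into the complement T ∩ U of W in U. *)
have UE : (W + (T :&: U))%VS = U by rewrite vspace_modl // WT capfv.
have WTU : (W :&: (T :&: U))%VS = 0%VS by rewrite capvA dWT cap0v.
have dE : (\dim W + \dim (T :&: U))%N = \dim U.
  by rewrite -[in RHS]UE dimv_disjoint_sum.
have dW : (0 < \dim W)%N by rewrite lt0n dimv_eq0; apply/eqP.
have [|s [ss us sE ds]] := IHn _ (stableI sT sU).
  by rewrite -ltnS (leq_trans _ dU) // ltnS -dE -add1n leq_add2r.
exists (W :: s); split=> /=.
- by move=> V; rewrite inE => /orP[/eqP->|/ss].
- rewrite us andbT; apply/negP => Ws; apply: W0; apply/eqP.
  rewrite -subv0 -WTU subv_cap subvv -sE.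
  by rewrite (big_rem _ Ws) /= addvSl.
- by rewrite big_cons sE.
- by rewrite big_cons ds dE.
Qed.

Lemma ract0 X v : ract (0 : A) v = 0 :> X.
Proof. exact: (bilin0l (@ract_bilin k A X)). Qed.

Definition orbit_map X (x : X) : 'Hom(regular_rep A, X) := linfun (fun a : A => ract a x).
Lemma orbit_mapE X (x : X) (a : A) : orbit_map x a = ract a x.
Proof. by rewrite linfunE //; apply: (ract_bilin X).1. Qed.
Lemma orbit_map_hom X (x : X) : is_hom (orbit_map x).
Proof. by move=> a v; rewrite !orbit_mapE ractM. Qed.

Lemma memv_sum_seq (V : vectType k) (s : seq {vspace V}) (P : V -> Prop) :
  P 0 -> (forall x y, P x -> P y -> P (x + y)) ->
  (forall U x, U \in s -> x \in U -> P x) ->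
  forall x, x \in (\sum_(U <- s) U)%VS -> P x.
Proof.
move=> P0 PD; elim: s => [|U s IHs] Ps x.
  by rewrite big_nil memv0 => /eqP->.
rewrite big_cons => /memv_addP[u uU [v vs ->]]; apply: PD.
  by apply: Ps uU; rewrite inE eqxx.
by apply: IHs vs => W y Ws; apply: Ps; rewrite inE Ws orbT.
Qed.

Lemma irreps_faithful (a : A) : semisimple A ->
  (forall X, irrep X -> forall x : X, ract a x = 0) -> a = 0.
Proof.
move=> /simple_decomposition[s [ss _ sE _]] a0.
suff : forall x : regular_rep A, ract a x = 0 by move/(_ 1); rewrite /= mulr1.
move=> x; have : x \in (\sum_(U <- s) U)%VS by rewrite sE memvf.
move: x; apply: memv_sum_seq => [|x y x0 y0|U x /ss sU xU].
- by rewrite linear0.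
- by rewrite linearD -[RHS]addr0; congr (_ + _).
have [stU _ _] := sU.
have := a0 _ (simple_sub_irrep stU sU) (vsproj U x).
by move/(congr1 vsval); rewrite linear0 vsval_sub_act // vsprojK.
Qed.

(** For x != 0 in X the map a |-> a x is non-zero at 1, hence on some simple summand of the regular
    module, and Schur's lemma identifies X with that summand. The list may contain repetitions. *)
Lemma finite_irreps : semisimple A -> exists (n : nat) (S : 'I_n -> rep A),
  (forall i, irrep (S i)) /\ forall X, irrep X -> exists i, isorep X (S i).
Proof.
move=> /simple_decomposition[s [ss _ sE _]].
have st (i : 'I_(size s)) : simple_sub (tnth (in_tuple s) i) by apply/ss/mem_tnth.
have stb (i : 'I_(size s)) : stable (tnth (in_tuple s) i) by case: (st i).
exists (size s), (fun i => subrep (stb i)); split=> [i|X iX].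
  exact: simple_sub_irrep.
have [x x0] : exists x : X, x != 0.
  have := iX.1; rewrite lt0n dimv_eq0 -vpick0 => x0; by exists (vpick {:X}).
have [i fi] : exists i, (orbit_map x \o sub_inj (stb i))%VF != 0.
  apply: contrapT => n0; move/eqP: x0; apply.
  rewrite -(ract1 x) -orbit_mapE.
  have : (1 : regular_rep A) \in (\sum_(U <- s) U)%VS by rewrite sE memvf.
  move: (1 : regular_rep A).
  apply: memv_sum_seq => [|y z y0 z0|U y Us yU].
  - by rewrite linear0.
  - by rewrite linearD /= y0 z0 addr0.
  have /tnthP[i Ui] : U \in in_tuple s by [].
  have : (orbit_map x \o sub_inj (stb i))%VF = 0.
    by apply/eqP/negP => /negP fi; apply: n0; exists i.
  move/lfunP/(_ (vsproj _ y)); rewrite zero_lfunE comp_lfunE sub_injE vsprojK //.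
  by rewrite -Ui.
exists i; apply: isorep_sym; apply: irrep_schur fi => //.
  exact: simple_sub_irrep.
apply: hom_comp; [exact: orbit_map_hom | exact: sub_inj_hom].
Qed.

End Modules.

Section ClosedField.
Variables (k : closedFieldType) (A : falgType k).
Implicit Types X Y Z : rep A.

Lemma eigenvector_ex (V : vectType k) (f : 'End(V)) : (0 < \dim {:V})%N ->
  exists c x, x != 0 /\ f x = c *: x.
Proof.
move=> dV; pose M := \matrix_(i, j < \dim {:V}) crd (f (bas i)) j.
have [c] : exists c, root (char_poly M) c.
  by apply/closed_rootP; rewrite size_char_poly eqSS -lt0n.
rewrite -eigenvalue_root_char => /eigenvalueP[v vM v0].
have crdE j : crd (\sum_i v 0 i *: bas i) j = v 0 j.
  rewrite crd_sum (bigD1 j) //= big1 ?addr0 => [|i /negPf ij]; rewrite crdZ crd_bas.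
    by rewrite eqxx mulr1.
  by rewrite ij mulr0.
exists c, (\sum_i v 0 i *: bas i); split.
  apply: contraNneq v0 => x0; apply/eqP/rowP => j; rewrite -crdE x0 mxE.
  by rewrite /crd linear0.
rewrite linear_sum [RHS]crdP (eq_bigr (fun i => \sum_j (v 0 i * M i j) *: bas j)).
  rewrite exchange_big; apply: eq_bigr => j _ /=.
  rewrite -scaler_suml; congr (_ *: _); rewrite crdZ crdE.
  by move/rowP: vM => /(_ j); rewrite !mxE.
move=> i _; rewrite linearZ /= [X in _ *: X]crdP scaler_sumr.
by apply: eq_bigr => j _; rewrite scalerA mxE.
Qed.

Lemma schur_scalar X (f : 'End(X)) : irrep X -> is_hom f ->
  exists c, forall x, f x = c *: x.
Proof.
move=> iX hf; have [c [x [x0 fx]]] := eigenvector_ex f iX.1.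
exists c => y; apply/eqP; rewrite -subr_eq0.
have gE z : (f - c *: \1%VF)%VF z = f z - c *: z.
  by rewrite add_lfunE opp_lfunE scale_lfunE id_lfunE.
have [g0|g0] := eqVneq (f - c *: \1%VF)%VF 0; first by rewrite -gE g0 zero_lfunE.
have hg : is_hom (f - c *: \1%VF)%VF.
  by move=> a z; rewrite !gE hf linearB [X in _ = _ - X]linearZ.
have := irrep_hom_inj iX hg g0.
move/vspaceP/(_ x); rewrite memv_ker gE fx subrr eqxx memv0 (negPf x0) //.
Qed.

Lemma scalar_char X : (0 < \dim {:X})%N ->
  (forall a, exists c, forall x : X, ract a x = c *: x) ->
  exists f : vdual A, [/\ forall a (x : X), ract a x = f a *: x, f 1 = 1 &
    forall a b, f (a * b) = f a * f b].
Proof.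
move=> dX sc; have [x x0] : exists x : X, x != 0.
  by move: dX; rewrite lt0n dimv_eq0 -vpick0 => x0; exists (vpick {:X}).
have [i xi] := bas_neq0 x0.
pose f a : k^o := crd (ract a x) i / crd x i.
have fE a (y : X) : ract a y = f a *: y.
  have [c cE] := sc a.
  by rewrite /f !cE crdZ mulfK.
have finj c d : c *: x = d *: x -> c = d.
  move/eqP; rewrite -subr_eq0 -scalerBl scaler_eq0 (negPf x0) orbF subr_eq0.
  by move/eqP.
have fl : linear f.
  move=> c a b; rewrite /f (ract_bilin X).1 crd_linear mulrDl.
  by rewrite -mulrA.
exists (linfun f); split=> [a y||a b]; rewrite ?linfunE //.
  by apply: finj; rewrite -fE ract1 scale1r.
by apply: finj; rewrite -fE ractM !fE scalerA.
Qed.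

Lemma dim1_scalar X : \dim {:X} = 1%N ->
  forall a, exists c, forall x : X, ract a x = c *: x.
Proof.
move=> d1 a; have [x x0 fx] : exists2 x : X, x != 0 & fullv = <[x]>%VS.
  exists (vpick {:X}); first by rewrite vpick0 -dimv_eq0 d1.
  apply/esym/eqP; rewrite eqEdim subvf d1 dim_vline vpick0 -dimv_eq0 d1 //.
have [c cE] : exists c, ract a x = c *: x.
  by apply/vlineP; rewrite -fx memvf.
exists c => y; have /vlineP[d ->] : y \in <[x]>%VS by rewrite -fx memvf.
by rewrite linearZ /= cE !scalerA mulrC.
Qed.

Lemma commuting_irrep X : irrep X ->
  (forall a b (x : X), ract (a * b) x = ract (b * a) x) -> \dim {:X} = 1%N.
Proof.
move=> iX cX; have sc a : exists c, forall x : X, ract a x = c *: x.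
  have hr : is_hom (linfun (ract a) : 'End(X)).
    by move=> b x; rewrite !lfunE /= -!ractM cX.
  have [c cE] := schur_scalar iX hr; exists c => x; by rewrite -cE lfunE.
have [x x0] : exists x : X, x != 0.
  by have := iX.1; rewrite lt0n dimv_eq0 -vpick0 => x0; exists (vpick {:X}).
have st : stable <[x]>%VS.
  by move=> a y; have [c ->] := sc a; apply: memvZ.
case: (iX.2 _ st) => [/eqP|<-]; last by rewrite dim_vline x0.
by rewrite -dimv_eq0 dim_vline x0.
Qed.

End ClosedField.

Section CharacterModule.
Variables (k : fieldType) (A : falgType k) (f : vdual A).
Hypotheses (f1 : f 1 = 1) (fM : forall a b, f (a * b) = f a * f b).
Definition char_act (a : A) (x : k^o) : k^o := f a *: x.
Fact char_bilin : bilin char_act.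
Proof.
split=> [w|v] a x y; rewrite /char_act; first by rewrite linearP scalerDl scalerA.
by rewrite scalerDr !scalerA mulrC.
Qed.
Fact char_act1 x : char_act 1 x = x. Proof. by rewrite /char_act f1 scale1r. Qed.
Fact char_actM a b x : char_act (a * b) x = char_act a (char_act b x).
Proof. by rewrite /char_act fM scalerA. Qed.
Definition char_rep : rep A := Rep char_bilin char_act1 char_actM.
End CharacterModule.

(** * Hopf algebras *)

Section TensorFacts.
Variable k : fieldType.
Implicit Types V W U : vectType k.

Lemma scalel_bilin V W U (f : {linear V -> k^o}) (g : {linear W -> U}) :
  bilin (fun v w => (f v : k) *: g w).
Proof.
split=> [w|v] a x y; first by rewrite linearP scalerDl scalerA.
by rewrite linearP scalerDr !scalerA mulrC.
Qed.

Lemma scaler_bilin V W U (f : {linear V -> U}) (g : {linear W -> k^o}) :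
  bilin (fun v w => (g w : k) *: f v).
Proof.
split=> [w|v] a x y; last by rewrite linearP scalerDl scalerA.
by rewrite linearP scalerDr !scalerA mulrC.
Qed.

Definition evalt V W (f : vdual V) (g : vdual W) (t : tens V W) : k^o :=
  tlift (fun v w => f v * g w : k^o) t.
HB.instance Definition _ V W f g :=
  GRing.isLinear.Build k (tens V W) k^o _ (@evalt V W f g)
    (tlift_linear (fun v w => f v * g w : k^o)).

Lemma evalt_pure V W (f : vdual V) (g : vdual W) v w :
  evalt f g (v ⊗ w) = f v * g w.
Proof. by rewrite /evalt tlift_tpure //; apply: bilin_mulk. Qed.

Lemma evalt_inj V W (s t : tens V W) :
  (forall f g, evalt f g s = evalt f g t) -> s = t.
Proof.
move=> st; apply/matrixP => i j.
have E (r : tens V W) : r i j = evalt (dbas i) (dbas j) r.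
  elim/tens_ind: r => [|x y IHx IHy|v w]; first by rewrite linear0 mxE.
    by rewrite linearD /= -IHx -IHy mxE.
  by rewrite evalt_pure !dbasE mxE.
by rewrite !E st.
Qed.

Lemma evalt_tmap V W V' W' (F : {linear V -> V'}) (G : {linear W -> W'})
  (f : vdual V') (g : vdual W') t :
  evalt f g (tmap F G t) = tlift (fun v w => f (F v) * g (G w) : k^o) t.
Proof.
elim/tens_ind: t => [|x y IHx IHy|v w]; first by rewrite !linear0.
  by rewrite !linearD /= IHx IHy.
rewrite tmap_tpure evalt_pure tlift_tpure //.
exact: (bilin_comp F G (bilin_mulk f g)).
Qed.

End TensorFacts.

Section Hopf.
Variables (k : fieldType) (H : hopfAlgType k).
Local Notation D := (vdual H).
Implicit Types (f g : D) (h x y : H).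

(** Coassociativity in Sweedler notation: in F(h1, h2, h3) either leg may be split first. [T] is the
    map on H ⊗ (H ⊗ H) induced by F. *)
Lemma sweedlerA (U : vectType k) (F : H -> H -> H -> U) :
  (forall y z, linear (fun x => F x y z)) ->
  (forall x z, linear (fun y => F x y z)) -> (forall x y, linear (F x y)) ->
  forall h,
  tlift (fun x y => tlift (fun x1 x2 => F x1 x2 y) (comul x)) (comul h) =
  tlift (fun x y => tlift (fun y1 y2 => F x y1 y2) (comul y)) (comul h).
Proof.
move=> F1 F2 F3 h; pose T (s : tens H (tens H H)) : U :=
  tlift (fun x s => tlift (fun y z => F x y z) s) s.
have Tl : linear T by apply: tlift_linear.
pose T' : {linear tens H (tens H H) -> U} := HB.pack T (GRing.isLinear.Build k _ _ _ T Tl).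
have bF x : bilin (fun y z => F x y z).
  by split=> [z|y] a u v; [apply: (F2 x z) | apply: (F3 x y)].
have bG : bilin (fun x s => tlift (fun y z => F x y z) s).
  split=> [s|x] a u v; last by rewrite linearP.
  by apply: tlift_fun_linear => y z; apply: (F1 y z).
have E0 x s : T' (x ⊗ s) = tlift (fun y z => F x y z) s.
  by rewrite /T' /= /T tlift_tpure.
have E1 s : T' (tmap idfun comul s) =
    tlift (fun x y => tlift (fun y1 y2 => F x y1 y2) (comul y)) s.
  elim/tens_ind: s => [|s t IHs IHt|x y]; first by rewrite !linear0.
    by rewrite !linearD IHs IHt.
  rewrite tmap_tpure E0 tlift_tpure //.
  split=> [w|w] a u v; last by rewrite !linearP.
  by apply: tlift_fun_linear => b c; apply: (F1 b c).
have E2 y s : T' (tassoc (s ⊗ y)) = tlift (fun x1 x2 => F x1 x2 y) s.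
  elim/tens_ind: s => [|s t IHs IHt|u v].
  - by rewrite (bilin0l (@tpure_bilin _ _ _)) !linear0.
  - by rewrite (bilinDl (@tpure_bilin _ _ _)) !linearD IHs IHt.
  by rewrite tassoc_tpure E0 !tlift_tpure.
have E3 s : T' (tassoc (tmap comul idfun s)) =
    tlift (fun x y => tlift (fun x1 x2 => F x1 x2 y) (comul x)) s.
  elim/tens_ind: s => [|s t IHs IHt|x y]; first by rewrite !linear0.
    by rewrite !linearD IHs IHt.
  rewrite tmap_tpure E2 tlift_tpure //.
  split=> [w|w] a u v; first by rewrite !linearP.
  by apply: tlift_fun_linear => b c; apply: (F3 b c).
by rewrite -E3 -E1 comulA.
Qed.

Definition algchar f : Prop := f 1 = 1 /\ forall x y, f (x * y) = f x * f y.

Lemma evalt_comul f g h : evalt f g (comul h) = (f * g) h.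
Proof. by rewrite -[RHS]/(dmul f g h) dmulE. Qed.

Lemma grouplike_dualP f : grouplikes (vdual H) f <-> algchar f.
Proof.
split=> [[df f1]|[f1 fM]]; split=> //.
  by move=> x y; rewrite -dcomulE -[dcomul f]/(comul f) df eval2_pure.
by apply: eval2_inj => x y; rewrite -[comul f]/(dcomul f) dcomulE eval2_pure.
Qed.

Lemma dual1E h : (1 : D) h = counit h.
Proof. by rewrite -[LHS]/(dunit H h) dunitE. Qed.

(* Transposes of the multiplications by f in H*, see lshE and rshE: identities
   between them reduce to associativity of H*. *)
Definition lsh f h : H := tlift (fun x y => (f x : k) *: y) (comul h).
Definition rsh f h : H := tlift (fun x y => (f y : k) *: x) (comul h).

Fact lsh_linear f : linear (lsh f).
Proof. by move=> a x y; rewrite /lsh !linearP. Qed.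
Fact rsh_linear f : linear (rsh f).
Proof. by move=> a x y; rewrite /rsh !linearP. Qed.
HB.instance Definition _ f := GRing.isLinear.Build k H H _ (lsh f) (lsh_linear f).
HB.instance Definition _ f := GRing.isLinear.Build k H H _ (rsh f) (rsh_linear f).

Lemma lshE f g h : g (lsh f h) = (f * g) h.
Proof. by rewrite -evalt_comul linear_tlift; apply: eq_tlift => x y; rewrite linearZ. Qed.
Lemma rshE f g h : g (rsh f h) = (g * f) h.
Proof.
rewrite -evalt_comul linear_tlift; apply: eq_tlift => x y.
by rewrite linearZ; apply: mulrC.
Qed.

Lemma lsh_comp f g h : lsh f (lsh g h) = lsh (g * f) h.
Proof. by apply: vdual_sep => l; rewrite !lshE mulrA. Qed.
Lemma lsh_rshC f g h : lsh f (rsh g h) = rsh g (lsh f h).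
Proof. by apply: vdual_sep => l; rewrite !(lshE, rshE) mulrA. Qed.
Lemma lsh1 h : lsh 1 h = h.
Proof. by apply: vdual_sep => l; rewrite lshE mul1r. Qed.
(** Only the left leg moves. Hence the common fixed points K of such shifts satisfy Delta(K) ⊂ K ⊗
    H, but need not form a subcoalgebra a priori. *)
Lemma comul_lsh f h : comul (lsh f h) = tmap (lsh f) idfun (comul h).
Proof.
apply: evalt_inj => g l; rewrite evalt_comul lshE mulrA -evalt_comul evalt_tmap.
by apply: eq_tlift => x y; rewrite lshE.
Qed.
Lemma comul_rsh f h : comul (rsh f h) = tmap idfun (rsh f) (comul h).
Proof.
apply: evalt_inj => g l; rewrite evalt_comul rshE -mulrA -evalt_comul evalt_tmap.
by apply: eq_tlift => x y; rewrite rshE.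
Qed.
(** Both sides are h1 ⊗ f(h2) h3. In [comul_K] this passes an invariance from the left leg to the
    right one. *)
Lemma tmap_lsh_rsh f h : tmap (rsh f) idfun (comul h) = tmap idfun (lsh f) (comul h).
Proof.
apply: evalt_inj => g l; rewrite !evalt_tmap.
transitivity ((g * f * l) h).
  by rewrite -evalt_comul; apply: eq_tlift => x y; rewrite rshE.
by rewrite -mulrA -evalt_comul; apply: eq_tlift => x y; rewrite lshE.
Qed.

Lemma counit_lsh f h : counit (lsh f h) = f h.
Proof. by rewrite -dual1E lshE mulr1. Qed.
Lemma scale_bilinH f : bilin (fun x y : H => (f x : k) *: y).
Proof. exact: (scalel_bilin f idfun). Qed.
Lemma scale_bilinHr f : bilin (fun x y : H => (f y : k) *: x).
Proof. exact: (scaler_bilin idfun f). Qed.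

Lemma lsh_one f : algchar f -> lsh f 1 = 1.
Proof.
move=> [f1 _]; rewrite /lsh comul1 -[X in tlift _ X]/(1 ⊗ 1).
by rewrite tlift_tpure ?f1 ?scale1r //; apply: scale_bilinH.
Qed.
Lemma tlift_tensM (A B C : falgType k) (F : {linear tens A B -> C}) :
  (forall a b a' b', F ((a * a') ⊗ (b * b')) = F (a ⊗ b) * F (a' ⊗ b')) ->
  forall s t : tens A B, F (s * t) = F s * F t.
Proof.
move=> FM; elim/tens_ind=> [|s s' IHs IHs'|a b] t.
- by rewrite mul0r !linear0 mul0r.
- by rewrite mulrDl !linearD /= mulrDl IHs IHs'.
elim/tens_ind: t => [|t t' IHt IHt'|a' b'].
- by rewrite mulr0 !linear0 mulr0.
- by rewrite mulrDr !linearD /= mulrDr IHt IHt'.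
by rewrite -[_ * _]/(tmul _ _) tmul_pure FM.
Qed.

Lemma lshM f x y : algchar f -> lsh f (x * y) = lsh f x * lsh f y.
Proof.
move=> [f1 fM]; rewrite /lsh comulM.
apply: (tlift_tensM (F := tlift _)) => a b a' b' /=.
by rewrite !tlift_tpure ?fM -?scalerAl -?scalerAr ?scalerA //; apply: scale_bilinH.
Qed.
Lemma rshM f x y : algchar f -> rsh f (x * y) = rsh f x * rsh f y.
Proof.
move=> [f1 fM]; rewrite /rsh comulM.
apply: (tlift_tensM (F := tlift _)) => a b a' b' /=.
by rewrite !tlift_tpure ?fM -?scalerAl -?scalerAr ?scalerA //; apply: scale_bilinHr.
Qed.

Lemma algchar1 : algchar 1.
Proof. by split=> [|x y]; rewrite !dual1E ?counit1 ?counitM. Qed.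
Lemma algcharM f g : algchar f -> algchar g -> algchar (f * g).
Proof.
move=> cf cg; split=> [|x y]; first by rewrite -lshE lsh_one // cg.1.
by rewrite -!lshE lshM // cg.2.
Qed.

Lemma dantiE f h : (antipode f : D) h = f (antipode h).
Proof. by rewrite -[LHS]/(dantipode f h) dantipodeE. Qed.

(** The antipode reverses coproducts, so it exchanges [lsh] and [rsh]; dually this is [antipodeM] in
    H*. *)
Lemma lsh_antipode f h : lsh f (antipode h) = antipode (rsh (antipode f) h).
Proof.
by apply: vdual_sep => g; rewrite lshE -!dantiE antipodeM rshE.
Qed.
Lemma rsh_antipode f h : rsh f (antipode h) = antipode (lsh (antipode f) h).
Proof.
by apply: vdual_sep => g; rewrite rshE -!dantiE antipodeM lshE.
Qed.

Lemma algchar_anti f : algchar f -> algchar (antipode f).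
Proof.
move=> [f1 fM]; split=> [|x y]; rewrite !dantiE ?antipode1 //.
by rewrite antipodeM fM; apply: mulrC.
Qed.
End Hopf.

Section Antipode.
Variables (k : fieldType) (H : hopfAlgType k).
Local Notation D := (vdual H).
Implicit Types (f g : D) (h x y : H).

Lemma algchar_antil f : algchar f -> antipode f * f = 1.
Proof.
move=> [f1 fM]; apply/lfunP => h; rewrite -evalt_comul dual1E /evalt.
transitivity (f (tlift (fun x y => antipode x * y) (comul h))).
  by rewrite linear_tlift; apply: eq_tlift => x y; rewrite /= fM dantiE.
by rewrite antipodel linearZ /= f1; apply: mulr1.
Qed.
Lemma algchar_antir f : algchar f -> f * antipode f = 1.
Proof.
move=> [f1 fM]; apply/lfunP => h; rewrite -evalt_comul dual1E /evalt.
transitivity (f (tlift (fun x y => x * antipode y) (comul h))).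
  by rewrite linear_tlift; apply: eq_tlift => x y; rewrite /= fM dantiE.
by rewrite antipoder linearZ /= f1; apply: mulr1.
Qed.

Lemma lshVK f : algchar f -> cancel (lsh (antipode f)) (lsh f).
Proof. by move=> cf h; rewrite lsh_comp algchar_antil // lsh1. Qed.
Lemma grouplike_antil (g : H) : grouplikes H g -> antipode g * g = 1.
Proof.
move=> [dg eg]; have := antipodel g; rewrite dg eg scale1r tlift_tpure //.
exact: (bilin_comp _ idfun (@mul_bilin k H)).
Qed.
Lemma grouplike_antir (g : H) : grouplikes H g -> g * antipode g = 1.
Proof.
move=> [dg eg]; have := antipoder g; rewrite dg eg scale1r tlift_tpure //.
exact: (bilin_comp idfun _ (@mul_bilin k H)).
Qed.
Lemma lsh_grouplike f (g : H) : grouplikes H g -> lsh f g = (f g : k) *: g.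
Proof. by move=> [dg _]; rewrite /lsh dg tlift_tpure //; apply: scale_bilinH. Qed.
Lemma rsh_grouplike f (g : H) : grouplikes H g -> rsh f g = (f g : k) *: g.
Proof. by move=> [dg _]; rewrite /rsh dg tlift_tpure //; apply: scale_bilinHr. Qed.

Lemma grouplikeM (g h : H) : grouplikes H g -> grouplikes H h -> grouplikes H (g * h).
Proof.
move=> [dg eg] [dh eh]; split; last by rewrite counitM eg eh mulr1.
by rewrite comulM dg dh -[LHS]/(tmul _ _) tmul_pure.
Qed.
End Antipode.

(** * The adjoint action on linear maps *)

Section HomRep.
Variables (k : fieldType) (H : hopfAlgType k).
Local Notation D := (vdual H).
Implicit Types (X Y : rep H) (f : D) (h x y : H).

Definition rho X (a : H) : 'End(X) := linfun (ract a).
Lemma rhoE X a v : rho X a v = ract a v. Proof. by rewrite lfunE. Qed.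
Fact rho_linear X : linear (rho X).
Proof.
move=> c a b; apply/lfunP => v; rewrite add_lfunE scale_lfunE !rhoE.
by rewrite (ract_bilin X).1.
Qed.
HB.instance Definition _ X := GRing.isLinear.Build k H 'End(X) _ (rho X) (rho_linear X).

Section Def.
Variables X Y : rep H.
(** This is Y ⊗ X*, with action h1 F S(h2), carried by the linear maps themselves so that
    composition and traces are directly available. *)
Definition hom_act (a : H) (F : 'Hom(X, Y)) : 'Hom(X, Y) :=
  tlift (fun x y => (rho Y x \o F \o rho X (antipode y))%VF) (comul a).

Lemma hom_bilin_in F :
  bilin (fun x y => (rho Y x \o F \o rho X (antipode y))%VF).
Proof.
split=> [w|v] c x y; first by rewrite linearP /= !comp_lfunDl -!comp_lfunZl.
by rewrite !linearP /= !comp_lfunDr -!comp_lfunZr.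
Qed.

Lemma hom_actE a F v : hom_act a F v =
  tlift (fun x y => ract x (F (ract (antipode y) v))) (comul a).
Proof.
by rewrite /hom_act tlift_lfunE; apply: eq_tlift => x y; rewrite !comp_lfunE !rhoE.
Qed.

Fact hom_act_bilin : bilin hom_act.
Proof.
split=> [F|a] c s t; first by rewrite /hom_act !linearP.
apply: tlift_fun_linear => x y.
by rewrite comp_lfunDr comp_lfunDl -comp_lfunZr -comp_lfunZl.
Qed.

Fact hom_act1 F : hom_act 1 F = F.
Proof.
rewrite /hom_act comul1 -[X in tlift _ X]/(1 ⊗ 1) tlift_tpure; last exact: hom_bilin_in.
by apply/lfunP => v; rewrite !comp_lfunE !rhoE antipode1 !ract1.
Qed.

Fact hom_actM a b F : hom_act (a * b) F = hom_act a (hom_act b F).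
Proof.
rewrite /hom_act comulM tlift_mul; last exact: hom_bilin_in.
apply: eq_tlift => x y; apply/lfunP => v.
rewrite tlift_lfunE !comp_lfunE !rhoE tlift_lfunE linear_tlift.
apply: eq_tlift => x' y'.
by rewrite !comp_lfunE !rhoE antipodeM !ractM.
Qed.
Definition hom_rep : rep H := Rep hom_act_bilin hom_act1 hom_actM.
End Def.

(** h F = h1 F S(h2) h3 = f(h1) F h2. *)
Lemma weight_shift X Y f (F : 'Hom(X, Y)) :
  (forall h, hom_act h F = (f h : k) *: F) ->
  forall h v, ract h (F v) = F (ract (lsh f h) v).
Proof.
move=> wF h v.
pose G (x y z : H) : Y := ract x (F (ract (antipode y) (ract z v))).
have E : tlift (fun x y => tlift (fun y1 y2 => G x y1 y2) (comul y)) (comul h) =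
    tlift (fun x y => tlift (fun x1 x2 => G x1 x2 y) (comul x)) (comul h).
  symmetry; apply: sweedlerA.
  - by move=> y z a s t; rewrite /G (ract_bilin Y).1.
  - by move=> x z a s t; rewrite /G linearP (ract_bilin X).1 !linearP.
  - by move=> x y a s t; rewrite /G (ract_bilin X).1 !linearP.
transitivity (tlift (fun x y => (f x : k) *: F (ract y v)) (comul h)); last first.
  have -> : F (ract (lsh f h) v) = lapply v (F \o rho X (lsh f h))%VF.
    by rewrite /lapply comp_lfunE rhoE.
  rewrite /lapply comp_lfunE linear_tlift tlift_lfunE linear_tlift.
  by apply: eq_tlift => x y; rewrite linearZ scale_lfunE linearZ rhoE.
transitivity (tlift (fun x y => tlift (fun y1 y2 => G x y1 y2) (comul y)) (comul h)).
  rewrite -[in LHS](counitr h) -[LHS]rhoE linear_tlift tlift_lfunE.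
  apply: eq_tlift => x y; rewrite linearZ scale_lfunE rhoE /G.
  transitivity (rho Y x (F (rho X (tlift (fun y1 y2 => antipode y1 * y2) (comul y)) v))).
    by rewrite antipodel linearZ scale_lfunE !rhoE ract1 !linearZ.
  rewrite linear_tlift tlift_lfunE linear_tlift linear_tlift.
  by apply: eq_tlift => y1 y2; rewrite /= !rhoE ractM.
rewrite E; apply: eq_tlift => x y; rewrite /G -hom_actE wF scale_lfunE //.
Qed.

(** h1 F S(h2) = F [lsh f](h1) S(h2). By [comul_lsh] this is F composed with g1 S(g2) for g =
    [lsh f h], and the counit of g is f h. *)
Lemma shift_weight X Y f (F : 'Hom(X, Y)) :
  (forall h v, ract h (F v) = F (ract (lsh f h) v)) ->
  forall h, hom_act h F = (f h : k) *: F.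
Proof.
move=> sF h; apply/lfunP => v; rewrite hom_actE scale_lfunE.
transitivity (F (ract (tlift (fun x y => lsh f x * antipode y) (comul h)) v)).
  rewrite -[X in F X]rhoE linear_tlift tlift_lfunE linear_tlift.
  by apply: eq_tlift => x y; rewrite sF rhoE ractM.
have <- : tlift (fun x y => x * antipode y) (comul (lsh f h)) =
    tlift (fun x y => lsh f x * antipode y) (comul h).
  rewrite comul_lsh; elim/tens_ind: (comul h) => [|s t IHs IHt|x y].
  - by rewrite !linear0.
  - by rewrite !linearD /= IHs IHt.
  rewrite tmap_tpure !tlift_tpure //; last exact: (bilin_comp idfun _ (@mul_bilin k H)).
  exact: (bilin_comp _ _ (@mul_bilin k H)).
by rewrite antipoder counit_lsh (bilinZl (ract_bilin X)) ract1 linearZ.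
Qed.

Lemma invariant_hom X Y (F : 'Hom(X, Y)) :
  (forall h, hom_act h F = (counit h : k) *: F) -> is_hom F.
Proof.
move=> iF h v; rewrite -{1}(lsh1 h); apply/esym/weight_shift => a.
by rewrite iF dual1E.
Qed.

End HomRep.

(** * Integrals and complete reducibility *)

Section Maschke.
Variables (k : fieldType) (H : hopfAlgType k) (L : H).
Hypotheses (LP : forall a, a * L = (counit a : k) *: L) (L1 : counit L = 1).
Implicit Types X Y : rep H.

Lemma average_hom X Y (F : 'Hom(X, Y)) : is_hom (hom_act L F).
Proof.
apply: invariant_hom => h; rewrite -hom_actM LP.
exact: (bilinZl (@hom_act_bilin _ _ _ _)).
Qed.

(** Averaging a linear projection onto U by the integral gives an H-linear one: its image stays in U
    because U is stable, and it is the identity on U because L1 S(L2) = 1. The kernel is the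
    complement. *)
Lemma maschke X : completely_reducible X.
Proof.
move=> U sU; pose P : 'End(X) := hom_act L (projv U).
have PU v : P v \in U.
  rewrite hom_actE; apply: (big_ind (fun x => x \in U)) => [||i _].
  - exact: mem0v.
  - exact: memvD.
  apply: memv_suml => j _; apply/memvZ/sU; exact: memv_proj.
have Pid v : v \in U -> P v = v.
  move=> vU; rewrite hom_actE.
  transitivity (ract (tlift (fun x y => x * antipode y) (comul L)) v).
    rewrite -[RHS]rhoE linear_tlift tlift_lfunE; apply: eq_tlift => x y.
    by rewrite projv_id ?sU // rhoE ractM.
  by rewrite antipoder L1 scale1r ract1.
exists (lker P); split; first exact/stable_lker/average_hom.
  apply/vspaceP => v; rewrite memvf -[v](subrK (P v)) addrC memv_add //.
  by rewrite memv_ker linearB /= (Pid (P v)) ?PU // subrr.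
apply/vspaceP => v; rewrite memv0; apply/idP/eqP => [|->]; last exact: mem0v.
by rewrite memv_cap memv_ker => /andP[/Pid-> /eqP].
Qed.
End Maschke.

(** L is the component of 1 in a complement W of the augmentation ideal; a L - counit(a) L lies both
    in W and in that ideal. *)
Lemma semisimple_integral (k : fieldType) (H : hopfAlgType k) : semisimple H ->
  exists2 L : H, forall a, a * L = (counit a : k) *: L & counit L = 1.
Proof.
move=> ss; pose e : 'Hom(H, k^o) := linfun counit.
have eE h : e h = counit h by rewrite lfunE.
have [|W [sW eW eW0]] := ss (lker e : {vspace regular_rep H}).
  by move=> a v; rewrite !memv_ker !eE counitM => /eqP->; rewrite mulr0.
have : (1 : H) \in (lker e + W)%VS by rewrite eW memvf.
case/memv_addP => v vk [L LW oneE].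
have L1 : counit L = 1.
  by move: vk; rewrite -[LHS]add0r memv_ker eE => /eqP <-; rewrite -linearD -oneE counit1.
exists L => // a; apply/eqP; rewrite -subr_eq0 -memv0 -eW0 memv_cap.
rewrite memv_ker eE linearB linearZ /= counitM L1 subrr eqxx /=.
by apply: memvB; [apply: sW | apply: memvZ].
Qed.

(** * R-matrices *)

Section Slices.
Variable k : fieldType.

Definition slicel (V W : vectType k) (f : vdual V) (t : tens V W) : W :=
  tlift (fun v w => (f v : k) *: w) t.
Definition slicer (V W : vectType k) (f : vdual W) (t : tens V W) : V :=
  tlift (fun v w => (f w : k) *: v) t.
HB.instance Definition _ V W f := GRing.isLinear.Build k (tens V W) W _
  (@slicel V W f) (tlift_linear (fun v w => (f v : k) *: w)).
HB.instance Definition _ V W f := GRing.isLinear.Build k (tens V W) V _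
  (@slicer V W f) (tlift_linear (fun v w => (f w : k) *: v)).

Lemma slicel_pure (V W : vectType k) (f : vdual V) v (w : W) :
  slicel f (v ⊗ w) = (f v : k) *: w.
Proof. by rewrite /slicel tlift_tpure //; apply: (scalel_bilin f idfun). Qed.
Lemma slicer_pure (V W : vectType k) (f : vdual W) (v : V) w :
  slicer f (v ⊗ w) = (f w : k) *: v.
Proof. by rewrite /slicer tlift_tpure //; apply: (scaler_bilin idfun f). Qed.

Lemma tensM_pure (A B : falgType k) (a c : A) (b d : B) :
  (a ⊗ b) * (c ⊗ d) = (a * c) ⊗ (b * d).
Proof. exact: tmul_pure. Qed.

Variables A B : falgType k.

Lemma slicelM (f : vdual A) : (forall x y, f (x * y) = f x * f y) ->
  forall s t : tens A B, slicel f (s * t) = slicel f s * slicel f t.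
Proof.
move=> fM; apply: tlift_tensM => a b a' b' /=.
by rewrite !slicel_pure fM -scalerAl -scalerAr scalerA.
Qed.

Lemma slicerM (f : vdual B) : (forall x y, f (x * y) = f x * f y) ->
  forall s t : tens A B, slicer f (s * t) = slicer f s * slicer f t.
Proof.
move=> fM; apply: tlift_tensM => a b a' b' /=.
by rewrite !slicer_pure fM -scalerAl -scalerAr scalerA.
Qed.

Lemma tmapM (C E : falgType k) (F : {linear A -> C}) (G : {linear B -> E}) :
  {morph F : x y / x * y} -> {morph G : x y / x * y} ->
  forall s t : tens A B, tmap F G (s * t) = tmap F G s * tmap F G t.
Proof.
move=> FM GM; apply: tlift_tensM => a b a' b' /=.
by rewrite !tmap_tpure tensM_pure FM GM.
Qed.

Lemma tmap_comp (V W V' W' V'' W'' : vectType k) (F : {linear V -> V'})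
  (G : {linear W -> W'}) (F' : {linear V' -> V''}) (G' : {linear W' -> W''}) t :
  tmap F' G' (tmap F G t) = tmap (F' \o F) (G' \o G) t.
Proof.
elim/tens_ind: t => [|s t IHs IHt|v w]; first by rewrite !linear0.
  by rewrite !linearD /= IHs IHt.
by rewrite !tmap_tpure.
Qed.

Lemma eq_tmap (V W V' W' : vectType k) (F F' : V -> V') (G G' : W -> W') t :
  F =1 F' -> G =1 G' -> tmap F G t = tmap F' G' t.
Proof. by move=> FF' GG'; apply: eq_tlift => v w; rewrite FF' GG'. Qed.

HB.instance Definition _ (V W : vectType k) (v : V) :=
  GRing.isLinear.Build k W (tens V W) _ (@tpure k V W v) ((@tpure_bilin k V W).2 v).

End Slices.

Section Rmatrix.
Variables (k : fieldType) (H : hopfAlgType k) (R : tens H H).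
Hypothesis RP : is_Rmatrix R.
Local Notation D := (vdual H).
Implicit Types (f g : D) (h x y : H).

Lemma Rcomul h : tswap (comul h) * R = R * comul h.
Proof. by case: RP => Ru _ _ _ ->; rewrite mulrVK. Qed.

Definition uR f : H := slicer f R.
Definition vR f : H := slicel f R.

(** Apply f to the second leg of Delta^cop(h) R = R Delta(h). The companion [rsh_vR] comes from the
    first leg. *)
Lemma lsh_uR f h : algchar f -> lsh f h * uR f = uR f * rsh f h.
Proof.
move=> [_ fM]; have := congr1 (slicer f) (Rcomul h); rewrite !slicerM //.
suff -> : slicer f (tswap (comul h)) = lsh f h by [].
rewrite /lsh; elim/tens_ind: (comul h) => [|s t IHs IHt|x y]; first by rewrite !linear0.
  by rewrite !linearD /= IHs IHt.
by rewrite tswap_tpure slicer_pure tlift_tpure //; apply: scale_bilinH.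
Qed.

Lemma rsh_vR f h : algchar f -> rsh f h * vR f = vR f * lsh f h.
Proof.
move=> [_ fM]; have := congr1 (slicel f) (Rcomul h); rewrite !slicelM //.
suff -> : slicel f (tswap (comul h)) = rsh f h by [].
rewrite /rsh; elim/tens_ind: (comul h) => [|s t IHs IHt|x y]; first by rewrite !linear0.
  by rewrite !linearD /= IHs IHt.
by rewrite tswap_tpure slicel_pure tlift_tpure //; apply: scale_bilinHr.
Qed.

Let tb := @tpure_bilin k.

Lemma slicel_leg13 f : slicel f (leg13 R) = 1 ⊗ vR f.
Proof.
rewrite /leg13 /vR -[X in tmap _ X]/(tpure 1).
elim/tens_ind: R => [|s t IHs IHt|x y].
- by rewrite !linear0.
- by rewrite !linearD /= IHs IHt.
by rewrite tmap_tpure !slicel_pure linearZ.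
Qed.

Lemma slicel_leg12 f : slicel f (leg12 R) = vR f ⊗ 1.
Proof.
rewrite /leg12 /vR; elim/tens_ind: R => [|s t IHs IHt|x y].
- by rewrite !(linear0, bilin0l (tb _ _)).
- by rewrite !(linearD, bilinDl (tb _ _)) /= IHs IHt.
by rewrite tassoc_tpure !slicel_pure (bilinZl (tb _ _)).
Qed.

Lemma slicel_leg23 f : f 1 = 1 -> slicel f (leg23 R) = R.
Proof. by move=> f1; rewrite /leg23 slicel_pure f1 scale1r. Qed.

Lemma slicer_leg13 f : tmap idfun (slicer f) (leg13 R) = uR f ⊗ 1.
Proof.
rewrite /leg13 /uR -[X in tmap _ X R]/(tpure 1).
elim/tens_ind: R => [|s t IHs IHt|x y].
- by rewrite !(linear0, bilin0l (tb _ _)).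
- by rewrite !(linearD, bilinDl (tb _ _)) /= IHs IHt.
by rewrite !tmap_tpure /= !slicer_pure linearZ (bilinZl (tb _ _)).
Qed.

Lemma slicer_leg12 f : f 1 = 1 -> tmap idfun (slicer f) (leg12 R) = R.
Proof.
move=> f1; rewrite /leg12; elim/tens_ind: R => [|s t IHs IHt|x y].
- by rewrite !(linear0, bilin0l (tb _ _)).
- by rewrite !(linearD, bilinDl (tb _ _)) /= IHs IHt.
by rewrite tassoc_tpure tmap_tpure /= slicer_pure f1 scale1r.
Qed.

Lemma slicer_leg23 f : tmap idfun (slicer f) (leg23 R) = 1 ⊗ uR f.
Proof. by rewrite /leg23 tmap_tpure. Qed.

Lemma slicel_comull f t : slicel f (tassoc (tmap comul idfun t)) = tmap (lsh f) idfun t :> tens H H.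
Proof.
elim/tens_ind: t => [|s t IHs IHt|x y]; first by rewrite !linear0.
  by rewrite !linearD /= IHs IHt.
rewrite !tmap_tpure /= /lsh; elim/tens_ind: (comul x) => [|s t IHs IHt|u v].
- by rewrite !(linear0, bilin0l (tb _ _)).
- by rewrite !(linearD, bilinDl (tb _ _)) /= IHs IHt.
rewrite tassoc_tpure slicel_pure tlift_tpure ?(bilinZl (tb _ _)) //.
exact: scale_bilinH.
Qed.

Lemma slicel_comulr f (t : tens H H) : slicel f (tmap idfun comul t) = comul (slicel f t).
Proof.
elim/tens_ind: t => [|s t IHs IHt|x y]; first by rewrite !linear0.
  by rewrite !linearD /= IHs IHt.
by rewrite !tmap_tpure !slicel_pure linearZ.
Qed.

Lemma slicer_comulr f (t : tens H H) :
  tmap idfun (slicer f) (tmap idfun comul t) = tmap idfun (rsh f) t.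
Proof.
elim/tens_ind: t => [|s t IHs IHt|x y]; first by rewrite !linear0.
  by rewrite !linearD /= IHs IHt.
by rewrite !tmap_tpure.
Qed.

Lemma slicer_comull f (t : tens H H) :
  tmap idfun (slicer f) (tassoc (tmap comul idfun t)) = comul (slicer f t).
Proof.
elim/tens_ind: t => [|s t IHs IHt|x y]; first by rewrite !linear0.
  by rewrite !linearD /= IHs IHt.
rewrite !tmap_tpure /= slicer_pure linearZ /=.
elim/tens_ind: (comul x) => [|s t IHs IHt|u v].
- by rewrite !(linear0, bilin0l (tb _ _)).
- by rewrite !(linearD, bilinDl (tb _ _)) /= IHs IHt.
by rewrite tassoc_tpure tmap_tpure /= slicer_pure linearZ.
Qed.

(** Apply f to the first leg of (Delta ⊗ id)(R) = R13 R23. Likewise [rsh_R] comes from the last leg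
    of (id ⊗ Delta)(R) = R13 R12. *)
Lemma lsh_R f : algchar f -> tmap (lsh f) idfun R = (1 ⊗ vR f) * R.
Proof.
move=> [f1 fM]; case: RP => _ E _ _ _; rewrite -slicel_comull E slicelM //.
by rewrite slicel_leg13 slicel_leg23.
Qed.

Lemma rsh_R f : algchar f -> tmap idfun (rsh f) R = (uR f ⊗ 1) * R.
Proof.
move=> [f1 fM]; case: RP => _ _ E _ _; rewrite -slicer_comulr E tmapM //.
  by rewrite slicer_leg13 slicer_leg12.
exact: slicerM.
Qed.

(** The order is reversed, unlike in [vR_mul], because R13 precedes R12 in (id ⊗ Delta)(R). *)
Lemma uR_mul f g : algchar f -> algchar g -> uR (f * g) = uR g * uR f.
Proof.
move=> [f1 fM] cg; transitivity (slicer f (tmap idfun (rsh g) R)).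
  rewrite /uR; elim/tens_ind: R => [|s t IHs IHt|x y]; first by rewrite !linear0.
    by rewrite !linearD /= IHs IHt.
  by rewrite tmap_tpure !slicer_pure rshE.
by rewrite rsh_R // slicerM // slicer_pure f1 scale1r.
Qed.

Lemma vR_mul f g : algchar f -> algchar g -> vR (f * g) = vR f * vR g.
Proof.
move=> cf [g1 gM]; transitivity (slicel g (tmap (lsh f) idfun R)).
  rewrite /vR; elim/tens_ind: R => [|s t IHs IHt|x y]; first by rewrite !linear0.
    by rewrite !linearD /= IHs IHt.
  by rewrite tmap_tpure !slicel_pure lshE.
by rewrite lsh_R // slicelM // slicel_pure g1 scale1r.
Qed.

Lemma uR_one : uR 1 = 1.
Proof.
case: RP => _ _ _ [_ <-] _; apply: eq_tlift => x y.
by rewrite dual1E.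
Qed.
Lemma vR_one : vR 1 = 1.
Proof.
case: RP => _ _ _ [<- _] _; apply: eq_tlift => x y.
by rewrite dual1E.
Qed.

(** Applying the multiplicative f to the last leg of (Delta ⊗ id)(R) = R13 R23 gives u ⊗ u. *)
Lemma uR_grouplike f : algchar f -> grouplikes H (uR f).
Proof.
move=> [f1 fM]; case: RP => _ E _ _ _; split.
  rewrite -slicer_comull E tmapM //; last exact: slicerM.
  by rewrite slicer_leg13 slicer_leg23 tensM_pure mulr1 mul1r.
case: RP => _ _ _ [E1 _] _.
transitivity (f (tlift (fun x y : H => (counit x : k) *: y) R)); last by rewrite E1.
rewrite /uR; elim/tens_ind: R => [|s t IHs IHt|x y]; first by rewrite !linear0.
  by rewrite !linearD /= IHs IHt.
rewrite slicer_pure tlift_tpure ?linearZ /=; first exact: mulrC.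
exact: (scalel_bilin counit idfun).
Qed.

Lemma vR_grouplike f : algchar f -> grouplikes H (vR f).
Proof.
move=> [f1 fM]; case: RP => _ _ E _ _; split.
  rewrite -slicel_comulr E slicelM //.
  by rewrite slicel_leg13 slicel_leg12 tensM_pure mulr1 mul1r.
case: RP => _ _ _ [_ E1] _.
transitivity (f (tlift (fun x y : H => (counit y : k) *: x) R)); last by rewrite E1.
rewrite /vR; elim/tens_ind: R => [|s t IHs IHt|x y]; first by rewrite !linear0.
  by rewrite !linearD /= IHs IHt.
rewrite slicel_pure tlift_tpure ?linearZ /=; first exact: mulrC.
exact: (scaler_bilin idfun counit).
Qed.

Lemma uR_vR f g : g (uR f) = f (vR g).
Proof.
rewrite /uR /vR; elim/tens_ind: R => [|s t IHs IHt|x y]; first by rewrite !linear0.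
  by rewrite !linearD /= IHs IHt.
by rewrite slicer_pure slicel_pure !linearZ; apply: mulrC.
Qed.

End Rmatrix.

Ltac bilinear_product :=
  split=> [?|?] ? ? ? /=;
  rewrite ?(linearP, mulrDl, mulrDr) /= ?(linearP, mulrDl, mulrDr) -?(scalerAl, scalerAr) -?(scalerAl, scalerAr) -?(scalerAl, scalerAr) //.

Section Counit.
Variables (k : fieldType) (H : hopfAlgType k) (U : vectType k) (L : H -> U).
Hypothesis Ll : linear L.

Lemma counitl_lin h : tlift (fun x y => (counit x : k) *: L y) (comul h) = L h.
Proof.
rewrite -[in RHS](counitl h) -[RHS](linfunE Ll) linear_tlift.
by apply: eq_tlift => x y; rewrite linearZ /= linfunE.
Qed.

Lemma counitr_lin h : tlift (fun x y => (counit y : k) *: L x) (comul h) = L h.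
Proof.
rewrite -[in RHS](counitr h) -[RHS](linfunE Ll) linear_tlift.
by apply: eq_tlift => x y; rewrite linearZ /= linfunE.
Qed.
End Counit.

(** * The Drinfeld element *)

Section Drinfeld.
Variables (k : fieldType) (H : hopfAlgType k) (R : tens H H).
Hypothesis RP : is_Rmatrix R.
Local Notation D := (vdual H).
Local Notation S := (@antipode k H).
Implicit Types (f g : D) (h x y : H).

Definition drinfeld : H := tlift (fun a b => S b * a) R.
Local Notation w := drinfeld.

Let tb := @tpure_bilin k.

(** Apply x ⊗ y ⊗ z |-> S²(z) S(y) x to Delta^cop(h1) R ⊗ h2 = R Delta(h1) ⊗ h2. On the left a
    factor S(x1) x2 collapses and leaves S²(h) w; on the right S²(h3) S(h2) = S(h2 S(h3)) collapses
    and leaves w h. *)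
Lemma drinfeld_antipode2 h : S (S h) * w = w * h.
Proof.
pose Psi z (t : tens H H) := tlift (fun x y => S (S z) * S y * x) t.
have Psi0 z : Psi z 0 = 0 by rewrite /Psi linear0.
have PsiD z s t : Psi z (s + t) = Psi z s + Psi z t by rewrite /Psi linearD.
have PsiE z x y : Psi z (x ⊗ y) = S (S z) * S y * x.
  by rewrite /Psi tlift_tpure //; bilinear_product.
have bw : bilin (fun a b : H => S b * a) by bilinear_product.
have E1 z t : Psi z (R * t) = tlift (fun x y => S (S z) * S y * w * x) t.
  have bR (r : H) : bilin (fun x y : H => S (S z) * S y * r * x) by bilinear_product.
  elim/tens_ind: t => [|s t IHs IHt|x y]; first by rewrite mulr0 Psi0 linear0.
    by rewrite mulrDr PsiD linearD IHs IHt.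
  rewrite tlift_tpure // /drinfeld; elim/tens_ind: R => [|s t IHs IHt|a b].
  - by rewrite mul0r Psi0 linear0 mulr0 mul0r.
  - by rewrite mulrDl PsiD linearD mulrDr mulrDl IHs IHt.
  by rewrite tensM_pure PsiE tlift_tpure // antipodeM !mulrA.
have E2 z x : Psi z (tswap (comul x) * R) = (counit x : k) *: (S (S z) * w).
  have bt (r : H) : bilin (fun a b : H => S (S z) * S b * r * a) by bilinear_product.
  transitivity (tlift (fun a b => S (S z) * S b * tlift (fun x1 x2 => S x1 * x2) (comul x) * a) R).
    have bs : bilin (fun a b : H => S a * b) by bilinear_product.
    elim/tens_ind: R => [|s t IHs IHt|a b]; first by rewrite mulr0 Psi0 linear0.
      by rewrite mulrDr PsiD linearD IHs IHt.
    rewrite tlift_tpure //; elim/tens_ind: (comul x) => [|s t IHs IHt|u v].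
    - by rewrite !linear0 mul0r Psi0 mulr0 mul0r.
    - by rewrite !linearD mulrDl PsiD mulrDr mulrDl IHs IHt.
    by rewrite tswap_tpure tensM_pure PsiE tlift_tpure // antipodeM !mulrA.
  rewrite antipodel /drinfeld; elim/tens_ind: R => [|s t IHs IHt|a b].
  - by rewrite !linear0 mulr0 scaler0.
  - by rewrite !linearD mulrDr scalerDr; congr (_ + _).
  by rewrite !tlift_tpure // -!scalerAr mulr1 -scalerAl mulrA.
have E3 : tlift (fun x z => Psi z (tswap (comul x) * R)) (comul h) =
          tlift (fun x z => Psi z (R * comul x)) (comul h).
  by apply: eq_tlift => x z; rewrite Rcomul.
have -> : S (S h) * w = tlift (fun x z => Psi z (tswap (comul x) * R)) (comul h).
  rewrite -(@counitl_lin _ _ _ (fun z => S (S z) * w)).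
    by apply: eq_tlift => x z; rewrite E2.
  by move=> a x y; rewrite !linearP mulrDl scalerAl.
rewrite E3 -(@counitr_lin _ _ _ (fun x => w * x)); last first.
  by move=> a x y; rewrite mulrDr scalerAr.
transitivity (tlift (fun x z => tlift (fun x1 x2 => S (S z) * S x2 * w * x1) (comul x)) (comul h)).
  by apply: eq_tlift => x z; rewrite E1.
rewrite (@sweedlerA k H H (fun x y z => S (S z) * S y * w * x)).
- apply: eq_tlift => x y.
  transitivity (S (tlift (fun y1 y2 => y1 * S y2) (comul y)) * w * x).
    elim/tens_ind: (comul y) => [|s t IHs IHt|u v].
    - by rewrite !linear0 !mul0r.
    - by rewrite !linearD !mulrDl; congr (_ + _).
    by rewrite !tlift_tpure ?antipodeM //; bilinear_product.
  by rewrite antipoder linearZ antipode1 -!scalerAl mul1r.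
- by move=> y z a s t; rewrite mulrDr scalerAr.
- by move=> y z a s t; rewrite linearP mulrDr !mulrDl -scalerAr -!scalerAl.
- by move=> y z a s t; rewrite !linearP !mulrDl -!scalerAl.
Qed.

Definition drinfeld_inv : H := tlift (fun a b => b * S (S a)) R.

(** Apply x ⊗ y ⊗ z |-> y S(z) x to (id ⊗ Delta)(R) = R13 R12. The left side gives 1 and the right
    side sum b w a, where w a = S²(a) w. *)
Lemma drinfeld_invK : drinfeld_inv * w = 1.
Proof.
pose M (t : tens H (tens H H)) := tlift (fun x s => tlift (fun y z => y * S z) s * x) t.
have M0 : M 0 = 0 by rewrite /M linear0.
have MD s t : M (s + t) = M s + M t by rewrite /M linearD.
have bS : bilin (fun y z : H => y * S z) by bilinear_product.
have ME x s : M (x ⊗ s) = tlift (fun y z => y * S z) s * x.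
  by rewrite /M tlift_tpure //; bilinear_product.
have E1 : M (tmap idfun comul R) = 1.
  case: (RP) => _ _ _ [_ <-] _.
  elim/tens_ind: R => [|s t IHs IHt|a b]; first by rewrite !linear0 M0.
    by rewrite !linearD MD IHs IHt.
  rewrite tmap_tpure ME antipoder tlift_tpure -?scalerAl ?mul1r //.
  exact: (scaler_bilin idfun counit).
have bw (r : H) : bilin (fun a b : H => b * r * a) by bilinear_product.
have bS2 : bilin (fun a b : H => S b * a) by bilinear_product.
have E2 s t : M (tmap idfun (tpure 1) s * tassoc (t ⊗ (1 : H))) =
    tlift (fun a b => b * tlift (fun a' b' => S b' * a') s * a) t.
  elim/tens_ind: t => [|t t' IHt IHt'|a b].
  - by rewrite !(linear0, bilin0l (tb _ _)) mulr0 M0.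
  - by rewrite !(linearD, bilinDl (tb _ _)) mulrDr MD IHt IHt'.
  rewrite tassoc_tpure [RHS]tlift_tpure //.
  elim/tens_ind: s => [|s s' IHs IHs'|a' b'].
  - by rewrite !linear0 mul0r M0 mulr0 mul0r.
  - by rewrite !linearD mulrDl MD IHs IHs' mulrDr mulrDl.
  by rewrite tmap_tpure !tensM_pure ME !tlift_tpure // mul1r mulr1 !mulrA.
have : M (leg13 R * leg12 R) = 1 by case: (RP) => _ _ <- _ _.
rewrite /leg13 /leg12 -[X in tmap _ X]/(tpure 1) E2 -/w => <-.
have E3 t : tlift (fun a b => b * S (S a)) t * w = tlift (fun a b => b * w * a) t.
  elim/tens_ind: t => [|s t IHs IHt|a b]; first by rewrite !linear0 mul0r.
    by rewrite !linearD mulrDl; congr (_ + _).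
  rewrite !tlift_tpure //; first by rewrite -!mulrA drinfeld_antipode2.
  by bilinear_product.
exact: E3.
Qed.

(** S x = 0 gives w x = S²(x) w = 0, and w has a left inverse. *)
Lemma antipode_inj : injective S.
Proof.
suff S0 x : S x = 0 -> x = 0.
  by move=> x y /eqP; rewrite -subr_eq0 -linearB => /eqP/S0/eqP; rewrite subr_eq0 => /eqP.
move=> Sx; rewrite -[x]mul1r -drinfeld_invK -mulrA -drinfeld_antipode2 Sx.
by rewrite linear0 mul0r mulr0.
Qed.

Section Char.
Variable f : D.
Hypothesis cf : algchar f.
Local Notation f' := (antipode f).
Local Notation u := (uR R f).
Local Notation v := (vR R f).

(** v carries [lsh f h] to [rsh f h] and u carries it back; every element has the form [lsh f h]. *)
Lemma uv_central h : u * v * h = h * (u * v).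
Proof.
rewrite -[h](lshVK cf) mulrA (lsh_uR RP) // -!mulrA -(rsh_vR RP) //.
Qed.

Definition uv_inv : H := S v * uR R f'.

Lemma uR_antil : uR R f' * u = 1.
Proof. by rewrite -(uR_mul RP) ?algchar_antir ?(uR_one RP) //; apply: algchar_anti. Qed.
Lemma uR_antir : u * uR R f' = 1.
Proof. by rewrite -(uR_mul RP) ?algchar_antil ?(uR_one RP) //; apply: algchar_anti. Qed.

Lemma uv_invl : uv_inv * (u * v) = 1.
Proof.
rewrite /uv_inv mulrA -[S v * _ * _]mulrA uR_antil mulr1.
exact/grouplike_antil/vR_grouplike.
Qed.
Lemma uv_invr : u * v * uv_inv = 1.
Proof.
rewrite /uv_inv mulrA -[u * v * _]mulrA grouplike_antir ?mulr1 ?uR_antir //.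
exact/vR_grouplike.
Qed.

Lemma uv_inv_central h : uv_inv * h = h * uv_inv.
Proof.
rewrite -[LHS]mulr1 -uv_invr [LHS]mulrA -[_ * h * (u * v)]mulrA -uv_central.
by rewrite [uv_inv * _]mulrA uv_invl mul1r.
Qed.

(** For R = sum a ⊗ b, [lsh f] sends S(b) a to S([rsh f'] b) [lsh f] a, so [lsh_R] and [rsh_R] apply
    to the two legs of R. The scalar arises because [rsh f'] multiplies the group-like v by f'(v);
    the remaining factor is the inverse of uv. *)
Lemma lsh_drinfeld : lsh f w = (f' v : k) *: (uv_inv * w).
Proof.
have cf' := algchar_anti cf.
have bS : bilin (fun a b : H => S b * a) by bilinear_product.
have E1 t : lsh f (tlift (fun a b => S b * a) t) =
    tlift (fun a b => S b * a) (tmap (lsh f) (rsh f') t).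
  elim/tens_ind: t => [|s t IHs IHt|a b]; first by rewrite !linear0.
    by rewrite !linearD /= IHs IHt.
  by rewrite tmap_tpure !tlift_tpure // lshM // lsh_antipode.
have E2 t : tlift (fun a b => S b * a) ((1 ⊗ rsh f' v) * ((uR R f' ⊗ 1) * t)) =
    (f' v : k) *: (uv_inv * tlift (fun a b => S b * a) t).
  elim/tens_ind: t => [|s t IHs IHt|a b].
  - by rewrite !(linear0, mulr0).
  - by rewrite !mulrDr !linearD mulrDr scalerDr; congr (_ + _).
  rewrite !tensM_pure !tlift_tpure // rsh_grouplike; last exact: vR_grouplike.
  rewrite !mul1r -scalerAl linearZ /= -scalerAl antipodeM uv_inv_central.
  by congr (_ *: _); rewrite -[RHS]mulrA -uv_inv_central /uv_inv !mulrA.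
rewrite /drinfeld E1 -E2 -rsh_R //; congr (tlift _ _).
transitivity (tmap idfun (rsh f') (tmap (lsh f) idfun R)).
  by rewrite tmap_comp; apply: eq_tmap.
rewrite (lsh_R RP) // tmapM ?tmap_tpure //.
by move=> x y; apply: rshM.
Qed.

End Char.
End Drinfeld.

(** * Weights and gradings *)

Section GroupOfLaws.
Variables (T : finType) (mul : T -> T -> T) (one : T) (inv : T -> T).
Hypotheses (mA : associative mul) (m1 : left_id one mul)
  (mV : left_inverse one inv mul).
(** The laws enter the body only to make the alias depend on them, so that the group structure can
    be attached to it. *)
Definition group_of_laws : Type := let _ := (mA, m1, mV) in T.
HB.instance Definition _ := Finite.on group_of_laws.
HB.instance Definition _ := Finite_isGroup.Build group_of_laws mA m1 mV.
End GroupOfLaws.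

(** Gradings are indexed by a [finGroupType]; this turns a finite multiplicative group sitting
    inside a ring into one. *)
Lemma fin_group (A : nzRingType) (T : finType) (e : T -> A) :
  injective e -> (exists i, e i = 1) ->
  (forall i j, exists l, e l = e i * e j) ->
  (forall i, exists j, e j * e i = 1) ->
  exists (G : finGroupType) (r : G -> A),
  [/\ injective r, r 1%g = 1, forall g h, r (g * h)%g = r g * r h,
      (forall i, exists g, r g = e i) /\ (forall g, exists i, r g = e i)
    & #|G| = #|T|].
Proof.
move=> ei [i1 e1] eM eV.
have [m mE] := choice (fun ij => eM ij.1 ij.2).
have [v vE] := choice eV.
pose mul i j := m (i, j).
have mulE i j : e (mul i j) = e i * e j by rewrite mE.
have mA : associative mul by move=> x y z; apply: ei; rewrite !mulE mulrA.
have m1 : left_id i1 mul by move=> x; apply: ei; rewrite mulE e1 mul1r.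
have mV : left_inverse i1 v mul by move=> x; apply: ei; rewrite mulE vE e1.
exists (group_of_laws mA m1 mV : finGroupType), e; split=> //.
  by split=> i; exists i.
by apply: (bij_eq_card (f := id : group_of_laws mA m1 mV -> T)); exists id.
Qed.

Section Weights.
Variables (k : closedFieldType) (H : hopfAlgType k).
Local Notation D := (vdual H).
Implicit Types (f g : D) (h : H) (X Y Z : rep H).

(* Vectors of weight f for the adjoint action on Hom(X, Y), see weightedP. *)
Definition weighted X Y f (F : 'Hom(X, Y)) : Prop :=
  forall h v, ract h (F v) = F (ract (lsh f h) v).

Lemma weightedP X Y f (F : 'Hom(X, Y)) :
  weighted f F <-> forall h, hom_act h F = (f h : k) *: F.
Proof. by split=> [/shift_weight|/weight_shift]. Qed.

Lemma weighted_comp X Y Z f g (F : 'Hom(Y, Z)) (F' : 'Hom(X, Y)) :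
  weighted f F -> weighted g F' -> weighted (f * g) (F \o F')%VF.
Proof. by move=> wF wF' h v; rewrite !comp_lfunE wF wF' lsh_comp. Qed.

Lemma weighted1 X Y (F : 'Hom(X, Y)) : weighted 1 F <-> is_hom F.
Proof. by split=> wF h v; have := wF h v; rewrite ?lsh1. Qed.

(** Schur's lemma up to the twist by [lsh f]: since [lsh f] is surjective, the kernel of F is still
    stable. *)
Lemma weighted_inj X Y f (F : 'Hom(X, Y)) : algchar f -> irrep X ->
  weighted f F -> F != 0 -> lker F = 0%VS.
Proof.
move=> cf [_ iX] wF F0; have sk : stable (lker F).
  move=> a v; rewrite !memv_ker => /eqP Fv; apply/eqP.
  by rewrite -[a](lshVK cf) -wF Fv linear0.
case: (iX _ sk) => // kF; case/eqP: F0; apply/lfunP => x.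
by rewrite zero_lfunE; apply/eqP; rewrite -memv_ker kF memvf.
Qed.

Lemma weighted_surj X Y f (F : 'Hom(X, Y)) : irrep Y ->
  weighted f F -> F != 0 -> limg F = fullv.
Proof.
move=> [_ iY] wF F0; have sk : stable (limg F).
  by move=> a v /memv_imgP[x _ ->]; rewrite wF memv_img ?memvf.
case: (iY _ sk) => // kF; case/eqP: F0; apply/lfunP => x.
by rewrite zero_lfunE; apply/eqP; rewrite -memv0 -kF memv_img ?memvf.
Qed.

(** The composite of F^-1 and F' is H-linear, hence scalar. So a linear character occurs at most
    once in Hom(X, Y). *)
Lemma weighted_unique X Y f (F F' : 'Hom(X, Y)) : algchar f -> irrep X -> irrep Y ->
  weighted f F -> F != 0 -> weighted f F' -> exists c, F' = c *: F.
Proof.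
move=> cf iX iY wF F0 wF'.
have kF : lker F == 0%VS by rewrite (weighted_inj cf iX wF F0).
have lF := weighted_surj iY wF F0.
have FK v : (F ((F^-1)%VF v) = v) by rewrite limg_lfunVK // lF memvf.
have hG : is_hom ((F^-1)%VF \o F')%VF.
  move=> a v; apply: (lker0P kF); rewrite !comp_lfunE FK.
  by rewrite -[a in RHS](lshVK cf) -wF FK wF' (lshVK cf).
have [c cE] := schur_scalar iX hG; exists c; apply/lfunP => v.
have := cE v; rewrite comp_lfunE => E.
by rewrite -[LHS]FK E linearZ scale_lfunE.
Qed.

End Weights.

(** * Subcategories defined by scalars and their gradings *)

Section Scalar.
Variables (k : fieldType) (A : hopfAlgType k).
Implicit Types (X Y : rep A) (Z : A -> Prop) (c : A -> k).

(** All levels of the tower and all components of the gradings have this form, so closure properties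
    are proved once. *)
Definition scal Z c X : Prop := forall a, Z a -> forall x : X, ract a x = c a *: x.

Lemma scal_iso Z c X Y : isorep X Y -> scal Z c X -> scal Z c Y.
Proof.
move=> [f [hf [g fK gK]]] sX a Za y.
by rewrite -[y in LHS]gK -hf sX // linearZ /= gK.
Qed.

Lemma scal_full_abelian Z c : full_abelian (scal Z c).
Proof.
split=> [I X Y sY [inj [prj [hom _ _ sum1]]] a Za x|X Y K f i sX _ _ hi ki _ a Za x|X Y Q f q _ sY _ hq lq _ a Za x].
- have xE (y : X) : y = \sum_i inj i (prj i y).
    rewrite -[LHS](id_lfunE y) -sum1 sum_lfunE.
    by apply: eq_bigr => i _; rewrite comp_lfunE.
  rewrite [LHS]xE [x in RHS]xE scaler_sumr; apply: eq_bigr => i _.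
  by have [_ hp] := hom i; rewrite hp sY // linearZ.
- have /lker0P inj : lker i == 0%VS by rewrite ki.
  by apply: inj; rewrite hi sX // linearZ.
- have : x \in limg q by rewrite lq memvf.
  by case/memv_imgP => y _ ->; rewrite -hq sY // linearZ.
Qed.

Lemma scal_unit Z c : (forall a, Z a -> c a = counit a) -> scal Z c (unit_rep A).
Proof. by move=> cE a Za x; rewrite cE. Qed.

Lemma scal_tens_grouplike (g : A) (c d : k) X Y : grouplikes A g ->
  (forall x : X, ract g x = c *: x) -> (forall y : Y, ract g y = d *: y) ->
  forall t : tens_rep X Y, ract g t = (c * d) *: t.
Proof.
move=> [dg _] gX gY t; rewrite /= /tens_act dg tlift_tpure; last exact: tens_bilin_in.
have tb := @tpure_bilin k.
elim/tens_ind: t => [|s t IHs IHt|x y]; first by rewrite linear0 scaler0.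
  by rewrite linearD /= IHs IHt scalerDr.
by rewrite tmap_tpure /= gX gY (bilinZl (tb _ _)) (bilinZr (tb _ _)) scalerA.
Qed.

Lemma scal_tens_full (f g : vdual A) X Y :
  (forall a (x : X), ract a x = (f a : k) *: x) ->
  (forall a (y : Y), ract a y = (g a : k) *: y) ->
  forall a (t : tens_rep X Y), ract a t = ((f * g) a : k) *: t.
Proof.
move=> fX gY a t; rewrite /= /tens_act -evalt_comul /evalt.
have tb := @tpure_bilin k.
have E x y : tmap (ract x) (ract y) t = (f x * g y : k) *: t.
  elim/tens_ind: t => [|s t IHs IHt|u v]; first by rewrite linear0 scaler0.
    by rewrite linearD /= IHs IHt scalerDr.
  by rewrite tmap_tpure /= fX gY (bilinZl (tb _ _)) (bilinZr (tb _ _)) scalerA.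
rewrite (eq_tlift (g := fun x y => (f x * g y : k) *: t)) //.
elim/tens_ind: (comul a) => [|s s' IHs IHs'|x y]; first by rewrite !linear0 scale0r.
  by rewrite !linearD /= IHs IHs' scalerDl.
rewrite !tlift_tpure //; first exact: bilin_mulk.
split=> [b|b] l u v; rewrite linearP /=.
  by rewrite mulrDl scalerDl scalerA mulrA.
by rewrite mulrDr scalerDl scalerA mulrCA.
Qed.

Section LeftDual.
Variable T : A -> A.
Hypotheses (TK : cancel antipode T) (KT : cancel T antipode).
Variable X : rep A.

Fact T_linear : linear T.
Proof. by move=> a x y; apply: (can_inj TK); rewrite linearP /= !KT. Qed.
Fact T_anti a b : T (a * b) = T b * T a.
Proof. by apply: (can_inj TK); rewrite antipodeM !KT. Qed.
Fact T_one : T 1 = 1.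
Proof. by apply: (can_inj TK); rewrite KT antipode1. Qed.

(** The dual taken along the inverse [T] of the antipode. Its [dual_rep] is X itself up to
    isomorphism, whereas X** is twisted by S²; it supplies the object whose dual is X, as the
    duality clause of [faithful_grading] requires. *)
Definition ldual_act (a : A) (f : vdual X) : vdual X := linfun (f \o ract (T a)).
Lemma ldual_actE a f v : ldual_act a f v = f (ract (T a) v).
Proof. by rewrite lfunE. Qed.
Fact ldual_bilin : bilin ldual_act.
Proof.
split=> [f|a] c x y; apply/lfunP=> v; rewrite add_lfunE scale_lfunE !ldual_actE.
  by rewrite T_linear (ract_bilin _).1 linearP.
by rewrite add_lfunE scale_lfunE.
Qed.
Fact ldual_act1 f : ldual_act 1 f = f.
Proof. by apply/lfunP=> v; rewrite ldual_actE T_one ract1. Qed.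
Fact ldual_actM a b f : ldual_act (a * b) f = ldual_act a (ldual_act b f).
Proof. by apply/lfunP=> v; rewrite !ldual_actE T_anti ractM. Qed.
Definition ldual_rep : rep A := Rep ldual_bilin ldual_act1 ldual_actM.

Definition bidual (x : X) : vdual (vdual X) := linfun (fun f : vdual X => f x : k^o).
Lemma bidualE x f : bidual x f = f x.
Proof. by rewrite linfunE // => a g h; rewrite add_lfunE scale_lfunE. Qed.

Lemma ldual_iso : isorep X (dual_rep ldual_rep).
Proof.
have bl : linear bidual.
  by move=> a x y; apply/lfunP => f; rewrite add_lfunE scale_lfunE !bidualE linearP.
pose F : 'Hom(X, dual_rep ldual_rep) := linfun (bidual : X -> dual_rep ldual_rep).
have FE x : F x = bidual x by rewrite linfunE.
have kF : lker F = 0%VS.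
  apply/eqP/lker0P => x y; rewrite !FE => xy; apply: vdual_sep => f.
  by rewrite -!bidualE xy.
apply: (isorepW (f := F)) => //.
  move=> a x; rewrite !FE; apply/lfunP => f.
  by rewrite bidualE dual_actE bidualE ldual_actE TK.
apply/eqP; rewrite eqEdim subvf limg_dim_eq ?kF ?capv0 // !dimvf.
by rewrite /= -[X in (X <= _)%N]/(_ * 1 * 1)%N !muln1.
Qed.
End LeftDual.

Lemma scal_fusion Z c : (forall X, completely_reducible X) ->
  (forall a, Z a -> c a = counit a) ->
  (forall X Y, scal Z c X -> scal Z c Y -> scal Z c (tens_rep X Y)) ->
  (forall X, scal Z c X -> scal Z c (dual_rep X)) ->
  fusion_subcategory (scal Z c).
Proof.
move=> cr cu ct cd; split=> //.
  by split; [apply: scal_full_abelian | apply: scal_unit].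
have [n [S [_ Sall]]] := finite_irreps (cr (regular_rep A)).
by exists n, S => X _; apply: Sall.
Qed.

Section Grading.
Variables (C : rep A -> Prop) (G : finGroupType) (Z : A -> Prop) (wt : G -> A -> k)
  (e : G -> A).
Definition weight X g (x : X) : Prop := forall a, Z a -> ract a x = wt g a *: x.
Hypotheses
  (scalC : forall g X, scal Z (wt g) X -> C X)
  (nonzero : forall g, exists X, scal Z (wt g) X /\ (0 < \dim {:X})%N)
  (dec : forall X, C X -> forall x : X, exists v : G -> X,
     x = \sum_g v g /\ forall g, weight g (v g))
  (eP : forall X, C X -> forall g h (x : X), weight h x -> ract (e g) x = (g == h)%:R *: x)
  (stab : forall X, C X -> forall g a (x : X), weight g x -> weight g (ract a x))
  (tensP : forall g h X Y, scal Z (wt g) X -> scal Z (wt h) Y ->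
     scal Z (wt (g * h)%g) (tens_rep X Y))
  (dualP : forall g X, scal Z (wt g) X -> scal Z (wt g^-1%g) (dual_rep X))
  (ldualP : forall g X, scal Z (wt g) X -> forall b, Z (antipode b) ->
     forall x : X, ract b x = wt g^-1%g (antipode b) *: x)
  (antipode_bij : bijective (@antipode k A)).

Lemma scal_weight X g (x : X) : scal Z (wt g) X -> weight g x.
Proof. by move=> sX a Za; apply: sX. Qed.

Lemma ract_e X : C X -> forall x : X, exists v : G -> X,
  [/\ x = \sum_g v g, forall g, weight g (v g) & forall g, ract (e g) x = v g].
Proof.
move=> CX x; have [v [xE vP]] := dec CX x; exists v; split=> // g.
rewrite xE linear_sum (bigD1 g) //= (eP CX g (vP g)) eqxx scale1r big1 ?addr0 // => h hg.
by rewrite (eP CX g (vP h)) eq_sym (negPf hg) scale0r.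
Qed.

Lemma ract_eC X : C X -> forall g a (x : X), ract (e g) (ract a x) = ract a (ract (e g) x).
Proof.
move=> CX g a x; have [v [xE vP ->]] := ract_e CX x.
rewrite xE !linear_sum (bigD1 g) //= (eP CX g (stab CX a (vP g))) eqxx scale1r.
rewrite big1 ?addr0 // => h hg.
by rewrite (eP CX g (stab CX a (vP h))) eq_sym (negPf hg) scale0r.
Qed.

Lemma grading_decomposition X : C X -> exists Y : G -> rep A,
  (forall g, scal Z (wt g) (Y g)) /\ is_dsum X Y.
Proof.
move=> CX.
have wE g x : x \in limg (rho X (e g)) -> weight g x.
  by case/memv_imgP => y _ ->; rewrite rhoE; have [v [_ vP ->]] := ract_e CX y; apply: vP.
have fE g x : x \in limg (rho X (e g)) -> ract (e g) x = x.
  by move=> xg; rewrite (eP CX g (wE _ _ xg)) eqxx scale1r.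
have st g : stable (limg (rho X (e g))).
  move=> a x xg; have := stab CX a (wE _ _ xg); rewrite -(fE _ _ xg) -ract_eC // => _.
  by rewrite -rhoE memv_img ?memvf.
have eg g x : ract (e g) x \in limg (rho X (e g)) by rewrite -rhoE memv_img ?memvf.
exists (fun g => subrep (st g)); split=> [g a Za x|].
  by apply: val_inj; rewrite [val _]vsval_sub_act // (wE g) ?subvsP // [in RHS]linearZ.
exists (fun g => sub_inj (st g)), (fun g => (sub_prj (st g) \o rho X (e g))%VF).
split=> [g|g|g h gh|].
- split; first exact: sub_inj_hom.
  move=> a x; rewrite !comp_lfunE !rhoE !sub_prjE; apply: val_inj.
  by rewrite [RHS]vsval_sub_act //= !vsprojK // ract_eC.
- apply/lfunP => x; rewrite !comp_lfunE id_lfunE rhoE sub_injE sub_prjE fE ?subvsP //.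
  exact: vsvalK.
- apply/lfunP => x; rewrite !comp_lfunE zero_lfunE rhoE sub_injE sub_prjE.
  by rewrite (eP CX h (wE g _ (subvsP x))) eq_sym (negPf gh) scale0r linear0.
- apply/lfunP => x; rewrite sum_lfunE id_lfunE.
  have [v [xE _ vE]] := ract_e CX x; rewrite [RHS]xE; apply: eq_bigr => g _.
  by rewrite !comp_lfunE rhoE sub_injE sub_prjE vsprojK ?eg // vE.
Qed.

(** [e g] acts on every object of C as the projection onto the part of weight g. Being an element of
    A, it commutes with all morphisms, which therefore vanish between different components. [ldualP]
    serves the direction of the duality clause in which Y is given and its preimage is the dual
    along the inverse antipode. *)
Lemma scal_grading : faithful_grading C (fun g => scal Z (wt g)).
Proof.
split=> // [g||g h X Y f gh sX sY hf|g Y].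
- by split; [apply: scal_full_abelian | apply: scalC | apply: nonzero].
- exact: grading_decomposition.
- apply/lfunP => x; rewrite zero_lfunE.
  rewrite -[x]scale1r -[1](congr1 (fun b : bool => b%:R) (eqxx g)).
  rewrite -(eP (scalC sX) g (scal_weight x sX)) hf.
  by rewrite (eP (scalC sY) g (scal_weight (f x) sY)) (negPf gh) scale0r.
split=> [sY|[X [sX iso]]]; last first.
  exact: (scal_iso (isorep_sym iso) (dualP sX)).
have [T TK KT] := antipode_bij; exists (ldual_rep TK KT Y); split; last exact: ldual_iso.
move=> a Za f; apply/lfunP => y; rewrite scale_lfunE ldual_actE.
have ZT : Z (antipode (T a)) by rewrite KT.
by rewrite (ldualP sY ZT) KT invgK linearZ.
Qed.

End Grading.
End Scalar.

(** The indices ['I_n] only bound the number of elements of P. It is applied to linear characters,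
    indexed by the irreducible modules that they define. *)
Lemma fin_group_pred (A : nzRingType) (P : A -> Prop) (n : nat) (rel : A -> 'I_n -> Prop) :
  (forall a, P a -> exists i, rel a i) ->
  (forall a b i, P a -> P b -> rel a i -> rel b i -> a = b) ->
  P 1 -> (forall a b, P a -> P b -> P (a * b)) ->
  (forall a, P a -> exists2 b, P b & b * a = 1) ->
  exists (G : finGroupType) (r : G -> A),
  [/\ injective r, r 1%g = 1, forall g h, r (g * h)%g = r g * r h,
      forall g, P (r g) & forall a, P a -> exists g, r g = a].
Proof.
move=> ex inj P1 PM PV; have [i1 _] := ex 1 P1.
have /choice[idx idxP] : forall a, exists i, P a -> rel a i.
  move=> a; have [Pa|nPa] := pselect (P a); last by exists i1.
  by have [i ai] := ex a Pa; exists i.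
pose Q i := `[< exists2 a, P a & idx a = i >].
have /choice[e eP] : forall t : {i : 'I_n | Q i}, exists a, P a /\ idx a = val t.
  by move=> [i Qi]; have /asboolP[a Pa ai] := Qi; exists a.
have onto a : P a -> exists t, e t = a.
  move=> Pa; have Qa : Q (idx a) by apply/asboolP; exists a.
  exists (exist _ (idx a) Qa); have [Pe /= ie] := eP (exist _ (idx a) Qa).
  by apply: (inj _ _ (idx a)) => //; [have := idxP _ Pe; rewrite ie | apply: idxP].
have e_inj : injective e.
  by move=> s t st; apply: val_inj; rewrite -(eP s).2 -(eP t).2 st.
have [|s t|s|G [r [r_inj r1 rM [re er] _]]] := fin_group e_inj.
- exact: onto.
- by apply: onto; apply: PM; [have [] := eP s | have [] := eP t].
- have [b Pb bE] := PV _ (eP s).1; have [t tE] := onto b Pb.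
  by exists t; rewrite tE.
exists G, r; split=> // [g|a Pa]; first by have [t ->] := er g; have [] := eP t.
by have [t <-] := onto a Pa; have [g gE] := re t; exists g.
Qed.

(** * The tower of graded subcategories *)

Section Tower.
Variables (k : closedFieldType) (p : nat) (A : hopfAlgType k) (ch : A) (z : k).
Hypotheses (pp : prime p) (p0 : (p%:R : k) != 0) (zP : p.-primitive_root z).
Hypothesis cr : forall X : rep A, completely_reducible X.
Hypothesis S_inj : injective (@antipode k A).
Hypotheses (gch : grouplikes A ch) (chC : forall a, ch * a = a * ch)
  (chp : ch ^+ p = 1).
Hypothesis eig : forall c, c ^+ p = 1 -> \sum_(i < p) (c^-1 ^+ i) *: ch ^+ i != 0.
Hypothesis comm1 : forall X : rep A, (forall x : X, ract ch x = x) ->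
  forall a b (x : X), ract (a * b) x = ract (b * a) x.
Local Notation D := (vdual A).
Local Notation S := (@antipode k A).
Implicit Types X Y : rep A.

(** The three levels of the tower as instances of [scal]: the condition set of [C2] is empty, so it
    is all of Rep A, while [C0] lets all of A act by the counit, which gives Vec. *)
Definition isch (a : A) : Prop := a = ch.
Definition C0 X : Prop := scal setT (fun a => counit a : k) X.
Definition C1 X : Prop := scal isch (fun=> 1) X.
Definition C2 X : Prop := scal set0 (fun=> 1) X.

Lemma S_bij : bijective S.
Proof.
have /choice[T TE] := linear_inj_surj S_inj.
by exists T => x //; apply: S_inj; rewrite TE.
Qed.

Lemma dual_scal X (a : A) (c : k) (f : vdual X) :
  (forall x : X, ract (S a) x = c *: x) -> ract a (f : dual_rep X) = c *: f.
Proof.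
by move=> aX; apply/lfunP => x; rewrite dual_actE scale_lfunE aX linearZ.
Qed.

Lemma ract_inv X (a b : A) (c : k) : a * b = 1 -> c != 0 ->
  (forall x : X, ract b x = c *: x) -> forall x : X, ract a x = c^-1 *: x.
Proof.
move=> ab c0 bX x; rewrite -[x in LHS](ract1 (r := X)) -[in LHS](mulr1 1).
rewrite mulr1 ract1 -[x in LHS]scale1r -(mulVf c0) -scalerA -bX linearZ /=.
by rewrite -ractM ab ract1.
Qed.

Lemma C0_fusion : fusion_subcategory C0.
Proof.
apply: scal_fusion => // [X Y sX sY a _ t|X sX a _ f].
  rewrite (@scal_tens_full k A 1 1) ?mulr1 ?dual1E // => b x; rewrite dual1E.
    exact: sX.
  exact: sY.
apply: dual_scal => x; rewrite sX //.
by rewrite -[counit (S a)]dual1E -dantiE; have := algchar_antir (algchar1 A);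
  rewrite mul1r => ->; rewrite dual1E.
Qed.

Lemma C1_fusion : fusion_subcategory C1.
Proof.
apply: scal_fusion => // [a ->|X Y sX sY a -> t|X sX a -> f].
- by rewrite gch.2.
- by rewrite (scal_tens_grouplike gch (c := 1) (d := 1)) ?mulr1 // => x; [apply: sX | apply: sY].
- apply: dual_scal => x; rewrite (ract_inv (grouplike_antil gch) (oner_neq0 k)) ?invr1 //.
  by move=> y; apply: sX.
Qed.

Lemma C2_fusion : fusion_subcategory C2.
Proof. by apply: scal_fusion => // [X Y _ _ a []|X _ a []]. Qed.

Lemma ract_ch_pow X (x : X) c i : ract ch x = c *: x -> ract (ch ^+ i) x = c ^+ i *: x.
Proof.
move=> cx; elim: i => [|i IHi]; first by rewrite !expr0 ract1 scale1r.
by rewrite !exprSr ractM cx linearZ /= IHi scalerA mulrC.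
Qed.

(** For c^p = 1, p times the idempotent projecting onto the c-eigenspace of [ch]. *)
Definition ech (c : k) : A := \sum_(i < p) (c^-1 ^+ i) *: ch ^+ i.

Lemma ch_ech c : c ^+ p = 1 -> ch * ech c = c *: ech c.
Proof.
move=> cp; have c0 := unity_root_neq0 (prime_gt0 pp) cp; rewrite /ech mulr_sumr scaler_sumr.
apply/eqP; rewrite -subr_eq0 -sumrB.
(* The difference telescopes, and its boundary terms cancel because ch^p = 1 = c^p. *)
pose F i : A := (c^-1 ^+ i * c) *: ch ^+ i.
rewrite (eq_bigr (fun i : 'I_p => F i.+1 - F i)) => [|i _]; last first.
  by rewrite /F -scalerAr -exprS scalerA [c * _]mulrC [c^-1 ^+ i.+1]exprSr mulfVK.
have -> : \sum_(i < p) (F i.+1 - F i) = \sum_(0 <= i < p) (F i.+1 - F i).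
  by rewrite big_mkord.
by rewrite telescope_sumr // /F chp !expr0 exprVn cp invr1 mul1r subrr.
Qed.

(** The grading is by the eigenvalue of the central element [ch], so the group consists of the p-th
    roots of unity. *)
Lemma C2_grading : exists (G : finGroupType) (D : G -> rep A -> Prop),
  faithful_grading C2 D /\ forall X, D 1%g X <-> C1 X.
Proof.
have z_inj : injective (fun i : 'I_p => z ^+ i).
  by move=> i j /eqP; rewrite (eq_prim_root_expr zP) !modn_small ?ltn_ord // => /eqP/val_inj.
have zX (i : nat) : (z ^+ i) ^+ p = 1 by rewrite exprAC (prim_expr_order zP) expr1n.
have zmod i : exists j : 'I_p, z ^+ j = z ^+ i.
  by exists (Ordinal (ltn_pmod i (prime_gt0 pp))); rewrite /= (prim_expr_mod zP).
have [|i j|i|G [r [r_inj r1 rM [re er] cG]]] := fin_group z_inj.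
- by have [j jE] := zmod 0%N; exists j; rewrite jE.
- by have [l lE] := zmod (i + j)%N; exists l; rewrite lE exprD.
- have [j jE] := zmod (p - i)%N; exists j.
  by rewrite jE -exprD subnK ?(prim_expr_order zP) // ltnW.
have rp g : r g ^+ p = 1 by have [i ->] := er g.
have rV g : r g^-1%g = (r g)^-1.
  apply: (mulIf (unity_root_neq0 (prime_gt0 pp) (rp g))); rewrite -rM mulVg r1 mulVf //.
  exact: unity_root_neq0 (prime_gt0 pp) (rp g).
exists G, (fun g => scal isch (fun=> r g)); split; last by move=> X; rewrite r1.
apply: (@scal_grading _ _ _ _ _ _ (fun g => p%:R^-1 *: ech (r g))) => //.
- by move=> g X _ a [].
(* The component is non-zero: the r g-eigenspace of multiplication by [ch] contains [ech (r g)],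
   which is non-zero by [eig]. *)
- move=> g; pose U : {vspace regular_rep A} := lker (rho (regular_rep A) ch - r g *: \1%VF).
  have UP x : (x \in U) = (ch * x == r g *: x :> A).
    by rewrite memv_ker add_lfunE opp_lfunE scale_lfunE id_lfunE rhoE subr_eq0.
  have sU : stable U.
    move=> a x; rewrite !UP /= => /eqP xU.
    by rewrite mulrA chC -mulrA xU scalerAr.
  exists (subrep sU); split.
    move=> a -> x; apply: val_inj; rewrite [val _]vsval_sub_act // [in RHS]linearZ /=.
    by apply/eqP; rewrite -UP subvsP.
  rewrite dim_subrep lt0n dimv_eq0; apply: contraNneq (eig (rp g)) => U0.
  by rewrite -memv0 -U0 UP -/(ech (r g)) ch_ech.
- move=> X _ x; exists (fun g => ract (p%:R^-1 *: ech (r g)) x); split.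
    rewrite -(bilin_suml (ract_bilin X)) -scaler_sumr.
    have -> : \sum_g ech (r g) = p%:R *: (1 : A).
      rewrite /ech exchange_big (bigD1 (Ordinal (prime_gt0 pp))) //=.
      rewrite -scaler_suml (eq_bigr (fun=> 1)) // sumr_const cG card_ord.
      rewrite big1 ?addr0 // => i i0; rewrite -scaler_suml.
      (* Here r h = z. Translating the sum by h multiplies it by z^-i, which differs from 1, so the
         sum vanishes. *)
      have [h hz] := re (Ordinal (prime_gt1 pp)).
      have zi : (r h)^-1 ^+ i != 1.
        rewrite hz expr1 exprVn invr_eq1 -(expr0 z) (eq_prim_root_expr zP).
        by rewrite mod0n modn_small.
      suff -> : \sum_g (r g)^-1 ^+ i = 0 by rewrite scale0r.
      have E : \sum_g (r g)^-1 ^+ i = (r h)^-1 ^+ i * \sum_g (r g)^-1 ^+ i.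
        rewrite {1}(reindex_inj (mulgI h)) mulr_sumr; apply: eq_bigr => g _ /=.
        by rewrite rM invfM exprMn.
      move/eqP: E; rewrite -subr_eq0 -{1}[\sum_g _]mul1r -mulrBl mulf_eq0.
      by rewrite subr_eq0 eq_sym (negPf zi) => /eqP.
    by rewrite scalerA mulVf // scale1r ract1.
  move=> g a ->; rewrite -ractM -scalerAr ch_ech // scalerA mulrC -scalerA.
  exact: (bilinZl (ract_bilin X)).
- move=> X _ g h x wx; have cx : ract ch x = r h *: x by apply: wx.
  rewrite (bilinZl (ract_bilin X)) /ech (bilin_suml (ract_bilin X)).
  rewrite (eq_bigr (fun i : 'I_p => ((r g)^-1 * r h) ^+ i *: x)); last first.
    by move=> i _; rewrite (bilinZl (ract_bilin X)) (ract_ch_pow i cx) scalerA exprMn.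
  rewrite -scaler_suml sum_unity_root; last by rewrite exprMn exprVn !rp invr1 mulr1.
  rewrite scalerA mulrCA mulVf // mulr1; congr (_%:R *: _).
  by rewrite (eq_unity_ratio _ (unity_root_neq0 (prime_gt0 pp) (rp g))) (inj_eq r_inj).
- by move=> X _ g a x wx b ->; rewrite -ractM chC ractM (wx ch) // linearZ.
- move=> g h X Y sX sY a -> t; rewrite rM.
  by apply: (scal_tens_grouplike gch) => x; [apply: sX | apply: sY].
- move=> g X sX a -> f; rewrite rV; apply: dual_scal.
  apply: (ract_inv (grouplike_antil gch)); first exact: unity_root_neq0 (prime_gt0 pp) (rp g).
  by move=> x; apply: sX.
- move=> g X sX b Sb x; rewrite rV; apply: (ract_inv (b := ch)); last 2 first.
  + exact: unity_root_neq0 (prime_gt0 pp) (rp g).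
  + by move=> y; apply: sX.
  by apply: S_inj; rewrite antipodeM Sb antipode1 grouplike_antil.
- exact: S_bij.
Qed.

Definition Gam (f : D) : Prop := algchar f /\ f ch = 1.

(** A acts commutatively where [ch] is trivial, so the simple objects of [C1] are linear characters.
    The group is formed by these characters, finite in number because distinct ones give
    non-isomorphic irreducibles. *)
Lemma C1_grading : exists (G : finGroupType) (D : G -> rep A -> Prop),
  faithful_grading C1 D /\ forall X, D 1%g X <-> C0 X.
Proof.
have [n [S' [iS allS]]] := finite_irreps (@cr (regular_rep A)).
pose rel (f : D) i := exists cf : algchar f, isorep (char_rep cf.1 cf.2) (S' i).
have d1 (f : D) (cf : algchar f) : \dim {:char_rep cf.1 cf.2} = 1%N by rewrite dimvf.
have irr (f : D) (cf : algchar f) : irrep (char_rep cf.1 cf.2).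
  split; first by rewrite d1.
  move=> U sU; have := dimvS (subvf U); rewrite d1 leq_eqVlt ltnS leqn0 dimv_eq0.
  by case/orP=> [dU|/eqP]; [right; apply/eqP; rewrite eqEdim subvf d1 (eqP dU) | left].
have [|f g i _ _ [cf fi] [cg gi]||f g [cf f1] [cg gg1]|f [cf f1]|G [r [r_inj r1 rM rG Gr]]] :=
    @fin_group_pred D Gam n rel.
- move=> f [cf _]; have [i fi] := allS _ (irr f cf); by exists i, cf.
- apply/lfunP => a; have [F [hF bF]] := isorep_trans fi (isorep_sym gi).
  have := hF a (1 : k^o); rewrite /= /char_act linearZ /= => /eqP.
  rewrite -subr_eq0 -scalerBl scaler_eq0 subr_eq0 => /orP[/eqP //|/eqP F1].
  have [F' FK _] := bF; have /eqP : (1 : k^o) = 0.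
    by apply: (can_inj FK); rewrite F1 linear0.
  by rewrite oner_eq0.
- by split; [apply: algchar1 | rewrite dual1E gch.2].
- split; first exact: algcharM.
  by rewrite -lshE lsh_grouplike // f1 scale1r.
- exists (antipode f); last exact: algchar_antil.
  split; first exact: algchar_anti.
  have := congr1 (fun l : D => l ch) (algchar_antir cf).
  by rewrite -lshE lsh_grouplike // f1 scale1r dual1E gch.2.
exists G, (fun g => scal setT (fun a => r g a : k)); split; last first.
  by move=> X; split=> sX a aT x; rewrite sX // r1 dual1E.
have rc g : algchar (r g) by case: (rG g).
have rV g : r g^-1%g = antipode (r g).
  by rewrite -[LHS]mulr1 -(algchar_antir (rc g)) mulrA -rM mulVg r1 mul1r.
(* Interpolation: for each h != g take an element with value 1 under r g and 0 under r h, and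
   multiply over all such h. *)
have ex_e g : exists e : A, forall h, r h e = (g == h)%:R.
  have /choice[b bP] : forall h, exists b, g != h -> r g b = 1 /\ r h b = 0.
    move=> h; have [->|gh] := eqVneq g h; first by exists 0.
    have [a ra] : exists a, r g a != r h a.
      apply: contrapT => na; case/eqP: gh; apply: r_inj; apply/lfunP => a.
      by apply/eqP/negP => /negP ra; apply: na; exists a.
    exists ((r g a - r h a)^-1 *: (a + (- r h a) *: 1)) => _.
    rewrite !linearZ !linearD !linearZ /= !(rc _).1 -![_ *: 1]/(_ * 1) !mulr1 subrr.
    by split; [apply: mulVf; rewrite subr_eq0 | apply: mulr0].
  exists (\prod_(h <- [seq h <- enum G | g != h]) b h) => h.
  have rprod (s : seq G) l : r l (\prod_(h <- s) b h) = \prod_(h <- s) (r l (b h) : k).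
    elim: s => [|i s IHs]; first by rewrite !big_nil (rc _).1.
    by rewrite !big_cons (rc _).2 IHs.
  rewrite rprod; case: eqVneq => [<-|gh].
    by rewrite big_seq big1 // => i; rewrite mem_filter => /andP[/bP[]].
  apply/eqP; rewrite prodf_seq_eq0; apply/hasP; exists h.
    by rewrite mem_filter gh mem_enum.
  by have [_ ->] := bP h gh; rewrite eqxx.
have /choice[e eP] := ex_e.
apply: (@scal_grading _ _ _ _ _ _ e) => //.
- by move=> g X sX a -> x; rewrite sX //; have [_ ->] := rG g.
- move=> g; exists (char_rep (rc g).1 (rc g).2); split=> //.
  by rewrite d1.
- move=> X CX; have [s [ss _ sE _]] := simple_decomposition (@cr X).
  move=> x; have : x \in (\sum_(U <- s) U)%VS by rewrite sE memvf.
  move: x; apply: memv_sum_seq => [|x y [v [xE vP]] [v' [yE vP']]|U x Us xU].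
  + exists (fun=> 0); split; first by rewrite big1.
    by move=> g a _; rewrite linear0 scaler0.
  + exists (fun g => v g + v' g); split; first by rewrite big_split xE yE.
    by move=> g a Za; rewrite linearD /= vP // vP' // scalerDr.
  have sU := ss _ Us; have [stU _ _] := sU; have iU := simple_sub_irrep stU sU.
  have CU : forall u : subrep stU, ract ch u = u.
    move=> u; apply: val_inj; rewrite [val _]vsval_sub_act //.
    by rewrite CX // scale1r.
  have dU := commuting_irrep iU (comm1 CU).
  have [||f [fE f1 fM]] := @scalar_char k A (subrep stU); first by rewrite dU.
    exact: dim1_scalar.
  have fch : f ch = 1.
    have [u u0] : exists u : subrep stU, u != 0.
      by have := iU.1; rewrite lt0n dimv_eq0 -vpick0 => u0; exists (vpick {:subrep stU}).
    have := fE ch u; rewrite CU => /eqP; rewrite -subr_eq0 -{1}[u]scale1r -scalerBl.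
    by rewrite scaler_eq0 (negPf u0) orbF subr_eq0 => /eqP.
  have [g gE] := Gr f (conj (conj f1 fM) fch).
  exists (fun h => if h == g then x else 0); split.
    by rewrite -big_mkcond big_pred1_eq.
  move=> h a _; case: eqVneq => [->|_]; last by rewrite linear0 scaler0.
  rewrite gE; have := congr1 vsval (fE a (vsproj U x)).
  by rewrite vsval_sub_act // linearZ /= vsprojK.
- by move=> X _ g h x wx; rewrite wx // eP.
- by move=> X _ g a x wx b _; rewrite wx // linearZ /= wx // !scalerA mulrC.
- move=> g h X Y sX sY a _ t; rewrite rM.
  by apply: scal_tens_full => b x; [apply: sX | apply: sY].
- by move=> g X sX a _ f; apply: dual_scal => x; rewrite sX // rV dantiE.
- by move=> g X sX b _ x; rewrite sX //; congr (_ *: _); rewrite -[g in LHS]invgK (rV g^-1%g) dantiE.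
- exact: S_bij.
Qed.
Lemma nilpotent_tower : nilpotent_hopf A.
Proof.
exists 2%N, (fun i => if i is i'.+1 then if i' is _.+1 then C2 else C1 else C0).
split.
- by case=> [|[|[|//]]] _; [exact: C0_fusion | exact: C1_fusion | exact: C2_fusion].
- move=> X; split=> [sX|[V iso] a _ x]; last first.
    by apply: (scal_iso (Z := setT) (c := fun a => counit a : k) (isorep_sym iso)).
  exists X; exists (\1%VF : 'Hom(X, triv_rep A X)); split.
    by move=> a x; rewrite !id_lfunE sX.
  by exists id => x; rewrite id_lfunE.
- by move=> X a [].
- by case=> [|[|//]] _; [exact: C1_grading | exact: C2_grading].
Qed.

End Tower.

(** * Irreducible degrees 1 and p *)

Section PrimeDegrees.
Variables (k : closedFieldType) (p : nat) (H : hopfAlgType k) (L : H)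
  (R : tens H H) (G : finGroupType) (r : G -> vdual H) (X0 : rep H).
Local Notation D := (vdual H).
Local Notation S := (@antipode k H).
Hypotheses (char0 : [pchar k] =i pred0) (pp : prime p).
Hypotheses (LP : forall a, a * L = (counit a : k) *: L) (L1 : counit L = 1).
Hypothesis RP : is_Rmatrix R.
Hypotheses (r_inj : injective r) (r1 : r 1%g = 1)
  (rM : forall g h, r (g * h)%g = r g * r h)
  (r_char : forall g, algchar (r g))
  (r_surj : forall f : D, algchar f -> exists g, r g = f) (cardG : #|G| = p).
Hypotheses (iX0 : irrep X0) (dX0 : \dim {:X0} = p).
Hypothesis degp : forall X : rep H, irrep X -> \dim {:X} = 1%N \/ \dim {:X} = p.
Implicit Types (f : D) (h : H) (X Y : rep H) (g : G).
Let w := drinfeld R.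

Lemma line_weight X (U : {vspace X}) : simple_sub U -> \dim U = 1%N ->
  exists g, forall h x, x \in U -> ract h x = (r g h : k) *: x.
Proof.
move=> sU dU; have [stU _ _] := sU.
have d1 : \dim {:subrep stU} = 1%N by rewrite dim_subrep.
have [||f [fE f1 fM]] := @scalar_char k H (subrep stU); first by rewrite d1.
  exact: dim1_scalar.
have [g gE] := r_surj (conj f1 fM); exists g => h x xU; rewrite gE.
have := congr1 vsval (fE h (vsproj U x)).
by rewrite vsval_sub_act // linearZ /= vsprojK.
Qed.

Lemma rep_weight X : \dim {:X} = 1%N ->
  exists g, forall h (x : X), ract h x = (r g h : k) *: x.
Proof.
move=> d1.
have [||f [fE f1 fM]] := @scalar_char k H X; first by rewrite d1.
  exact: dim1_scalar.
by have [g gE] := r_surj (conj f1 fM); exists g => h x; rewrite gE.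
Qed.

(** The vector L x spans a stable subspace, which cannot be a line inside a simple submodule of
    dimension p > 1. *)
Lemma integral_simple_eq0 X (x : X) (U : {vspace X}) : simple_sub U -> x \in U -> \dim U = p ->
  ract L x = 0.
Proof.
move=> [sU U0 Um] xU dU; apply/eqP/negPn/negP => Lx.
have sl : stable <[ract L x]>%VS.
  move=> a y /vlineP[c ->]; rewrite linearZ /= -ractM LP (bilinZl (ract_bilin X)).
  by rewrite !memvZ ?memv_line.
have [|/eqP|lU] := Um _ sl; first by rewrite -memvE sU.
  by rewrite -dimv_eq0 dim_vline Lx.
by move: dU; rewrite -lU dim_vline Lx => p1; move: pp; rewrite -p1.
Qed.

Lemma end_decomposition X : irrep X -> \dim {:X} = p ->
  (forall g, exists2 T : 'End(X), T != 0 & weighted (r g) T) /\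
  exists2 U : {vspace hom_rep X X}, simple_sub U & \dim U = p.
Proof.
move=> iX dX; pose M := hom_rep X X.
have dM : \dim {:M} = (p * p)%N.
  by rewrite dimvf -[RHS]/(muln _ _) -{1 2}dX !dimvf.
have [s [ss us sE ds]] := simple_decomposition (@maschke _ _ _ LP L1 M).
have dimU U : U \in s -> \dim U = 1%N \/ \dim U = p.
  move=> Us; have sU := ss _ Us; have [stU _ _] := sU.
  by rewrite -(dim_subrep stU); apply: degp; apply: simple_sub_irrep.
pose s1 := [seq U <- s | \dim U == 1%N].
have p1 : p != 1%N by apply: contraTneq pp => ->.
have /choice[ga gaE] : forall U : {vspace M}, exists g : G, U \in s1 ->
    forall h x, x \in U -> ract h x = (r g h : k) *: x.
  move=> U.
  have [Us|/negP nU] := boolP (U \in s1); last by exists 1%g.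
  move: Us; rewrite mem_filter => /andP[/eqP dU Us].
  by have [g gP] := line_weight (ss _ Us) dU; exists g.
(* Two lines of the same weight coincide by [weighted_unique]; so there are at most |G| = p
   lines. *)
have ga_inj : {in s1 &, injective ga}.
  move=> U V Us Vs gUV; have dU1 W : W \in s1 -> \dim W = 1%N.
    by rewrite mem_filter => /andP[/eqP].
  have [F FU F0] : exists2 F : M, F \in U & F != 0.
    exists (vpick U); first exact: memv_pick.
    by rewrite vpick0 -dimv_eq0 dU1.
  have wW W F' : W \in s1 -> F' \in W -> weighted (r (ga W)) (F' : 'Hom(X, X)).
    by move=> Ws FW; apply/weightedP => h; apply: gaE.
  apply/esym/eqP; rewrite eqEdim !dU1 // leqnn andbT; apply/subvP => F' F'V.
  have [|c ->] := weighted_unique (r_char (ga U)) iX iX (wW _ _ Us FU) F0 (F' := F').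
    by rewrite gUV; apply: wW.
  exact: memvZ.
have us1 : uniq [seq ga U | U <- s1] by rewrite map_inj_in_uniq ?filter_uniq.
have le1 : (size s1 <= p)%N.
  by rewrite -cardG -(size_map ga) -(card_uniqP us1) max_card.
(* The dimension count p^2 = (number of lines) + p (number of other pieces) makes the number of
   lines divisible by p. *)
have sumE : (size s1 + p * count (fun U => \dim U != 1%N) s)%N = (p * p)%N.
  rewrite -dM -ds size_filter; elim: s dimU {ss us sE ds s1 gaE ga_inj us1 le1} => [|U s IHs] dimU.
    by rewrite big_nil /= muln0.
  rewrite big_cons /= -IHs; last by move=> V Vs; apply: dimU; rewrite inE Vs orbT.
  by case: (dimU U (mem_head _ _)) => ->; rewrite ?eqxx ?p1 /=; lia.
(* Without lines L would annihilate End X, but it fixes the identity map. *)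
have gt0 : (0 < size s1)%N.
  rewrite lt0n size_eq0; apply/eqP => s10.
  have L0 : forall x : M, ract L x = 0.
    move=> x; have : x \in (\sum_(U <- s) U)%VS by rewrite sE memvf.
    move: x; apply: memv_sum_seq => [|x y x0 y0|U x Us xU].
    - by rewrite linear0.
    - by rewrite linearD -[RHS]addr0; congr (_ + _).
    apply: (integral_simple_eq0 (ss _ Us) xU); case: (dimU _ Us) => // d1.
    by have : U \in s1; [rewrite mem_filter d1 eqxx | rewrite s10].
  have := L0 (\1%VF : 'End(X)); rewrite /=.
  have -> : hom_act L (\1%VF : 'End(X)) = \1%VF.
    have /weightedP-> : weighted 1 (\1%VF : 'End(X)) by apply/weighted1/hom_id.
    by rewrite dual1E L1 scale1r.
  move=> id0; have := iX.1; rewrite lt0n dimv_eq0 -vpick0 => /eqP; apply.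
  by rewrite -[LHS]id_lfunE id0 zero_lfunE.
have sz : size s1 = p.
  apply/eqP; rewrite eqn_leq le1 dvdn_leq //.
  by have := dvdn_mulr p (dvdnn p); rewrite -sumE dvdn_addl // dvdn_mulr.
split=> [g|].
  have : g \in [seq ga U | U <- s1].
    have /subset_leqif_cards[_] : [set x in [seq ga U | U <- s1]] \subset [set: G].
      exact: finset.subsetT.
    rewrite cardsT cardG cardsE (card_uniqP us1) size_map sz eqxx => /esym/eqP/setP/(_ g).
    by rewrite !inE.
  case/mapP => U Us ->; exists (vpick U : 'End(X)).
    by rewrite vpick0 -dimv_eq0; move: Us; rewrite mem_filter => /andP[/eqP->].
  by apply/weightedP => h; apply: gaE => //; apply: memv_pick.
(* The p lines do not exhaust the dimension p^2, so a p-dimensional piece remains; [uv_scalar1]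
   depends on it. *)
have : (0 < count (fun U => \dim U != 1%N) s)%N.
  rewrite lt0n; apply/eqP => c0; move: sumE; rewrite c0 muln0 addn0 sz.
  have := prime_gt1 pp; nia.
rewrite -has_count => /hasP[U Us dU]; exists U; first exact: ss.
by case: (dimU _ Us) => // d1; rewrite d1 in dU.
Qed.

(** * The trace twisted by the Drinfeld element *)

Local Notation tr X F := (ltrace (F \o rho X w)%VF).

Lemma rhoM X a b : rho X (a * b) = (rho X a \o rho X b)%VF.
Proof. by apply/lfunP => v; rewrite comp_lfunE !rhoE ractM. Qed.
Lemma rho1 X : rho X 1 = \1%VF.
Proof. by apply/lfunP => v; rewrite id_lfunE rhoE ract1. Qed.

Lemma tr_linear X : linear (fun F : 'End(X) => tr X F : k^o).
Proof. by move=> a F1 F2; rewrite comp_lfunDl -comp_lfunZl linearP. Qed.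

(* Uses that w implements the square of the antipode. *)
Lemma tr_invariant X (F : 'End(X)) h :
  tr X (hom_act h F) = (counit h : k) * tr X F.
Proof.
have trl := @tr_linear X.
transitivity (tr X (F \o rho X (S (tlift (fun x y => S x * y) (comul h))))%VF).
  have trl2 : linear (fun z => tr X (F \o rho X (S z))%VF : k^o).
    move=> a x y; rewrite !linearP comp_lfunDr comp_lfunDl -comp_lfunZr -comp_lfunZl.
    by rewrite linearP.
  etransitivity; first exact: (tlift_of_linear trl).
  etransitivity; last exact: esym (tlift_of_linear trl2 _ _).
  apply: (@eq_tlift k H H k^o) => x y.
  rewrite -!comp_lfunA ltraceC -!comp_lfunA -!rhoM antipodeM.
  by rewrite -mulrA drinfeld_antipode2.
rewrite antipodel linearZ /= antipode1 linearZ /= rho1 -comp_lfunZr comp_lfun1r.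
by rewrite -comp_lfunZl linearZ.
Qed.

Lemma nontrivial_char g : g != 1%g -> exists h, r g h != counit h.
Proof.
move=> g1; apply: contrapT => n; case/eqP: g1; apply: r_inj; rewrite r1.
by apply/lfunP => h; rewrite dual1E; apply/eqP/negP => /negP rh; apply: n; exists h.
Qed.

Lemma tr_weighted X (F : 'End(X)) g : weighted (r g) F -> g != 1%g -> tr X F = 0.
Proof.
move=> /weightedP wF g1; have [h rh] := nontrivial_char g1.
have := tr_invariant F h; rewrite wF -comp_lfunZl linearZ => /eqP.
rewrite -subr_eq0 -[X in X - _]/(_ * _) -mulrBl mulf_eq0 subr_eq0 (negPf rh).
by move=> /eqP.
Qed.

(** The trace form is nondegenerate and w acts invertibly, so tr F != 0 for some F. Averaging F by L
    preserves this trace and turns F into a scalar. *)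
Lemma tr1_neq0 X : irrep X -> tr X \1%VF != 0.
Proof.
move=> iX; have w0 : rho X w != 0.
  apply: contraTneq iX.1 => w0; rewrite -eqn0Ngt dimv_eq0 -subv0.
  apply/subvP => x _; rewrite memv0 -[x]id_lfunE -rho1 -(drinfeld_invK RP) rhoM.
  by rewrite -/w w0 comp_lfun0r zero_lfunE.
have [F trF] := ltrace_nondeg w0.
have := tr_invariant F L; rewrite L1 mul1r => E.
have [c cE] := schur_scalar iX (average_hom LP F).
have FE : hom_act L F = c *: \1%VF.
  by apply/lfunP => x; rewrite cE scale_lfunE id_lfunE.
rewrite -E FE -comp_lfunZl linearZ /= in trF.
by apply: contraNneq trF => ->; rewrite mulr0.
Qed.

Lemma central_scalar X z : irrep X -> (forall h, z * h = h * z) ->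
  exists c, forall x : X, ract z x = c *: x.
Proof.
move=> iX cz; have hz : is_hom (rho X z).
  by move=> a v; rewrite !rhoE -!ractM cz.
by have [c cE] := schur_scalar iX hz; exists c => x; rewrite -cE rhoE.
Qed.

(** A group-like element acts on End X by conjugation, and uv acts on X by a scalar. *)
Lemma uv_trivial_end g X (F : 'End(X)) : irrep X ->
  hom_act (uR R (r g) * vR R (r g)) F = F.
Proof.
move=> iX; set u := uR R (r g); set v := vR R (r g).
have cg := r_char g; have gu := uR_grouplike RP cg; have gv := vR_grouplike RP cg.
have guv : grouplikes H (u * v) := grouplikeM gu gv.
have [c cE] := central_scalar iX (uv_central RP cg).
rewrite /hom_act guv.1 tlift_tpure; last exact: hom_bilin_in.
apply/lfunP => x; rewrite !comp_lfunE !rhoE cE -linearZ -cE -ractM.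
by rewrite grouplike_antir // ract1.
Qed.

(** An invertible T of weight r g conjugates the action of w into that of [lsh (r g) w], so the
    traces agree. By [lsh_drinfeld] the second is q c times the first, which is non-zero. *)
Lemma drinfeld_scalar g X c : irrep X -> \dim {:X} = p ->
  (forall x : X, ract (uv_inv R (r g)) x = c *: x) ->
  antipode (r g) (vR R (r g)) * c = 1.
Proof.
move=> iX dX cE; have cg := r_char g; set q := antipode (r g) _.
have [/(_ g)[T T0 wT] _] := end_decomposition iX dX.
have kT : lker T == 0%VS by rewrite (weighted_inj cg iX wT T0).
have lT := weighted_surj iX wT T0.
have TV : (T \o T^-1)%VF = \1%VF.
  by apply/lfunP => x; rewrite comp_lfunE id_lfunE limg_lfunVK // lT memvf.
have VT : (T^-1 \o T)%VF = \1%VF.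
  by apply/lfunP => x; rewrite comp_lfunE id_lfunE lker0_lfunK.
have E : ltrace (rho X w) = ltrace (rho X (lsh (r g) w)).
  have comT : (rho X w \o T)%VF = (T \o rho X (lsh (r g) w))%VF.
    by apply/lfunP => x; rewrite !comp_lfunE !rhoE wT.
  by rewrite -[LHS](congr1 _ (comp_lfun1r _)) -TV comp_lfunA comT -comp_lfunA ltraceC
     -comp_lfunA VT comp_lfun1r.
have := tr1_neq0 iX; rewrite comp_lfun1l => tr0.
have rE : rho X (lsh (r g) w) = (q * c) *: rho X w.
  apply/lfunP => x; rewrite scale_lfunE !rhoE (lsh_drinfeld RP cg) -/q.
  by rewrite (bilinZl (ract_bilin X)) ractM cE scalerA.
move: E; rewrite rE linearZ /= => /eqP; rewrite -subr_eq0 -[X in X - _]mul1r -mulrBl.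
by rewrite mulf_eq0 (negPf tr0) orbF subr_eq0 => /eqP.
Qed.

(** Apply [drinfeld_scalar] to a p-dimensional constituent U of End X0, where uv acts trivially and
    hence c = 1. It remains to use that r g and its antipode take inverse values on the group-like
    v. *)
Lemma uv_scalar1 g : r g (vR R (r g)) = 1.
Proof.
have cg := r_char g; have [_ [U sU dU]] := end_decomposition iX0 dX0.
have [stU _ _] := sU; have iU := simple_sub_irrep stU sU.
have [c cE] := central_scalar iU (uv_inv_central RP cg).
have q1 := drinfeld_scalar iU (etrans (dim_subrep stU) dU) cE.
have gv := vR_grouplike RP cg.
have c1 : c = 1.
  have U0 : vpick U != 0 by rewrite vpick0 -dimv_eq0 dU -lt0n prime_gt0.
  have := cE (vsproj U (vpick U)); move/(congr1 vsval).
  rewrite vsval_sub_act // linearZ /= vsprojK ?memv_pick //.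
  rewrite -[in LHS](uv_trivial_end g (vpick U) iX0) -hom_actM (uv_invl RP cg).
  rewrite hom_act1 => /eqP; rewrite -subr_eq0 -[X in X - _]scale1r -scalerBl.
  by rewrite scaler_eq0 (negPf U0) orbF subr_eq0 => /eqP.
have : (r g * antipode (r g)) (vR R (r g)) = 1.
  by rewrite algchar_antir // dual1E gv.2.
by rewrite -lshE lsh_grouplike // linearZ /= => E; move: q1; rewrite c1 mulr1 => E2;
  move: E; rewrite /= E2; rewrite -[LHS]/(_ * _) mulr1.
Qed.

Lemma uR_scalar1 g : r g (uR R (r g)) = 1.
Proof. by rewrite uR_vR uv_scalar1. Qed.

Lemma p_neq0 : (p%:R : k) != 0.
Proof. by have /pcharf0P-> := char0; rewrite -lt0n prime_gt0. Qed.

(** K stays a predicate on H: functionals on K are functionals on H compared only on such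
    elements. *)
Definition inK (a : H) : Prop := forall g, lsh (r g) a = a.

(** * Eigenlines of a weighted endomorphism *)

Section Eigen.
Variables (g0 : G) (z : k).
Hypotheses (g01 : g0 != 1%g) (zP : p.-primitive_root z).

Lemma g0_order : #[g0]%g = p.
Proof.
have : (#[g0]%g %| p)%N by rewrite -cardG -cardsT order_dvdG ?inE.
case/primeP: pp => _ pdiv /pdiv/orP[|/eqP //].
by rewrite order_eq1 (negPf g01).
Qed.

Lemma g0_gen g : exists2 m, (m < p)%N & g = (g0 ^+ m)%g.
Proof.
have : g \in <[g0]>%g.
  suff -> : <[g0]>%g = [set: G] by rewrite inE.
  by apply/eqP; rewrite eqEcard finset.subsetT cardsT cardG -g0_order leqnn.
by case/cyclePmin => m mp ->; exists m; rewrite // -g0_order.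
Qed.

Definition lpow X (T : 'End(X)) n : 'End(X) := iter n (fun F => T \o F)%VF \1%VF.
Lemma lpowS X (T : 'End(X)) n : lpow T n.+1 = (T \o lpow T n)%VF. Proof. by []. Qed.
Lemma lpow_weighted X (T : 'End(X)) n :
  weighted (r g0) T -> weighted (r (g0 ^+ n)%g) (lpow T n).
Proof.
move=> wT; elim: n => [|n IHn]; first by rewrite expg0 r1; apply/weighted1/hom_id.
by rewrite expgS rM; apply: weighted_comp.
Qed.
Lemma lpow_inj X (T : 'End(X)) n : lker T = 0%VS -> injective (lpow T n).
Proof.
move=> kT; elim: n => [|n IHn] x y; first by rewrite !id_lfunE.
rewrite !comp_lfunE => /(lker0P _) E; apply/IHn/E; exact/eqP.
Qed.
Lemma lpow_eigen X (T : 'End(X)) n x c : T x = c *: x -> lpow T n x = c ^+ n *: x.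
Proof.
move=> Tx; elim: n => [|n IHn]; first by rewrite id_lfunE scale1r.
by rewrite comp_lfunE IHn linearZ /= Tx scalerA exprSr.
Qed.

(** If T^p = 1 = c^p, p times the projection onto the c-eigenspace of T; the counterpart of [ech]
    for an endomorphism. *)
Definition eproj X (T : 'End(X)) (c : k) : 'End(X) :=
  \sum_(i < p) (c^-1 ^+ i) *: lpow T i.

Lemma eproj_eigen X (T : 'End(X)) c x :
  lpow T p = \1%VF -> c ^+ p = 1 -> T (eproj T c x) = c *: eproj T c x.
Proof.
move=> Tp cp; have c0 := unity_root_neq0 (prime_gt0 pp) cp.
rewrite /eproj !sum_lfunE linear_sum scaler_sumr; apply/eqP; rewrite -subr_eq0 -sumrB.
pose F i : X := (c^-1 ^+ i * c) *: lpow T i x.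
rewrite (eq_bigr (fun i : 'I_p => F i.+1 - F i)) => [|i _]; last first.
  rewrite /F !scale_lfunE linearZ /= scalerA [c * _]mulrC; congr (_ *: _ - _).
    by rewrite exprSr mulfVK ?invr_eq0.
  by rewrite comp_lfunE.
have -> : \sum_(i < p) (F i.+1 - F i) = \sum_(0 <= i < p) (F i.+1 - F i).
  by rewrite big_mkord.
rewrite telescope_sumr // /F Tp.
by rewrite expr0 exprVn cp invr1 mul1r subrr.
Qed.

Lemma eproj_on X (T : 'End(X)) c d x : c ^+ p = 1 -> d ^+ p = 1 -> T x = d *: x ->
  eproj T c x = ((c == d)%:R * p%:R) *: x.
Proof.
move=> cp dp Tx; have c0 := unity_root_neq0 (prime_gt0 pp) cp.
rewrite /eproj sum_lfunE (eq_bigr (fun i : 'I_p => (c^-1 * d) ^+ i *: x)); last first.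
  by move=> i _; rewrite scale_lfunE (lpow_eigen _ Tx) scalerA exprMn.
rewrite -scaler_suml sum_unity_root ?(eq_unity_ratio _ c0) //.
by rewrite exprMn exprVn cp dp invr1 mulr1.
Qed.

Lemma lpowZ X (T : 'End(X)) a n : lpow (a *: T) n = a ^+ n *: lpow T n.
Proof.
elim: n => [|n IHn]; first by rewrite scale1r.
by rewrite !lpowS IHn -comp_lfunZl -comp_lfunZr scalerA exprS.
Qed.

Lemma zX (j : nat) : (z ^+ j) ^+ p = 1.
Proof. by rewrite exprAC (prim_expr_order zP) expr1n. Qed.

Lemma z_inj (i j : 'I_p) : (z ^+ i == z ^+ j) = (i == j).
Proof. by rewrite (eq_prim_root_expr zP) !modn_small ?ltn_ord. Qed.

Lemma nonzero_vector X : irrep X -> exists x : X, x != 0.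
Proof. by move=> [d0 _]; exists (vpick {:X}); rewrite vpick0 -dimv_eq0 -lt0n. Qed.

(** T^p has weight r (g0^p) = 1, so it is a scalar c by Schur's lemma. Dividing T by a p-th root of
    c makes it 1. *)
Lemma unipotent_weight X : irrep X -> \dim {:X} = p ->
  exists T : 'End(X), [/\ weighted (r g0) T, T != 0 & lpow T p = \1%VF].
Proof.
move=> iX dX; have [/(_ g0)[T T0 wT] _] := end_decomposition iX dX.
have kT := weighted_inj (r_char g0) iX wT T0.
have := lpow_weighted p wT; rewrite -[X in (g0 ^+ X)%g]g0_order expg_order r1 => /weighted1 hp.
have [c cE] := schur_scalar iX hp; have [x x0] := nonzero_vector iX.
have c0 : c != 0.
  apply: contraNneq x0 => c0; apply/eqP/(@lpow_inj _ _ p kT).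
  by rewrite cE c0 scale0r linear0.
have [b bp] : exists b, b ^+ p = c.
  have /closed_rootP[b] : size ('X^p - c%:P : {poly k}) != 1%N.
    by rewrite size_XnsubC ?prime_gt0 // eqSS -lt0n prime_gt0.
  by rewrite rootE !hornerE subr_eq0 => /eqP; exists b.
have b0 : b != 0.
  by apply: contraNneq c0 => b0; rewrite -bp b0 expr0n (gtn_eqF (prime_gt0 pp)).
exists (b^-1 *: T); split.
- move=> h v; rewrite !scale_lfunE -[in RHS]wT linearZ //.
- by rewrite scaler_eq0 invr_eq0 negb_or b0.
- apply/lfunP => y; rewrite lpowZ scale_lfunE cE scalerA exprVn bp mulVf //.
  by rewrite scale1r id_lfunE.
Qed.

(** For 0 < i < p the power T^i has the non-trivial weight g0^i and trace 0, so only the term i = 0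
    contributes. *)
Lemma tr_eproj X (T : 'End(X)) c : weighted (r g0) T ->
  tr X (eproj T c) = tr X \1%VF.
Proof.
move=> wT; have trl := @tr_linear X.
have -> : tr X (eproj T c) = \sum_(i < p) c^-1 ^+ i * tr X (lpow T i).
  transitivity (linfun (fun F : 'End(X) => tr X F : k^o) (eproj T c)).
    by rewrite linfunE.
  by rewrite linear_sum; apply: eq_bigr => i _; rewrite linearZ /= linfunE.
rewrite (bigD1 (Ordinal (prime_gt0 pp))) //= mul1r big1 ?addr0 // => i i0.
rewrite (tr_weighted (lpow_weighted _ wT)) ?mulr0 // -order_dvdn g0_order.
by rewrite gtnNdvd // lt0n.
Qed.

Lemma weighted_K X (T : 'End(X)) g a x : weighted (r g) T -> inK a ->
  ract a (T x) = T (ract a x).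
Proof. by move=> wT Ka; rewrite wT Ka. Qed.

Lemma eproj_K X (T : 'End(X)) c a x : weighted (r g0) T -> inK a ->
  eproj T c (ract a x) = ract a (eproj T c x).
Proof.
move=> wT Ka; rewrite /eproj !sum_lfunE linear_sum; apply: eq_bigr => i _.
by rewrite !scale_lfunE linearZ /= (weighted_K _ (lpow_weighted i wT) Ka).
Qed.

Lemma eigenbasis X : irrep X -> \dim {:X} = p ->
  exists (T : 'End(X)) (x : p.-tuple X),
  [/\ basis_of fullv x, weighted (r g0) T, T != 0,
      forall j : 'I_p, T x`_j = z ^+ j *: x`_j &
      forall a, inK a -> forall j : 'I_p,
        ract a x`_j = coord x j (ract a x`_j) *: x`_j].
Proof.
move=> iX dX; have [T [wT T0 Tp]] := unipotent_weight iX dX.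
(* Every p-th root of unity is an eigenvalue of T, since its projector has the non-zero trace of the
   identity. *)
have ex (j : 'I_p) : exists y : X, eproj T (z ^+ j) y != 0.
  apply: contrapT => n0; have := tr1_neq0 iX; rewrite -[\1%VF]/(lpow T 0).
  have : tr X (eproj T (z ^+ j)) = 0.
    have -> : eproj T (z ^+ j) = 0; last by rewrite comp_lfun0l linear0.
    apply/lfunP => y; rewrite zero_lfunE; apply/eqP/negP => /negP y0.
    by apply: n0; exists y.
  by rewrite (tr_eproj _ wT) => ->; rewrite eqxx.
have {ex}[y yP] := choice ex.
have [x xE] : exists x : p.-tuple X, forall j : 'I_p, x`_j = eproj T (z ^+ j) (y j).
  exists [tuple eproj T (z ^+ j) (y j) | j < p] => j.
  by rewrite -tnth_nth tnth_mktuple.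
have x0 j : x`_(j : 'I_p) != 0 by rewrite xE.
have Tx (j : 'I_p) : T x`_j = z ^+ j *: x`_j by rewrite xE eproj_eigen ?zX.
have Px (i j : 'I_p) : eproj T (z ^+ i) x`_j = ((i == j)%:R * p%:R) *: x`_j.
  by rewrite (eproj_on (zX i) (zX j) (Tx j)) z_inj.
have Psum (i : 'I_p) (c : 'I_p -> k) :
    eproj T (z ^+ i) (\sum_j c j *: x`_j) = (c i * p%:R) *: x`_i.
  rewrite linear_sum (bigD1 i) //= big1 ?addr0 => [|j /negPf ji]; rewrite linearZ /= Px scalerA.
    by rewrite eqxx mul1r.
  by rewrite eq_sym ji mul0r mulr0 scale0r.
have bx : basis_of fullv x.
  rewrite basisEfree subvf size_tuple dX leqnn !andbT.
  apply/freeP => c cE i; have := Psum i c; rewrite cE linear0 => /esym/eqP.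
  by rewrite scaler_eq0 (negPf (x0 i)) orbF mulf_eq0 (negPf p_neq0) orbF => /eqP.
exists T, x; split=> // a Ka j.
have := coord_basis bx (memvf (ract a x`_j)) => E.
have := Psum j (fun i => coord x i (ract a x`_j)); rewrite -E (eproj_K _ _ wT Ka) Px eqxx.
rewrite mul1r linearZ /= mulrC -scalerA.
by move/(scalerI p_neq0).
Qed.

End Eigen.

(** * Integrals of K and maps linear over K *)

Lemma antipode_r g : antipode (r g) = r g^-1%g.
Proof.
rewrite -[LHS]mulr1 -r1 -(mulgV g) rM mulrA algchar_antil ?mul1r //.
Qed.

(** There is no factor 1/p: the counit of [lsh (r g) L] is r g L, which vanishes for g != 1. *)
Definition LK : H := \sum_g lsh (r g) L.

Lemma LK_inK : inK LK.
Proof.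
move=> h; rewrite /LK linear_sum (reindex_inj (mulIg h^-1%g)); apply: eq_bigr => g _ /=.
by rewrite lsh_comp -rM mulgKV.
Qed.

Lemma lsh_integral h g : h * lsh (r g) L = (r g^-1%g h : k) *: lsh (r g) L.
Proof.
rewrite -[h in LHS](lshVK (r_char g)) -lshM; last exact: r_char.
by rewrite LP linearZ /= antipode_r counit_lsh.
Qed.

Lemma char_integral_eq0 g : g != 1%g -> r g L = 0.
Proof.
move=> g1; have [h rh] := nontrivial_char g1.
have := (r_char g).2 h L; rewrite LP linearZ => /eqP.
rewrite eq_sym -subr_eq0 -[X in _ - X]/(_ * _) -mulrBl mulf_eq0 subr_eq0 (negPf rh).
by move/eqP.
Qed.

Lemma counit_LK : counit LK = 1.
Proof.
rewrite /LK linear_sum (bigD1 1%g) //= counit_lsh r1 dual1E L1 big1 ?addr0 // => g g1.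
by rewrite counit_lsh char_integral_eq0.
Qed.

(** The averaging projection of H onto K. Membership of a tensor in K ⊗ H is expressed as
    [tmap piK idfun t = t]. *)
Definition piK (h : H) : H := p%:R^-1 *: \sum_g lsh (r g) h.
Fact piK_linear : linear piK.
Proof.
move=> a x y; rewrite /piK scalerA mulrC -scalerA -scalerDr; congr (_ *: _).
by rewrite scaler_sumr -big_split; apply: eq_bigr => g _; rewrite linearP.
Qed.
HB.instance Definition _ := GRing.isLinear.Build k H H _ piK piK_linear.

Lemma piK_in h : inK (piK h).
Proof.
move=> g; rewrite /piK linearZ; congr (_ *: _).
rewrite linear_sum (reindex_inj (mulIg g^-1%g)); apply: eq_bigr => g' _ /=.
by rewrite lsh_comp -rM mulgKV.
Qed.

Lemma sum_const (V : lmodType k) (x : V) : p%:R^-1 *: (\sum_(g : G) x) = x.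
Proof. by rewrite sumr_const cardG -scaler_nat scalerA mulVf ?scale1r // p_neq0. Qed.

Lemma piK_id a : inK a -> piK a = a.
Proof. by move=> Ka; rewrite /piK (eq_bigr (fun=> a)) ?sum_const. Qed.

Lemma tmap_piKl (t : tens H H) : (forall g, tmap (lsh (r g)) idfun t = t) ->
  tmap piK idfun t = t.
Proof.
move=> tK; have -> : tmap piK idfun t = p%:R^-1 *: \sum_g tmap (lsh (r g)) idfun t.
  elim/tens_ind: t {tK} => [|s t IHs IHt|x y].
  - by rewrite linear0 big1 ?scaler0 // => g _; rewrite linear0.
  - rewrite linearD /= IHs IHt -scalerDr -big_split; congr (_ *: _).
    by apply: eq_bigr => g _; rewrite linearD.
  rewrite tmap_tpure (bilinZl (@tpure_bilin _ _ _)) (bilin_suml (@tpure_bilin _ _ _)).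
  by congr (_ *: _); apply: eq_bigr => g _; rewrite tmap_tpure.
by rewrite (eq_bigr (fun=> t)) ?sum_const.
Qed.

Lemma comul_Kl a : inK a -> tmap piK idfun (comul a) = comul a.
Proof. by move=> Ka; apply: tmap_piKl => g; rewrite -comul_lsh Ka. Qed.

Definition Klinear X Y (F : 'Hom(X, Y)) : Prop :=
  forall a, inK a -> forall v, ract a (F v) = F (ract a v).

(** The left legs of Delta(a) lie in K and commute with F, so a1 F S(a2) = F a1 S(a2). *)
Lemma Klinear_invariant X Y (F : 'Hom(X, Y)) a : Klinear F -> inK a ->
  hom_act a F = (counit a : k) *: F.
Proof.
move=> KF Ka; apply/lfunP => v; rewrite hom_actE scale_lfunE -(comul_Kl Ka).
transitivity (F (ract (tlift (fun x y => x * S y) (tmap piK idfun (comul a))) v)).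
  elim/tens_ind: (comul a) => [|s t IHs IHt|x y].
  - by rewrite !linear0 ract0 linear0.
  - rewrite [tmap _ _ (s + t)]linearD /=; move: IHs IHt.
    move: (tmap piK idfun s) (tmap piK idfun t) => s' t' IHs IHt.
    by rewrite [LHS]linearD /= IHs IHt -linearD -(bilinDl (ract_bilin X)) -linearD.
  rewrite tmap_tpure !tlift_tpure; last 2 first.
  - exact: (bilin_comp idfun _ (@mul_bilin k H)).
  - split=> [b|b] c s t; first by rewrite (ract_bilin Y).1.
    by rewrite !linearP (ract_bilin X).1 !linearP.
  by rewrite /= KF ?ractM //; apply: piK_in.
by rewrite comul_Kl // antipoder (bilinZl (ract_bilin X)) ract1 linearZ.
Qed.

(** The component of F of weight r g. The inverse appears because [lsh (r g) L] is an integral for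
    the character r g^-1. *)
Definition Kpart X Y (F : 'Hom(X, Y)) g : 'Hom(X, Y) := hom_act (lsh (r g^-1%g) L) F.

Lemma Kpart_weighted X Y (F : 'Hom(X, Y)) g : weighted (r g) (Kpart F g).
Proof.
apply/weightedP => h; rewrite /Kpart -hom_actM lsh_integral invgK.
exact: (bilinZl (@hom_act_bilin _ _ _ _)).
Qed.

(* LK is an integral of K and a sum of integrals of H twisted by characters. *)
Lemma Klinear_sum X Y (F : 'Hom(X, Y)) : Klinear F -> F = \sum_g Kpart F g.
Proof.
move=> KF; rewrite -[LHS]scale1r -counit_LK -(Klinear_invariant KF LK_inK).
rewrite /LK (bilin_suml (@hom_act_bilin _ _ _ _)).
by rewrite (reindex_inj invg_inj); apply: eq_bigr.
Qed.

(** Some weight component of F is non-zero. Composing it with an endomorphism of X of the inverse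
    weight gives a non-zero H-linear map. *)
Lemma Klinear_iso X Y (F : 'Hom(X, Y)) : irrep X -> \dim {:X} = p -> irrep Y ->
  Klinear F -> F != 0 -> isorep X Y.
Proof.
move=> iX dX iY KF F0; have [g Fg] : exists g, Kpart F g != 0.
  apply: contrapT => n; case/eqP: F0; rewrite (Klinear_sum KF) big1 // => g _.
  by apply/eqP/negP => /negP Fg; apply: n; exists g.
have [/(_ g^-1%g)[T T0 wT] _] := end_decomposition iX dX.
apply: (irrep_schur (f := (Kpart F g \o T)%VF)) => //.
  apply/weighted1; rewrite -r1 -(mulgV g) rM; apply: weighted_comp wT.
  exact: Kpart_weighted.
apply: contraNneq Fg => FT; apply/eqP/lfunP => y; rewrite zero_lfunE.
have : y \in limg T by rewrite (weighted_surj iX wT T0) memvf.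
by case/memv_imgP => x _ ->; rewrite -comp_lfunE FT zero_lfunE.
Qed.

(** * The characters of K *)

Section EigenKchar.
Variables (g0 : G) (z : k).
Hypotheses (g01 : g0 != 1%g) (zP : p.-primitive_root z).

(** Each weight component of F is a multiple of a power of T, by [weighted_unique] and because g0
    generates G. *)
Lemma Klinear_comm X (F T : 'End(X)) : irrep X -> \dim {:X} = p ->
  weighted (r g0) T -> T != 0 -> Klinear F -> (F \o T)%VF = (T \o F)%VF.
Proof.
move=> iX dX wT T0 KF; have kT := weighted_inj (r_char g0) iX wT T0.
have [x x0] := nonzero_vector iX.
have comm n : (lpow T n \o T)%VF = (T \o lpow T n)%VF.
  elim: n => [|n IHn]; first by rewrite comp_lfun1l comp_lfun1r.
  by rewrite !lpowS -comp_lfunA IHn.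
have part g : (Kpart F g \o T)%VF = (T \o Kpart F g)%VF.
  have [m _ gE] := g0_gen g01 g.
  have Tm0 : lpow T m != 0.
    apply: contraNneq x0 => Tm; apply/eqP/(lpow_inj kT (n := m)).
    by rewrite Tm !zero_lfunE.
  have wTm := lpow_weighted m wT; rewrite -gE in wTm.
  have [c ->] := weighted_unique (r_char g) iX iX wTm Tm0 (Kpart_weighted F g).
  by rewrite -comp_lfunZl -comp_lfunZr comm.
rewrite (Klinear_sum KF); apply/lfunP => y.
rewrite !comp_lfunE !sum_lfunE linear_sum; apply: eq_bigr => g _.
by rewrite /= -!comp_lfunE part.
Qed.

Definition eigenbasis_of X (T : 'End(X)) (x : p.-tuple X) : Prop :=
  [/\ basis_of fullv x, weighted (r g0) T, T != 0,
      forall j : 'I_p, T x`_j = z ^+ j *: x`_j &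
      forall a, inK a -> forall j : 'I_p,
        ract a x`_j = coord x j (ract a x`_j) *: x`_j].

Definition kchar X (x : p.-tuple X) (j : 'I_p) : D :=
  linfun (fun a : H => coord x j (ract a x`_j) : k^o).

Lemma kcharE X (x : p.-tuple X) (j : 'I_p) a : kchar x j a = coord x j (ract a x`_j).
Proof.
rewrite /kchar linfunE // => c b d.
by rewrite (ract_bilin X).1 linearP.
Qed.

Lemma kchar_act X T (x : p.-tuple X) : eigenbasis_of T x -> forall a, inK a ->
  forall j : 'I_p, ract a x`_j = (kchar x j a : k) *: x`_j.
Proof. by move=> [_ _ _ _ Kx] a Ka j; rewrite kcharE -Kx. Qed.

Lemma coord_act X T (x : p.-tuple X) : eigenbasis_of T x -> forall a, inK a ->
  forall (j : 'I_p) v, coord x j (ract a v) = kchar x j a * coord x j v.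
Proof.
move=> ebx a Ka j v; have [bx _ _ _ _] := ebx.
rewrite {1}(coord_basis bx (memvf v)) linear_sum.
rewrite (eq_bigr (fun i : 'I_p => (kchar x i a * coord x i v) *: x`_i)) => [|i _].
  by rewrite coord_sum_free // (basis_free bx).
by rewrite linearZ /= (kchar_act ebx) // scalerA mulrC.
Qed.

Definition matrix_unit X Y (x : p.-tuple X) (y : p.-tuple Y) (j l : 'I_p) : 'Hom(X, Y) :=
  linfun (fun v => coord x j v *: y`_l).

Lemma matrix_unitE X Y (x : p.-tuple X) (y : p.-tuple Y) (j l : 'I_p) v :
  matrix_unit x y j l v = coord x j v *: y`_l.
Proof. by rewrite linfunE // => a u u'; rewrite linearP scalerDl scalerA. Qed.

Lemma matrix_unit_K X Y T T' (x : p.-tuple X) (y : p.-tuple Y) (j l : 'I_p) :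
  eigenbasis_of T x -> eigenbasis_of T' y ->
  (forall a, inK a -> kchar x j a = kchar y l a) -> Klinear (matrix_unit x y j l).
Proof.
move=> ebx eby E a Ka v; rewrite !matrix_unitE linearZ /= (kchar_act eby) //.
by rewrite (coord_act ebx) // E // scalerA mulrC.
Qed.

Lemma basis_neq0 X (x : p.-tuple X) (j : 'I_p) : basis_of fullv x -> x`_j != 0.
Proof.
move=> bx; apply: contraTneq (oner_neq0 k) => xj0.
have := coord_free j j (basis_free bx); rewrite xj0 linear0 eqxx => E.
by rewrite negbK; apply/eqP/esym.
Qed.

Lemma matrix_unit_on X Y (x : p.-tuple X) (y : p.-tuple Y) (j l i : 'I_p) :
  basis_of fullv x -> matrix_unit x y j l x`_i = (i == j)%:R *: y`_l.
Proof. by move=> bx; rewrite matrix_unitE (coord_free _ _ (basis_free bx)). Qed.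

Lemma kchar_iso X Y T T' (x : p.-tuple X) (y : p.-tuple Y) (j l : 'I_p) :
  irrep X -> \dim {:X} = p -> irrep Y -> eigenbasis_of T x -> eigenbasis_of T' y ->
  (forall a, inK a -> kchar x j a = kchar y l a) -> isorep X Y.
Proof.
move=> iX dX iY ebx eby E; apply: (Klinear_iso iX dX iY (matrix_unit_K ebx eby E)).
have [bx _ _ _ _] := ebx; have [by_ _ _ _ _] := eby.
apply: contraNneq (basis_neq0 l by_) => F0; apply/eqP.
by have := matrix_unit_on y j l j bx; rewrite F0 zero_lfunE eqxx scale1r.
Qed.

(** If two eigenlines carry the same character, the matrix unit between them is K-linear and thus
    commutes with T, which forces z^j = z^l. *)
Lemma kchar_inj X T (x : p.-tuple X) (j l : 'I_p) :
  irrep X -> \dim {:X} = p -> eigenbasis_of T x ->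
  (forall a, inK a -> kchar x j a = kchar x l a) -> j = l.
Proof.
move=> iX dX ebx E; have [bx wT T0 Tx _] := ebx.
have := Klinear_comm iX dX wT T0 (matrix_unit_K ebx ebx E).
move/lfunP/(_ x`_j); rewrite !comp_lfunE Tx linearZ /=.
rewrite matrix_unit_on // eqxx scale1r Tx => /eqP.
rewrite -subr_eq0 -scalerBl scaler_eq0 (negPf (basis_neq0 l bx)) orbF subr_eq0.
by rewrite z_inj // => /eqP.
Qed.

(** If the character were the counit, [LK] would fix the eigenvector, so some [lsh (r g) L] would
    not kill it and would produce a stable line in the irreducible X. *)
Lemma kchar_neq1 X T (x : p.-tuple X) (j : 'I_p) :
  irrep X -> \dim {:X} = p -> eigenbasis_of T x ->
  ~ (forall a, inK a -> kchar x j a = counit a).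
Proof.
move=> iX dX ebx E; have [bx _ _ _ _] := ebx.
have := kchar_act ebx LK_inK j; rewrite E; last exact: LK_inK.
rewrite counit_LK scale1r /LK.
rewrite (bilin_suml (ract_bilin X)) => sumE.
have [g gx] : exists g, ract (lsh (r g) L) x`_j != 0.
  apply: contrapT => n; move/eqP: (basis_neq0 j bx); apply.
  rewrite -sumE big1 // => g _; apply/eqP/negP => /negP gx; apply: n; by exists g.
have st : stable <[ract (lsh (r g) L) x`_j]>%VS.
  move=> a v /vlineP[c ->]; rewrite linearZ /= -ractM lsh_integral (bilinZl (ract_bilin X)).
  by rewrite !memvZ ?memv_line.
have [/eqP|lE] := iX.2 _ st; first by rewrite -dimv_eq0 dim_vline gx.
by move: dX; rewrite -lE dim_vline gx => p1; move: pp; rewrite -p1.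
Qed.

Lemma irreps_list : exists (J : finType) (S : J -> rep H),
  [/\ forall a, irrep (S a) /\ \dim {:S a} = p,
      forall X, irrep X -> \dim {:X} = p -> exists a, isorep X (S a)
    & forall a b, isorep (S a) (S b) -> a = b].
Proof.
have [n [S [iS allS]]] := finite_irreps (@maschke _ _ _ LP L1 (regular_rep H)).
(* Repetitions are removed by keeping the least index in each isomorphism class. *)
pose P (i : 'I_n) := `[< \dim {:S i} = p /\ forall j : 'I_n, (j < i)%N -> ~ isorep (S i) (S j) >].
exists {i : 'I_n | P i}, (fun a => S (val a)); split=> [[i /asboolP[di _]] //|X iX dX|].
  have [i Xi] := allS X iX.
  have ex : exists m : nat, `[< exists2 j : 'I_n, m = nat_of_ord j & isorep X (S j) >].
    by exists i; apply/asboolP; exists i.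
  case: (ex_minnP ex) => m /asboolP[j -> Xj] mmin.
  have Pj : P j.
    apply/asboolP; split; first by rewrite -(isorep_dim Xj).
    move=> l lj jl; have : (j <= l)%N; last by rewrite leqNgt lj.
    by apply: mmin; apply/asboolP; exists l => //; apply: isorep_trans jl.
  by exists (exist _ j Pj).
move=> [i Pi] [j Pj] /= ij; apply/eqP; rewrite -val_eqE /=.
move: (Pi) (Pj) => /asboolP[_ mi] /asboolP[_ mj].
case: (ltngtP (i : nat) j) => [lij|lji|e]; last exact/eqP/val_inj; exfalso.
  by apply: (mj i lij); apply: isorep_sym.
exact: (mi j lji).
Qed.

Definition Kmul (f : D) : Prop :=
  f 1 = 1 /\ forall a b, inK a -> inK b -> f (a * b) = f a * f b.

Lemma kchar_mul X T (x : p.-tuple X) j : eigenbasis_of T x -> Kmul (kchar x j).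
Proof.
move=> ebx; have [bx _ _ _ _] := ebx; split=> [|a b Ka Kb].
  by rewrite kcharE ract1 (coord_free _ _ (basis_free bx)) eqxx.
rewrite !kcharE ractM (kchar_act ebx Kb) linearZ /= (kchar_act ebx Ka).
by rewrite !linearZ /= (coord_free _ _ (basis_free bx)) eqxx !mulr1 mulrC.
Qed.

(** [None] stands for the counit and [Some (a, j)] for the j-th eigenline of the a-th irreducible of
    dimension p; hence the cardinality 1 + mp. *)
Lemma Kchar_list : exists (m : nat) (I : finType) (n : I -> D),
  [/\ #|I| = (1 + m * p)%N, forall i, Kmul (n i),
      forall i j, (forall a, inK a -> n i a = n j a) -> i = j
    & forall a, inK a -> (forall i, n i a = 0) -> a = 0].
Proof.
have [J [S [iS allS injS]]] := irreps_list.
have eb a : exists x : p.-tuple (S a), exists T, eigenbasis_of T x.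
  have [T [x ebx]] := eigenbasis g01 zP (iS a).1 (iS a).2.
  by exists x, T.
pose x a := projT1 (cid (eb a)).
have xP a : exists T, eigenbasis_of T (x a) := projT2 (cid (eb a)).
pose n (i : option (J * 'I_p)) : D := if i is Some aj then kchar (x aj.1) aj.2 else 1.
exists #|J|, (option (J * 'I_p)), n; split.
- by rewrite card_option card_prod card_ord.
- case=> [[a j]|]; last by split=> [|a b _ _]; rewrite !dual1E ?counit1 ?counitM.
  by have [T ebx] := xP a; apply: kchar_mul ebx.
- case=> [[a j]|] [[b l]|] //= E.
  + have [T ebx] := xP a; have [T' eby] := xP b.
    have ab : a = b.
      by apply: injS; apply: (kchar_iso (iS a).1 (iS a).2 (iS b).1 ebx eby E).
    subst b; congr (Some (_, _)).
    exact: (kchar_inj (iS a).1 (iS a).2 ebx E).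
  + have [T ebx] := xP a; case: (kchar_neq1 (iS a).1 (iS a).2 ebx (j := j)).
    by move=> c Kc; rewrite E // dual1E.
  + have [T ebx] := xP b; case: (kchar_neq1 (iS b).1 (iS b).2 ebx (j := l)).
    by move=> c Kc; rewrite -E // dual1E.
- move=> c Kc nc; apply: irreps_faithful.
    exact: (@maschke _ _ _ LP L1 (regular_rep H)).
  move=> X iX v; case: (degp iX) => dX.
    (* Every linear character of H restricts to the counit on K, so the index [None] accounts for
       all one-dimensional modules. *)
    have [g ->] := rep_weight dX.
    by rewrite -counit_lsh Kc -dual1E (nc None) scale0r.
  have [a [f [hf [f' fK _]]]] := allS X iX dX.
  rewrite -[ract c v]fK hf (_ : ract c (f v) = 0) -?(linear0 f) ?fK //.
  have [T ebx] := xP a; have [bx _ _ _ _] := ebx.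
  rewrite [f v](coord_basis bx (memvf _)) linear_sum big1 ?linear0 // => j _.
  by rewrite linearZ /= (kchar_act ebx) // (nc (Some (a, j))) scale0r scaler0.
Qed.

End EigenKchar.

Lemma tmap_piK_sumr (t : tens H H) :
  tmap idfun piK t = p%:R^-1 *: \sum_g tmap idfun (lsh (r g)) t.
Proof.
elim/tens_ind: t => [|s t IHs IHt|x y].
- by rewrite linear0 big1 ?scaler0 // => g _; rewrite linear0.
- rewrite linearD /= IHs IHt -scalerDr -big_split; congr (_ *: _).
  by apply: eq_bigr => g _; rewrite linearD.
rewrite tmap_tpure (bilinZr (@tpure_bilin _ _ _)) (bilin_sumr (@tpure_bilin _ _ _)).
by congr (_ *: _); apply: eq_bigr => g _; rewrite tmap_tpure.
Qed.

Lemma tmap_piKr (t : tens H H) : (forall g, tmap idfun (lsh (r g)) t = t) ->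
  tmap idfun piK t = t.
Proof. by move=> tK; rewrite tmap_piK_sumr (eq_bigr (fun=> t)) ?sum_const. Qed.

Lemma inK1 : inK 1. Proof. by move=> g; apply: lsh_one. Qed.
Lemma inKM a b : inK a -> inK b -> inK (a * b).
Proof. by move=> Ka Kb g; rewrite lshM ?Ka ?Kb. Qed.
Lemma inKD a b : inK a -> inK b -> inK (a + b).
Proof. by move=> Ka Kb g; rewrite linearD /= Ka Kb. Qed.
Lemma inKZ c a : inK a -> inK (c *: a).
Proof. by move=> Ka g; rewrite linearZ /= Ka. Qed.

Definition inKr (a : H) : Prop := forall g, rsh (r g) a = a.

Lemma antipode_inK a : inK a -> inKr (S a).
Proof. by move=> Ka g; rewrite rsh_antipode antipode_r Ka. Qed.

Lemma antipode_inKr a : inKr a -> exists2 b, inK b & a = S b.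
Proof.
move=> Ka; have [b ab] := linear_inj_surj (antipode_inj RP) a.
exists b => // g; apply: (antipode_inj RP).
by rewrite -[g]invgK -antipode_r -rsh_antipode ab Ka.
Qed.

Section KernelCommutative.
Variables (g0 : G) (z : k).
Hypotheses (g01 : g0 != 1%g) (zP : p.-primitive_root z).

Lemma K_comm a b : inK a -> inK b -> a * b = b * a.
Proof.
move=> Ka Kb; apply/eqP; rewrite -subr_eq0; apply/eqP.
apply: irreps_faithful; first exact: (@maschke _ _ _ LP L1 (regular_rep H)).
move=> X iX v; rewrite -rhoE linearB /= !rhoM add_lfunE opp_lfunE !comp_lfunE !rhoE.
apply/eqP; rewrite subr_eq0; apply/eqP; case: (degp iX) => dX.
  by have [g gE] := rep_weight dX; rewrite !gE !scalerA mulrC.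
have [T [x ebx]] := eigenbasis g01 zP iX dX; have [bx _ _ _ Kx] := ebx.
rewrite (coord_basis bx (memvf v)) !linear_sum; apply: eq_bigr => j _.
rewrite !linearZ /= (Kx a Ka) (Kx b Kb) !linearZ /= (Kx a Ka) (Kx b Kb).
by rewrite !linearZ /= !scalerA; congr (_ *: _); rewrite mulrACA.
Qed.

Lemma Kr_comm a b : inKr a -> inKr b -> a * b = b * a.
Proof.
move=> /antipode_inKr[a' Ka ->] /antipode_inKr[b' Kb ->].
by rewrite -!antipodeM K_comm.
Qed.
End KernelCommutative.

Lemma grouplike_r1 v g : grouplikes H v -> g != 1%g -> r g v = 1 ->
  forall g', r g' v = 1.
Proof.
move=> gv g1 gv1 g'; have [m _ ->] := g0_gen g1 g'.
elim: m => [|m IHm]; first by rewrite expg0 r1 dual1E gv.2.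
by rewrite expgS rM -lshE lsh_grouplike // gv1 scale1r.
Qed.

Lemma grouplike_inK v : grouplikes H v -> (forall g, r g v = 1) -> inK v /\ inKr v.
Proof.
by move=> gv v1; split=> g; rewrite ?lsh_grouplike ?rsh_grouplike // v1 scale1r.
Qed.

Lemma uR_r1 g g' : r g' (uR R (r g)) = 1.
Proof.
have gu := uR_grouplike RP (r_char g).
have [->|g1] := eqVneq g 1%g; last exact: grouplike_r1 gu g1 (uR_scalar1 g) g'.
by rewrite r1 (uR_one RP) (r_char g').1.
Qed.

Lemma vR_r1 g g' : r g' (vR R (r g)) = 1.
Proof.
have gu := vR_grouplike RP (r_char g).
have [->|g1] := eqVneq g 1%g; last exact: grouplike_r1 gu g1 (uv_scalar1 g) g'.
by rewrite r1 (vR_one RP) (r_char g').1.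
Qed.

(** * K as a Hopf subalgebra *)

Section KernelHopf.
Variables (g0 : G) (z : k).
Hypotheses (g01 : g0 != 1%g) (zP : p.-primitive_root z).

(** [lsh_uR] reads a u = u rsh(a), and a commutes with u because u lies in the commutative K. *)
Lemma inK_Kr a : inK a -> inKr a.
Proof.
move=> Ka g; have gu := uR_grouplike RP (r_char g).
have [Ku _] := grouplike_inK gu (uR_r1 g).
have := lsh_uR RP a (r_char g); rewrite Ka (K_comm g01 zP Ka Ku) => E.
by rewrite -[RHS]mul1r -(grouplike_antil gu) -mulrA E mulrA (grouplike_antil gu) mul1r.
Qed.

Lemma inKr_K a : inKr a -> inK a.
Proof.
move=> Ka g; have gu := uR_grouplike RP (r_char g).
have [_ Ku] := grouplike_inK gu (uR_r1 g).
have := lsh_uR RP a (r_char g); rewrite Ka -(Kr_comm g01 zP Ka Ku) => E.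
by rewrite -[LHS]mulr1 -(grouplike_antir gu) mulrA E -mulrA (grouplike_antir gu) mulr1.
Qed.

(** The left legs lie in K, hence are fixed by [rsh] as well; [tmap_lsh_rsh] transfers this to the
    right legs. *)
Lemma comul_K a : inK a -> tmap piK piK (comul a) = comul a.
Proof.
move=> Ka; transitivity (tmap idfun piK (tmap piK idfun (comul a))).
  by rewrite tmap_comp; apply: eq_tmap.
rewrite comul_Kl // tmap_piKr // => g; rewrite -tmap_lsh_rsh -(comul_Kl Ka).
rewrite tmap_comp; apply: eq_tmap => // x /=.
by rewrite inK_Kr //; apply: piK_in.
Qed.

Lemma evalt_K (f f' g g' : D) (t : tens H H) :
  (forall a, inK a -> f a = g a) -> (forall a, inK a -> f' a = g' a) ->
  tmap piK piK t = t -> evalt f f' t = evalt g g' t.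
Proof.
move=> fg fg' <-; rewrite !evalt_tmap; apply: (@eq_tlift k H H k^o) => x y.
by rewrite fg ?fg' //; apply: piK_in.
Qed.

Lemma Kconv_ext (f f' g g' : D) a : inK a ->
  (forall b, inK b -> f b = g b) -> (forall b, inK b -> f' b = g' b) ->
  (f * f') a = (g * g') a.
Proof. by move=> Ka fg fg'; rewrite -!evalt_comul; apply: evalt_K => //; apply: comul_K. Qed.

Lemma Kconv_mul (f g : D) : Kmul f -> Kmul g -> Kmul (f * g).
Proof.
move=> [f1 fM] [gg1 gM]; split.
  by rewrite -evalt_comul comul1 -[1]/(1 ⊗ 1) evalt_pure f1 gg1 mulr1.
move=> a b Ka Kb; rewrite -!evalt_comul comulM -(comul_K Ka) -(comul_K Kb).
elim/tens_ind: (comul a) => [|s s' IHs IHs'|x y].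
- by rewrite linear0 mul0r linear0 mul0r.
- by rewrite linearD mulrDl !linearD /= IHs IHs' mulrDl.
elim/tens_ind: (comul b) => [|s s' IHs IHs'|x' y'].
- by rewrite linear0 mulr0 linear0 mulr0.
- by rewrite linearD mulrDr !linearD /= IHs IHs' mulrDr.
rewrite !tmap_tpure tensM_pure !evalt_pure /= fM ?gM; try exact: piK_in.
exact: mulrACA.
Qed.

Lemma Kconv_inv f a : Kmul f -> inK a -> (antipode f * f) a = counit a.
Proof.
move=> [f1 fM] Ka; rewrite -evalt_comul -(comul_K Ka) evalt_tmap.
transitivity (f (tlift (fun x y => S x * y) (tmap piK piK (comul a)))).
  elim/tens_ind: (comul a) => [|s t IHs IHt|x y]; first by rewrite !linear0.
    by rewrite !linearD /= IHs IHt.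
  rewrite tmap_tpure !tlift_tpure; last 2 first.
  - exact: (bilin_comp antipode idfun (@mul_bilin k H)).
  - exact: (bilin_comp piK piK (bilin_mulk (antipode f) f)).
  rewrite fM ?dantiE //; last exact: piK_in.
  by apply/inKr_K/antipode_inK/piK_in.
by rewrite comul_K // antipodel linearZ /= f1; apply: mulr1.
Qed.

(** * The group of characters of K and its consequences *)

Section Chars.
Variables (m : nat) (I : finType) (n : I -> D).
Hypotheses (cardI : #|I| = (1 + m * p)%N) (nM : forall i, Kmul (n i)).
Hypotheses (n_inj : forall i j, (forall a, inK a -> n i a = n j a) -> i = j).
Hypotheses (n_faithful : forall a, inK a -> (forall i, n i a = 0) -> a = 0).

Lemma inK_prod (s : seq I) (b : I -> H) : (forall i, inK (b i)) -> inK (\prod_(i <- s) b i).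
Proof. by move=> Kb; apply: (big_ind inK) => //; [exact: inK1 | exact: inKM]. Qed.

Lemma Kmul_prod f (s : seq I) (b : I -> H) : Kmul f -> (forall i, inK (b i)) ->
  f (\prod_(i <- s) b i) = \prod_(i <- s) (f (b i) : k).
Proof.
move=> [f1 fM] Kb; elim: s => [|i s IHs]; first by rewrite !big_nil.
by rewrite !big_cons fM ?IHs //; apply: inK_prod.
Qed.

(* If f differs from all the n i, a product of elements of K separating f from
   each n i is killed by every n i but not by f. *)
Lemma kchars_complete f : Kmul f -> exists i, forall a, inK a -> f a = n i a.
Proof.
move=> Mf; apply: contrapT => nf; have /choice[a aP] : forall i, exists a, inK a /\ f a != n i a.
  move=> i; apply: contrapT => na; apply: nf; exists i => a Ka.
  by apply/eqP/negP => /negP fa; apply: na; exists a.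
pose b i := (f (a i) - n i (a i))^-1 *: (a i + (- n i (a i)) *: 1).
have Kb i : inK (b i).
  by apply: inKZ; apply: inKD; [case: (aP i) | apply/inKZ/inK1].
have fb i : f (b i) = 1.
  rewrite linearZ linearD linearZ /= Mf.1 -[_ *: 1]/(_ * 1) mulr1.
  by apply: mulVf; rewrite subr_eq0; case: (aP i).
have nb i : n i (b i) = 0.
  rewrite linearZ linearD linearZ /= (nM i).1 -[_ *: 1]/(_ * 1) mulr1 subrr.
  exact: mulr0.
have b0 : \prod_(i <- enum I) b i = 0.
  apply: n_faithful => [|j]; first exact: inK_prod.
  rewrite Kmul_prod //; apply/eqP; rewrite prodf_seq_eq0; apply/hasP; exists j.
    by rewrite mem_enum.
  by rewrite nb eqxx.
have := Kmul_prod (enum I) Mf Kb; rewrite b0 linear0 big1 => [/eqP|i _]; last exact: fb.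
by rewrite eq_sym oner_eq0.
Qed.

(** The translate f * n i is again a character of K, hence in the list; convolution with the
    antipode of f undoes the translation on K. *)
Lemma kchars_translate f : Kmul f -> exists s : I -> I, injective s /\
  forall i a, inK a -> n (s i) a = (f * n i) a.
Proof.
move=> Mf; have /choice[s sP] i : exists j, forall a, inK a -> (f * n i) a = n j a.
  by apply: kchars_complete; apply: Kconv_mul.
exists s; split=> [i j sij|i a Ka]; last by rewrite sP.
apply: n_inj => a Ka.
have E l b : inK b -> (antipode f * (f * n l)) b = n l b.
  move=> Kb; rewrite mulrA -[in RHS](mul1r (n l)).
  by apply: Kconv_ext => // c Kc; rewrite dual1E Kconv_inv.
rewrite -E // -[RHS]E //; apply: Kconv_ext => // b Kb.
by rewrite !sP // sij.
Qed.

(* Lagrange: translation by n j permutes the characters n i, so the product of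
   all the n i (v) is multiplied by (n j v)^|I|. *)
Lemma grouplike_trivial v : grouplikes H v -> (forall g, r g v = 1) -> v ^+ p = 1 -> v = 1.
Proof.
move=> gv rv vp; have [Kv _] := grouplike_inK gv rv.
have nv i : (n i v : k) ^+ p = 1.
  rewrite -[RHS](nM i).1 -vp; elim: (p) => [|q IHq]; first by rewrite !expr0 (nM i).1.
  rewrite !exprS (nM i).2 ?IHq //; elim: q {IHq} => [|q IHq]; first exact: inK1.
  by rewrite exprS; apply: inKM.
have nv0 i := unity_root_neq0 (prime_gt0 pp) (nv i).
apply/eqP; rewrite -subr_eq0; apply/eqP; apply: n_faithful.
  by rewrite -scaleN1r; apply: inKD => //; apply/inKZ/inK1.
move=> j; rewrite linearB /= (nM j).1; apply/eqP; rewrite subr_eq0; apply/eqP.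
have [s [s_inj sP]] := kchars_translate (nM j).
pose P : k := \prod_i n i v.
have P0 : P != 0 by apply/prodf_neq0 => i _; apply: nv0.
have : (n j v : k) ^+ #|I| * P = 1 * P.
  rewrite mul1r {2}/P (reindex_inj s_inj) -prodr_const -big_split.
  apply: eq_bigr => i _ /=; rewrite sP // -lshE lsh_grouplike // linearZ //.
move/(mulIf P0); rewrite cardI exprD mulnC exprM nv expr1n mulr1 expr1.
exact.
Qed.

Lemma uR_expr g q : uR R (r (g ^+ q)%g) = uR R (r g) ^+ q.
Proof.
elim: q => [|q IHq]; first by rewrite expg0 r1 (uR_one RP) expr0.
by rewrite expgSr rM (uR_mul RP) // IHq exprS.
Qed.
Lemma vR_expr g q : vR R (r (g ^+ q)%g) = vR R (r g) ^+ q.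
Proof.
elim: q => [|q IHq]; first by rewrite expg0 r1 (vR_one RP) expr0.
by rewrite expgS rM (vR_mul RP) // IHq exprS.
Qed.
Lemma expg_p g : (g ^+ p)%g = 1%g.
Proof.
have [->|g1] := eqVneq g 1%g; first exact: expg1n.
by rewrite -(g0_order g1) expg_order.
Qed.

Lemma uR_trivial g : uR R (r g) = 1.
Proof.
apply: grouplike_trivial; [exact: uR_grouplike | exact: uR_r1 |].
by rewrite -uR_expr expg_p r1 (uR_one RP).
Qed.
Lemma vR_trivial g : vR R (r g) = 1.
Proof.
apply: grouplike_trivial; [exact: vR_grouplike | exact: vR_r1 |].
by rewrite -vR_expr expg_p r1 (vR_one RP).
Qed.

Lemma lsh_rsh g a : lsh (r g) a = rsh (r g) a.
Proof. by have := lsh_uR RP a (r_char g); rewrite uR_trivial mulr1 mul1r. Qed.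

Lemma r_central g f : r g * f = f * r g.
Proof. by apply/lfunP => a; rewrite -lshE -rshE lsh_rsh. Qed.

(** Once u and v are 1, [lsh_R] and [rsh_R] say that both legs of R are fixed by the shifts. *)
Lemma R_K : tmap piK piK R = R.
Proof.
have Rl : tmap piK idfun R = R.
  apply: tmap_piKl => g; rewrite (lsh_R RP) // vR_trivial.
  by rewrite -[1 ⊗ 1]/(1 : tens H H) mul1r.
have Rr : tmap idfun piK R = R.
  apply: tmap_piKr => g; transitivity (tmap idfun (rsh (r g)) R).
    by apply: eq_tmap => // x; rewrite lsh_rsh.
  rewrite (rsh_R RP) // uR_trivial.
  by rewrite -[1 ⊗ 1]/(1 : tens H H) mul1r.
rewrite -[RHS]Rr -[in RHS]Rl tmap_comp; exact: eq_tmap.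
Qed.

(** R and Delta(a) both lie in the commutative algebra K ⊗ K, so conjugation by R is trivial on
    Delta(a). *)
Lemma K_cocomm a : inK a -> tswap (comul a) = comul a.
Proof.
move=> Ka; case: (RP) => Ru _ _ _ ->.
suff -> : R * comul a = comul a * R by rewrite mulrK.
rewrite -R_K -(comul_K Ka).
elim/tens_ind: R => [|s s' IHs IHs'|x y].
- by rewrite linear0 mul0r mulr0.
- by rewrite linearD mulrDl mulrDr IHs IHs'.
elim/tens_ind: (comul a) => [|s s' IHs IHs'|x' y'].
- by rewrite linear0 mul0r mulr0.
- by rewrite linearD mulrDl mulrDr IHs IHs'.
by rewrite !tmap_tpure !tensM_pure /= (K_comm g01 zP) ?[piK y * _](K_comm g01 zP) //; apply: piK_in.
Qed.

Lemma piK_comul a : tmap idfun piK (comul a) = comul (piK a).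
Proof.
rewrite tmap_piK_sumr /piK [RHS]linearZ [in RHS]linear_sum; congr (_ *: _).
apply: eq_bigr => g _; rewrite [in RHS]lsh_rsh comul_rsh; apply: eq_tmap => // x.
exact: lsh_rsh.
Qed.

(** The sum of the characters of K, extended to H along the projection [piK]. *)
Definition cointegral : D := \sum_i linfun (n i \o piK).

Lemma cointegralE a : cointegral a = \sum_i n i (piK a).
Proof. by rewrite /cointegral sum_lfunE; apply: eq_bigr => i _; rewrite lfunE. Qed.

Lemma cointegral1 : cointegral 1 = #|I|%:R.
Proof.
rewrite cointegralE piK_id; last exact: inK1.
by rewrite (eq_bigr (fun=> 1)) ?sumr_const // => i _; apply: (nM i).1.
Qed.

Lemma cointegralP f : f * cointegral = f 1 *: cointegral.
Proof.
apply/lfunP => a; rewrite -rshE scale_lfunE.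
suff -> : rsh cointegral a = (cointegral a : k) *: 1 by rewrite linearZ; apply: mulrC.
have cK b : cointegral (piK b) = cointegral b.
  by rewrite !cointegralE piK_id //; apply: piK_in.
(* As [cointegral] only sees the K-part, the claim reduces to a in K. There it can be tested on the
   characters n i, whose translations permute the sum. *)
have E : rsh cointegral a = rsh cointegral (piK a).
  rewrite /rsh -piK_comul; elim/tens_ind: (comul a) => [|s t IHs IHt|x y].
  - by rewrite !linear0.
  - by rewrite !linearD /= IHs IHt.
  by rewrite tmap_tpure !tlift_tpure ?cK //; apply: scale_bilinHr.
rewrite E -cK; move: (piK a) (piK_in a) => b Kb.
have Ky : inK (rsh cointegral b).
  by move=> g; rewrite lsh_rshC Kb.
apply/eqP; rewrite -subr_eq0; apply/eqP; apply: n_faithful.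
  rewrite -scaleN1r scalerA; apply: inKD => //; exact/inKZ/inK1.
move=> i; rewrite linearB linearZ /= (nM i).1 rshE -[_ *: 1]/(_ * 1) mulr1.
apply/eqP; rewrite subr_eq0; apply/eqP.
have [s [s_inj sP]] := kchars_translate (nM i).
rewrite [in RHS]cointegralE piK_id // (reindex_inj s_inj) /cointegral mulr_sumr sum_lfunE.
apply: eq_bigr => j _; rewrite sP //; apply: Kconv_ext => // c Kc.
by rewrite lfunE /= piK_id.
Qed.

End Chars.
End KernelHopf.

Lemma prim_root_ex : exists z : k, p.-primitive_root z.
Proof.
have [rs Dp] := closed_field_poly_normal ('X^p - 1 : {poly k}).
have p_gt0 := prime_gt0 pp.
rewrite (monicP _) ?monicXnsubC // scale1r in Dp.
have rn1 : all p.-unity_root rs.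
  by apply/allP=> y; rewrite -root_prod_XsubC -Dp.
have sz_r : (p < (size rs).+1)%N.
  by rewrite -(size_prod_XsubC rs id) -Dp size_XnsubC.
have [|y] := hasP (has_prim_root p_gt0 rn1 _ sz_r); last by exists y.
by rewrite -separable_prod_XsubC -Dp separable_Xn_sub_1 // p_neq0.
Qed.

Lemma dual_antipode_inj : injective (@antipode k (vdual H)).
Proof.
move=> f f' ff'; apply/lfunP => x.
have [y <-] := linear_inj_surj (antipode_inj RP) x.
by rewrite -!dantiE ff'.
Qed.

(** * Modules over the dual *)

Section Conclusion.
Variables (g0 : G) (z : k).
Hypotheses (g01 : g0 != 1%g) (zP : p.-primitive_root z).
Variables (m : nat) (I : finType) (n : I -> D).
Hypotheses (cardI : #|I| = (1 + m * p)%N) (nM : forall i, Kmul (n i)).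
Hypotheses (n_inj : forall i j, (forall a, inK a -> n i a = n j a) -> i = j).
Hypotheses (n_faithful : forall a, inK a -> (forall i, n i a = 0) -> a = 0).

Lemma dual_maschke (X : rep (vdual H)) : completely_reducible X.
Proof.
have I0 : (#|I|%:R : k) != 0 by have /pcharf0P-> := char0; rewrite cardI.
apply: (@maschke _ _ (#|I|%:R^-1 *: cointegral n)).
  move=> f; rewrite -scalerAr (cointegralP g01 zP cardI nM n_inj n_faithful).
  by rewrite !scalerA mulrC.
rewrite linearZ /= -[dcounit _]/(cointegral n 1) cointegral1 //.
exact: mulVf.
Qed.

Lemma r_expr g q : r (g ^+ q)%g = r g ^+ q.
Proof. by elim: q => [|q IHq]; rewrite ?expg0 ?r1 // expgS rM IHq exprS. Qed.

(** Evaluate at the integral L: non-trivial characters vanish there, so only the term i = 0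
    survives. *)
Lemma grouplike_projector_neq0 c : \sum_(i < p) (c^-1 ^+ i) *: r g0 ^+ i != 0.
Proof.
apply: contraTneq (oner_neq0 k) => /lfunP/(_ L).
rewrite sum_lfunE zero_lfunE (bigD1 (Ordinal (prime_gt0 pp))) //=.
rewrite big1 ?addr0 => [|i i0].
  by rewrite scale_lfunE !expr0 dual1E L1 scale1r => /eqP; rewrite negbK.
rewrite scale_lfunE -r_expr char_integral_eq0 ?scaler0 // -order_dvdn g0_order //.
by rewrite gtnNdvd // lt0n.
Qed.

(** The idempotent e = 1/p sum r g acts as the identity on X, while F e is F composed with [piK],
    hence zero. *)
Lemma vanish_on_K (X : rep (vdual H)) (F : D) :
  (forall x : X, ract (r g0) x = x) -> (forall a, inK a -> F a = 0) ->
  forall x : X, ract F x = 0.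
Proof.
move=> gX FK x; pose e : D := p%:R^-1 *: \sum_g r g.
have rX g : ract (r g) x = x.
  have [q _ ->] := g0_gen g01 g; rewrite r_expr.
  elim: q => [|q IHq]; first by rewrite expr0 ract1.
  by rewrite exprSr ractM gX.
have <- : ract e x = x.
  rewrite /e (bilinZl (ract_bilin X)) (bilin_suml (ract_bilin X)).
  by rewrite (eq_bigr (fun=> x)) ?sum_const.
rewrite -ractM (_ : F * e = 0) ?ract0 //; apply/lfunP => a.
rewrite zero_lfunE -rshE (_ : rsh e a = piK a) ?FK //; first exact: piK_in.
apply: vdual_sep => f; rewrite rshE /e -scalerAr scale_lfunE mulr_sumr sum_lfunE.
rewrite /piK [RHS]linearZ [in RHS]linear_sum; congr (_ *: _); apply: eq_bigr => g _ /=.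
by rewrite lshE (r_central g01 zP cardI nM n_inj n_faithful).
Qed.

(** A commutator in H* vanishes on K because K is cocommutative. *)
Lemma trivial_component_comm (X : rep (vdual H)) :
  (forall x : X, ract (r g0) x = x) ->
  forall (f f' : D) (x : X), ract (f * f') x = ract (f' * f) x.
Proof.
move=> gX f f' x; apply/eqP; rewrite -subr_eq0 -rhoE -[ract (f' * f) x]rhoE.
rewrite -opp_lfunE -add_lfunE -linearB rhoE; apply/eqP.
apply: (vanish_on_K gX) => a Ka; rewrite add_lfunE opp_lfunE -!evalt_comul.
rewrite -[in X in _ - X](K_cocomm g01 zP cardI nM n_inj n_faithful Ka).
apply/eqP; rewrite subr_eq0; apply/eqP.
elim/tens_ind: (comul a) => [|s t IHs IHt|u v]; first by rewrite !linear0.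
  by rewrite !linearD /= IHs IHt.
by rewrite tswap_tpure !evalt_pure; apply: mulrC.
Qed.

Lemma dual_nilpotent : nilpotent_hopf (vdual H).
Proof.
apply: (@nilpotent_tower k p (vdual H) (r g0) z) => //.
- exact: p_neq0.
- exact: dual_maschke.
- exact: dual_antipode_inj.
- exact/grouplike_dualP.
- exact: (r_central g01 zP cardI nM n_inj n_faithful).
- by rewrite -r_expr expg_p r1.
- by move=> c _; apply: grouplike_projector_neq0.
- exact: trivial_component_comm.
Qed.

End Conclusion.

Lemma central_and_nilpotent :
  (forall g f, r g * f = f * r g) /\ nilpotent_hopf (vdual H).
Proof.
have [g0 g01] : exists g0 : G, g0 != 1%g.
  apply: contrapT => n; have := prime_gt1 pp; rewrite -cardG.
  rewrite ltnNge => /negP; apply; rewrite -(card1 (1%g : G)).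
  apply/subset_leq_card/fintype.subsetP => g _; rewrite inE.
  by apply/negP => /negP gn; apply: n; exists g.
have [z zP] := prim_root_ex.
have [m [I [n [cI nM n_inj n_f]]]] := Kchar_list g01 zP.
split; last exact: (dual_nilpotent g01 zP cI nM n_inj n_f).
exact: (r_central g01 zP cI nM n_inj n_f).
Qed.

End PrimeDegrees.

Theorem proposition4p9 (k : closedFieldType) (p : nat) (H : hopfAlgType k) :
  [pchar k] =i pred0 ->
  prime p ->
  semisimple H ->
  char_degrees H = [set 1%N; p]%classic ->
  (grouplikes (vdual H) #= `I_p)%card ->
  quasitriangular H ->
  (grouplikes (vdual H) `<=` alg_center (vdual H))%classic /\
  nilpotent_hopf (vdual H).
Proof.
move=> char0 pp ss cd cG [R RP]; have [L LP L1] := semisimple_integral ss.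
have degp (X : rep H) : irrep X -> \dim {:X} = 1%N \/ \dim {:X} = p.
  move=> iX; have : char_degrees H (\dim {:X}) by exists X.
  by rewrite cd => -[/= ->|/= ->]; [left|right].
have [X0 [iX0 dX0]] : char_degrees H p by rewrite cd; right.
(* The cardinality hypothesis enumerates the group-likes of H* by ['I_p]; [fin_group] then makes
   them an abstract group G embedded by r. *)
have /card_set_bijP[f [fP f_inj f_onto]] := cG.
have /choice[e eE] : forall i : 'I_p, exists x, grouplikes (vdual H) x /\ f x = i.
  by move=> i; have [x gx fx] := f_onto i (ltn_ord i); exists x.
have eP i : grouplikes (vdual H) (e i) by have [] := eE i.
have e_inj : injective e.
  by move=> i j eij; apply: val_inj; rewrite /= -(eE i).2 -(eE j).2 eij.
have e_onto x : grouplikes (vdual H) x -> exists i, e i = x.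
  move=> gx; exists (Ordinal (fP x gx)); apply: f_inj; rewrite ?inE //.
  by rewrite (eE _).2.
have [|i j|i|G [r [r_inj r1 rM [re er] cardG]]] := fin_group e_inj.
- apply: e_onto; exact/grouplike_dualP/algchar1.
- by apply: e_onto; apply/grouplike_dualP/algcharM; apply/grouplike_dualP.
- have ci : algchar (e i) by apply/grouplike_dualP.
  have [j jE] := e_onto _ ((grouplike_dualP _).2 (algchar_anti ci)).
  by exists j; rewrite jE algchar_antil.
have r_char g : algchar (r g).
  by have [i ->] := er g; apply/grouplike_dualP.
have r_surj (x : vdual H) : algchar x -> exists g, r g = x.
  by move=> /grouplike_dualP/e_onto[i <-]; apply: re.
rewrite card_ord in cardG.
have [cen nil] := central_and_nilpotent char0 pp LP L1 RP r_inj r1 rM r_char r_surj cardG iX0 dX0 degp.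
split=> // x /grouplike_dualP/r_surj[g <-]; rewrite /alg_center /=.
by rewrite memv_cap memvf; apply/centvP => y _; apply: cen.
Qed.
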